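(* Assume the $D$-Hurwitz assumption holds. Then: (1) For every $\tau>0$, $$\limsup_{\varepsilon\searrow 0}\lambda(\Sigma^\varepsilon_{\mathcal K,\tau})\le\lambda(\bar\Sigma_\tau);$$ in particular, if $\bar\Sigma_\tau$ is ES then $\Sigma^\varepsilon_{\mathcal K,\tau}$ is ES for every $\varepsilon>0$ small enough. (2) If $\tilde\lambda(\hat\Sigma)<0$, then $$\limsup_{\varepsilon\searrow 0}\lambda(\Sigma^\varepsilon_{\mathcal K})\le\lambda(\tilde\Sigma);$$ in particular, if moreover $\tilde\Sigma$ is ES then $\Sigma^\varepsilon_{\mathcal K}$ is ES for every $\varepsilon>0$ small enough.
   Context: Setup. Fix an integer $d\ge 2$ and a compact set $\mathcal K\subset\{1,\dots,d-1\}\times \mathrm{GL}(d,\mathbb R)\times M_d(\mathbb R)\times M_d(\mathbb R)$, whose elements are written $\sigma=(\ell,P,\Lambda,R)$. For $\ell\in\{1,\dots,d\}$ and $\varepsilon\ge 0$, $E^\varepsilon_\ell$ is the $d\times d$ diagonal matrix whose first $\ell$ diagonal entries are $1$ and the others $\varepsilon$. For a set $\mathcal Z$ and $\tau\ge 0$, $\mathcal S_{\mathcal Z,\tau}$ is the set of right-continuous piecewise-constant functions $Z:\mathbb R_{\ge 0}\to\mathcal Z$ whose switching times $0=t_0<t_1<t_2<\cdots$ (finitely or infinitely many, without finite accumulation point) satisfy $t_{k+1}-t_k\ge\tau$; $Z_k$ denotes the value of $Z$ on $[t_k,t_{k+1})$, and $\mathcal S_{\mathcal Z}=\mathcal S_{\mathcal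 Z,0}$. For $\varepsilon>0$, $\tau\ge0$, the system $\Sigma^\varepsilon_{\mathcal K,\tau}$ is: for $\sigma=(\ell,P,\Lambda,R)\in\mathcal S_{\mathcal K,\tau}$, $E^\varepsilon_{\ell_k}P_k\dot X(t)=\Lambda_k X(t)$ for $t\in[t_k,t_{k+1})$, and $X(t_k)=R_{k-1}X(t_k^-)$ at each switching time $t_k$, $k\ge 1$; $\Sigma^\varepsilon_{\mathcal K}:=\Sigma^\varepsilon_{\mathcal K,0}$. For any (possibly dimension-varying) linear switched system $\Sigma$ with admissible signal class $\mathcal S$ and flow matrices $\Phi_\sigma(t,0)$, $\lambda(\Sigma)=\limsup_{t\to\infty}\sup_{\sigma\in\mathcal S}\frac{\log\|\Phi_\sigma(t,0)\|}{t}$ (with $\log 0=-\infty$, $\|\cdot\|$ the operator norm induced by Euclidean norms); $\Sigma$ is ES if there exist $c,\delta>0$ with $\|\Phi_\sigma(t,0)\|\le ce^{-\delta t}$ for all $t\ge0$ and all $\sigma\in\mathcal S$. Block notation. For $\sigma=(\ell,P,\Lambda,R)\in\mathcal K$ write $\Lambda P^{-1}=\begin{pmatrix}A&B\\ C&D\end{pmatrix}$ with $A\in M_\ell(\mathbb R)$, $D\in M_{d-\ell}(\mathbb R)$. The $D$-Hurwitz assumption: $D(\sigma)$ is Hurwitz for every $\sigma\in\mathcal K$. Under it set $M(\sigma)=A-BD^{-1}C\in M_\ell(\mathbb R)$ and $T(\sigma)=\begin{pmatrix}I_\ell&0\\ D^{-1}C&I_{d-\ell}\end{pmatrix}P$.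 For a matrix $Q$, $(Q)_{\ell,c}$ is its upper-left $\ell\times c$ block. Subscript $k$ means evaluation at $\sigma_k$. Auxiliary systems. $\bar\Sigma_\tau$ ($\tau\ge0$): for $\sigma\in\mathcal S_{\mathcal K,\tau}$, the state $\bar x(t)\in\mathbb R^{\ell_k}$ on $[t_k,t_{k+1})$ evolves by $\dot{\bar x}=M_k\bar x$, with jumps $\bar x(t_k)=(T_kR_{k-1}T_{k-1}^{-1})_{\ell_k,\ell_{k-1}}\bar x(t_k^-)$. $\hat\Sigma$: for $\sigma\in\mathcal S_{\mathcal K}$ with switching times $s_k$, state $y(s)\in\mathbb R^d$ with $\dot y=\mathrm{diag}(0_{\ell_k},D_k)y$ on $[s_k,s_{k+1})$ and $y(s_k)=T_kR_{k-1}T_{k-1}^{-1}y(s_k^-)$; with flow $\Phi^{\hat\Sigma}_\sigma$, $\tilde\lambda(\hat\Sigma)=\limsup_{s\to\infty}\sup\{\frac{\log\|\Phi^{\hat\Sigma}_\sigma(s,0)\|}{s}:\sigma\in\mathcal S_{\mathcal K},\ s=s_k \text{ a switching time of }\sigma, k\ge1\}$. $\hat{\mathcal F}=\{I_d\}\cup\{\prod_{i=1}^n R_iT_i^{-1}\mathrm{diag}(I_{\ell_i},e^{s_iD_i})T_i: n\in\mathbb N,\ s_i>0,\ \sigma_i=(\ell_i,P_i,\Lambda_i,R_i)\in\mathcal K\}$. $\tilde\Sigma$: for $\sigma\in\mathcal S_{\mathcal K}$ and any choice of matrices $F_0,F_1,\dots\in\hat{\mathcal F}$, state $\tilde x(t)\in\mathbb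 R^{\ell_k}$ on $[t_k,t_{k+1})$ with $\dot{\tilde x}=M_k\tilde x$ and jumps $\tilde x(t_k)=(T_kF_{k-1}R_{k-1}T_{k-1}^{-1})_{\ell_k,\ell_{k-1}}\tilde x(t_k^-)$ (the supremum in $\lambda(\tilde\Sigma)$ is over $\sigma$ and the choices of $F_k$). *)

(* Defs.v *)
From HB Require Import structures.
From mathcomp Require Import all_boot all_order all_algebra.
From mathcomp Require Import all_classical all_reals all_analysis.
From mathcomp Require Import complex.

Set Implicit Arguments.
Unset Strict Implicit.
Unset Printing Implicit Defensive.

Import Order.TTheory GRing.Theory Num.Theory.
Import numFieldNormedType.Exports.
Local Open Scope classical_set_scope.
Local Open Scope ring_scope.

Section Defs.
Variables (R : realType) (d : nat).

(** A mode sigma = (l, P, Lambda, R).  l ranges in 'I_d = {0,..,d-1};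
    the constraint l >= 1 and P invertible are hypotheses on K. *)
Record mode := Mode { ml : 'I_d; mP : 'M[R]_d; mL : 'M[R]_d; mR : 'M[R]_d }.

Lemma split_eq (l : 'I_d) : (l + (d - l) = d)%N.
Proof. exact: subnKC (ltnW (ltn_ord l)). Qed.

Definition splitmx (l : 'I_d) (Q : 'M[R]_d) : 'M[R]_(l + (d - l)) :=
  castmx (esym (split_eq l), esym (split_eq l)) Q.

Definition LPinv (s : mode) : 'M[R]_d := mL s *m invmx (mP s).
Definition Ablk (s : mode) : 'M[R]_(ml s) := ulsubmx (splitmx (ml s) (LPinv s)).
Definition Bblk (s : mode) : 'M[R]_(ml s, d - ml s) := ursubmx (splitmx (ml s) (LPinv s)).
Definition Cblk (s : mode) : 'M[R]_(d - ml s, ml s) := dlsubmx (splitmx (ml s) (LPinv s)).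
Definition Dblk (s : mode) : 'M[R]_(d - ml s) := drsubmx (splitmx (ml s) (LPinv s)).

Definition Mmat (s : mode) : 'M[R]_(ml s) :=
  Ablk s - Bblk s *m invmx (Dblk s) *m Cblk s.

Definition Tmat (s : mode) : 'M[R]_d :=
  castmx (split_eq (ml s), split_eq (ml s))
    (block_mx 1%:M 0 (invmx (Dblk s) *m Cblk s) 1%:M) *m mP s.

Definition ulblock (l c : 'I_d) (Q : 'M[R]_d) : 'M[R]_(l, c) :=
  ulsubmx (castmx (esym (split_eq l), esym (split_eq c)) Q).

Definition Eeps (l : nat) (e : R) : 'M[R]_d :=
  \matrix_(i, j) (if i == j then (if (i < l)%N then 1 else e) else 0).

End Defs.

Section Gen.
Variable R : realType.

Definition Hurwitz (n : nat) (A : 'M[R]_n) : Prop :=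
  forall z : R[i],
    eigenvalue (map_mx (fun x : R => (x%:C)%C) A) z ->
    complex.Re z < 0.

Definition expmx (n : nat) (A : 'M[R]_n) : 'M[R]_n :=
  limn (fun N : nat => \sum_(k < N) (k`!%:R)^-1 *: A ^+ k).

Definition enorm (n : nat) (x : 'cV[R]_n) : R :=
  Num.sqrt (\sum_i x i ord0 ^+ 2).
Definition opnorm (m n : nat) (A : 'M[R]_(m, n)) : R :=
  sup [set enorm (A *m x) | x in [set x : 'cV[R]_n | enorm x <= 1]].

(** Switching signals: values sg_val k on [sg_time k, sg_time k.+1);
    sg_num = Some n : exactly n pieces (n-1 switching times after 0),
    the last one lasting forever; sg_num = None : infinitely many. *)
Record signal (X : Type) := Signal
  { sg_val : nat -> X; sg_time : nat -> R; sg_num : option nat }.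

Definition inpieces (N : option nat) (k : nat) : bool :=
  if N is Some n then (k < n)%N else true.

Definition admissible (X : Type) (Z : set X) (tau : R) (s : signal X) : Prop :=
  [/\ sg_time s 0 = 0,
      (forall n, sg_num s = Some n -> (0 < n)%N),
      (forall k, inpieces (sg_num s) k -> Z (sg_val s k)),
      (forall k, inpieces (sg_num s) k.+1 ->
         [/\ sg_time s k < sg_time s k.+1,
             tau <= sg_time s k.+1 - sg_time s k &
             sg_val s k.+1 <> sg_val s k])
    & (sg_num s = None -> forall M : R, exists k, M < sg_time s k)].

Definition in_piece (X : Type) (s : signal X) (k : nat) (t : R) : Prop :=
  [/\ inpieces (sg_num s) k, sg_time s k <= t &
      (inpieces (sg_num s) k.+1 -> t < sg_time s k.+1)].

(** Flow of a (possibly dimension-varying) switched linear system with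
    state dimension dm k on the k-th piece, flow Fl k u over a duration u
    inside piece k, and jump J k applied at the switching time t_{k+1}. *)
Section Flow.
Variables (dm : nat -> nat) (Fl : forall k, R -> 'M[R]_(dm k))
          (J : forall k, 'M[R]_(dm k.+1, dm k)) (tt : nat -> R).

(** Phi(t_k, 0) (jump at t_k included) *)
Fixpoint preflow (k : nat) : 'M[R]_(dm k, dm 0) :=
  match k as k0 return 'M[R]_(dm k0, dm 0) with
  | 0 => 1%:M
  | k'.+1 => J k' *m (Fl k' (tt k'.+1 - tt k') *m preflow k')
  end.

Definition flowat (k : nat) (t : R) : 'M[R]_(dm k, dm 0) :=
  Fl k (t - tt k) *m preflow k.
End Flow.

Local Open Scope ereal_scope.

Definition logdiv (x t : R) : \bar R :=
  if x == 0%R then -oo else ((ln x / t)%R)%:E.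

Definition limsup_pinfty (g : R -> \bar R) : \bar R :=
  ereal_inf [set ereal_sup [set g t | t in [set t | T <= t]%R] | T in [set: R]].

Definition limsup_0plus (g : R -> \bar R) : \bar R :=
  ereal_inf [set ereal_sup [set g e | e in [set e | 0 < e < r]%R]
            | r in [set r : R | 0 < r]%R].

(** A switched system is described by NS t, the set of the norms
    ||Phi_sigma(t,0)|| over all admissible signals sigma. *)
Definition lyap (NS : R -> set R) : \bar R :=
  limsup_pinfty (fun t => ereal_sup [set logdiv x t | x in NS t]).

Definition ES (NS : R -> set R) : Prop :=
  exists c delta : R, (0 < c)%R /\ (0 < delta)%R /\
    forall t : R, (0 <= t)%R -> forall x, NS t x -> (x <= c * expR (- delta * t))%R.

End Gen.

Section Systems.
Variables (R : realType) (d : nat) (K : set (mode R d)).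
Local Notation sv s k := (sg_val s k).

Definition NS_eps (e tau : R) (t : R) : set R :=
  [set x | exists (s : signal R (mode R d)) k,
     [/\ admissible K tau s, (0 <= t)%R, in_piece s k t &
      x = opnorm (flowat (dm := fun _ => d)
           (fun k u => expmx (u *: (invmx (mP (sv s k)) *m
                       invmx (Eeps d (ml (sv s k)) e) *m mL (sv s k))))
           (fun k => mR (sv s k)) (sg_time s) k t)]].

Definition NS_bar (tau : R) (t : R) : set R :=
  [set x | exists (s : signal R (mode R d)) k,
     [/\ admissible K tau s, (0 <= t)%R, in_piece s k t &
      x = opnorm (flowat (dm := fun k => nat_of_ord (ml (sv s k)))
           (fun k u => expmx (u *: Mmat (sv s k)))
           (fun k => ulblock (ml (sv s k.+1)) (ml (sv s k))
                 (Tmat (sv s k.+1) *m mR (sv s k) *m invmx (Tmat (sv s k))))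
           (sg_time s) k t)]].

Definition diag0D (s : mode R d) : 'M[R]_d :=
  castmx (split_eq (ml s), split_eq (ml s)) (block_mx 0 0 0 (Dblk s)).
Definition diagIexpD (s : mode R d) (u : R) : 'M[R]_d :=
  castmx (split_eq (ml s), split_eq (ml s))
    (block_mx 1%:M 0 0 (expmx (u *: Dblk s))).

Definition NS_hat_sw (t : R) : set R :=
  [set x | exists (s : signal R (mode R d)) k,
     [/\ admissible K 0 s, (0 < k)%N, inpieces (sg_num s) k, t = sg_time s k &
      x = opnorm (preflow (dm := fun _ => d)
           (fun k u => expmx (u *: diag0D (sv s k)))
           (fun k => Tmat (sv s k.+1) *m mR (sv s k) *m invmx (Tmat (sv s k)))
           (sg_time s) k)]].

Definition lyap_tilde_hat : \bar R :=
  limsup_pinfty (fun t => ereal_sup [set logdiv x t | x in NS_hat_sw t]).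

Definition hatF (F : 'M[R]_d) : Prop :=
  F = 1%:M \/
  exists (n : nat) (u : nat -> R) (ss : nat -> mode R d),
    (forall i, (i < n)%N -> (0 < u i)%R /\ K (ss i)) /\
    F = \prod_(i < n) (mR (ss i) *m invmx (Tmat (ss i)) *m
                       diagIexpD (ss i) (u i) *m Tmat (ss i)).

Definition NS_tilde (t : R) : set R :=
  [set x | exists (s : signal R (mode R d)) (F : nat -> 'M[R]_d) k,
     [/\ admissible K 0 s, (forall j, hatF (F j)), (0 <= t)%R, in_piece s k t &
      x = opnorm (flowat (dm := fun k => nat_of_ord (ml (sv s k)))
           (fun k u => expmx (u *: Mmat (sv s k)))
           (fun k => ulblock (ml (sv s k.+1)) (ml (sv s k))
                 (Tmat (sv s k.+1) *m F k *m mR (sv s k) *m invmx (Tmat (sv s k))))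
           (sg_time s) k t)]].

End Systems.

(* Main.v *)
Require Import Defs.
From HB Require Import structures.
From mathcomp Require Import all_boot all_order all_algebra.
From mathcomp Require Import all_classical all_reals all_analysis.
From mathcomp Require Import complex ring lra.

Import Order.TTheory GRing.Theory Num.Theory.
Import numFieldNormedType.Exports.
Local Open Scope classical_set_scope.
Local Open Scope ring_scope.

Set Implicit Arguments.
Unset Strict Implicit.

(* Let [T] be the matrix [Tmat] of a mode. In the coordinates [w = T X] the mode
   reads [w1' = M w1 + B w2], [w2' = (D/e + F) w2 + G w1], and Duhamel's formula
   shows that, uniformly over the compact set [K] and for every rate [nu] above
   the spectral abscissae of all [M],
     slow part of the flow = exp(uM) w1 + O(e) exp(nu u),
     fast part of the flow = exp(uD/e) w2 + O(min(u, e)) exp(nu u).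
   The uniform constants come from quadratic Lyapunov functions, which are stable
   under perturbation of the mode. Every product of steps is then compared with a
   reference product, in a norm adapted to the latter.

   With a dwell time the reference is the (lifted) reduced system, and the [O(e)]
   errors are absorbed because the steps have length at least [tau].

   Without dwell time the reference is the fast system in the time [u / e]. A slow
   component is constant along that system, so its decay at switching times can
   only hold if each jump out of a mode kills the slow component, that is
   [R T^-1 (I, 0)^T = 0]. The reference then decays at rate [delta / e], which
   absorbs errors of size [min(u, e)] however short the steps are; the only
   remaining information in the tilde system is the growth of constant signals. *)

(** * Matrix exponentials *)

(** The obstacle is that products are known only up to a constant: a reference product of m steps is
    at most a constant times the product of its rates, and estimating step by step would raise that
    constant to the power m, while the number of switches in a given time is not bounded uniformly.
    The constant must enter once, which the adapted norm achieves; a step with error q then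
    multiplies this norm by at most its rate plus a constant times q, and it remains to bound this
    sum by the target rate of that same step. A dwell time leaves a room proportional to tau at each
    step. Without it, the room on a step of length u shrinks like u / e when u is small, so an error
    of order e would be too large and the bound by min(u, e) is essential. An upper bound on a
    Lyapunov exponent controls large times only, whereas the adapted norm needs every subword,
    however short; hence the device of waiting in the first mode. Constant signals turn the growth
    hypothesis into a spectral bound on each [Mmat], which is where the quadratic Lyapunov functions
    start. *)

Section SumNorm.
Variable R : realType.

(** The entrywise sum is submultiplicative for rectangular matrices of any sizes, so one norm serves
    for vectors, blocks and full matrices. *)
Definition N1 m n (A : 'M[R]_(m, n)) : R := \sum_i \sum_j `|A i j|.

Lemma N1_ge0 m n (A : 'M[R]_(m, n)) : 0 <= N1 A.
Proof. by apply: sumr_ge0 => i _; apply: sumr_ge0 => j _. Qed.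

Lemma N1_entry m n (A : 'M[R]_(m, n)) i j : `|A i j| <= N1 A.
Proof.
rewrite /N1 (bigD1 i) //= (bigD1 j) //= -addrA lerDl addr_ge0 //.
  by apply: sumr_ge0.
by apply: sumr_ge0 => k _; apply: sumr_ge0.
Qed.

Lemma N1D m n (A B : 'M[R]_(m, n)) : N1 (A + B) <= N1 A + N1 B.
Proof.
rewrite /N1 -big_split /=; apply: ler_sum => i _.
rewrite -big_split /=; apply: ler_sum => j _; rewrite mxE; exact: ler_normD.
Qed.

Lemma N1N m n (A : 'M[R]_(m, n)) : N1 (- A) = N1 A.
Proof. by apply: eq_bigr => i _; apply: eq_bigr => j _; rewrite mxE normrN. Qed.

Lemma N1Z m n a (A : 'M[R]_(m, n)) : N1 (a *: A) = `|a| * N1 A.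
Proof.
rewrite /N1 mulr_sumr; apply: eq_bigr => i _; rewrite mulr_sumr.
by apply: eq_bigr => j _; rewrite mxE normrM.
Qed.

Lemma N1_0 m n : N1 (0 : 'M[R]_(m, n)) = 0.
Proof. by rewrite -(scale0r 0) N1Z normr0 mul0r. Qed.

Lemma N1_tr m n (A : 'M[R]_(m, n)) : N1 A^T = N1 A.
Proof.
by rewrite /N1 exchange_big; apply: eq_bigr => i _; apply: eq_bigr => j _; rewrite mxE.
Qed.

Lemma N1_row m n (A : 'M[R]_(m, n)) i : \sum_j `|A i j| <= N1 A.
Proof.
by rewrite /N1 [leRHS](bigD1 i) //= lerDl; apply: sumr_ge0 => l _; apply: sumr_ge0.
Qed.

Lemma N1M m n p (A : 'M[R]_(m, n)) (B : 'M[R]_(n, p)) : N1 (A *m B) <= N1 A * N1 B.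
Proof.
rewrite {1 2}/N1 mulr_suml; apply: ler_sum => i _.
rewrite [leRHS](_ : _ = \sum_j (`|A i j| * N1 B)); last by rewrite mulr_suml.
apply: (@le_trans _ _ (\sum_j \sum_k `|A i k| * `|B k j|)).
  apply: ler_sum => j _; rewrite mxE; apply: le_trans (ler_norm_sum _ _ _) _.
  by apply: ler_sum => k _; rewrite normrM.
rewrite exchange_big /=; apply: ler_sum => k _.
rewrite -mulr_sumr; apply: ler_wpM2l => //.
exact: N1_row.
Qed.

Lemma N1_1 n : N1 (1%:M : 'M[R]_n) = n%:R.
Proof.
rewrite /N1 (eq_bigr (fun=> 1)) ?sumr_const ?card_ord // => i _.
rewrite (bigD1 i) //= mxE eqxx normr1 big1 ?addr0 // => j /negbTE ji.
by rewrite mxE eq_sym ji normr0.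
Qed.

Lemma N1_bound m n (A : 'M[R]_(m, n)) c :
  (forall i j, `|A i j| <= c) -> N1 A <= (m * n)%:R * c.
Proof.
move=> h; apply: (@le_trans _ _ (\sum_(i < m) \sum_(j < n) c)).
  by apply: ler_sum => i _; apply: ler_sum => j _.
by rewrite !sumr_const !card_ord -mulrnA mulr_natl mulnC.
Qed.

Lemma N1_cols m n (A : 'M[R]_(m, n)) c :
  (forall x : 'cV[R]_n, N1 (A *m x) <= c * N1 x) -> N1 A <= n%:R * c.
Proof.
move=> h.
have -> : N1 A = \sum_j N1 (col j A).
  rewrite /N1 exchange_big; apply: eq_bigr => j _; apply: eq_bigr => i _.
  by rewrite big_ord1 mxE.
have -> : n%:R * c = \sum_(j < n) c by rewrite sumr_const card_ord mulr_natl.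
apply: ler_sum => j _; rewrite colE; apply: le_trans (h _) _.
suff -> : N1 (delta_mx j (0 : 'I_1) : 'cV[R]_n) = 1 by rewrite mulr1.
rewrite /N1 (bigD1 j) //= big_ord1 mxE !eqxx normr1 big1 ?addr0 // => i /negbTE ij.
by rewrite big_ord1 mxE ij normr0.
Qed.

End SumNorm.

(** * The exponential series, its derivative, and mean value estimates *)

Section Exp.
Variable R : realType.

(** Entrywise limits give access to scalar power series; [ecvgP] returns to the matrix topology in
    which [expmx] is a limit. *)
Definition ecvg m n (S : nat -> 'M[R]_(m, n)) (L : 'M[R]_(m, n)) :=
  forall i j, S k i j @[k --> \oo] --> L i j.

Lemma ecvgP m n (S : nat -> 'M[R]_(m, n)) L : ecvg S L -> S @ \oo --> L.
Proof.
move=> h P [Q Qn sub]; apply: (@filterS _ _ _ [set k | forall i j, Q i j (S k i j)]).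
  by move=> k /= hk; apply: sub.
apply: (@filter_forall _ _ (fun i k => forall j, Q i j (S k i j)) \oo _) => i.
apply: (@filter_forall _ _ (fun j k => Q i j (S k i j)) \oo _) => j.
exact: (h i j _ (Qn i j)).
Qed.

Lemma ecvg_cst m n (A : 'M[R]_(m, n)) : ecvg (fun=> A) A.
Proof. by move=> i j; exact: cvg_cst. Qed.

Lemma ecvgM m n p (S : nat -> 'M[R]_(m, n)) (T : nat -> 'M[R]_(n, p)) L M :
  ecvg S L -> ecvg T M -> ecvg (fun k => S k *m T k) (L *m M).
Proof.
move=> hS hT i j; rewrite mxE.
have -> : (fun k => (S k *m T k) i j) = (fun k => \sum_l (S k i l * T k l j)).
  by apply/funext => k; rewrite mxE.
apply: cvg_big => [|l _]; first exact: add_continuous.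
by apply: cvgM; [exact: hS|exact: hT].
Qed.

Lemma ecvg_unique m n (S : nat -> 'M[R]_(m, n)) L M : ecvg S L -> ecvg S M -> L = M.
Proof.
move=> h1 h2; apply/matrixP => i j.
exact: (cvg_unique _ (h1 i j) (h2 i j)).
Qed.

(** Power series in u of the (i, j) entry of A^m exp(uA). The shift [m] is there because termwise
    differentiation turns [m] into [m.+1]. *)
Definition expcoef n (A : 'M[R]_n) m i j : R^nat :=
  fun k => (A ^+ (k + m)) i j / k`!%:R.

Lemma pow_entry n (A : 'M[R]_n) k i j : `|(A ^+ k) i j| <= N1 A ^+ k.
Proof.
elim: k i j => [|k IH] i j.
  by rewrite !expr0 [X in `|X|]mxE; case: (i == j); rewrite ?normr1 ?normr0.
rewrite !exprS [X in `|X|]mxE; apply: le_trans (ler_norm_sum _ _ _) _.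
apply: (@le_trans _ _ (\sum_l `|A i l| * N1 A ^+ k)).
  by apply: ler_sum => l _; rewrite normrM; apply: ler_wpM2l.
rewrite -mulr_suml; apply: ler_wpM2r; first by rewrite exprn_ge0 ?N1_ge0.
exact: N1_row.
Qed.

Lemma is_cvg_expcoef n (A : 'M[R]_n) m i j x : cvgn (pseries (expcoef A m i j) x).
Proof.
apply: normed_cvg.
apply: (@series_le_cvg _ _ (fun k => N1 A ^+ m * exp_coeff (N1 A * `|x|) k)).
- by move=> k /=.
- by move=> k; rewrite mulr_ge0 ?exprn_ge0 ?N1_ge0 ?exp_coeff_ge0 ?mulr_ge0 ?N1_ge0.
- move=> k /=; rewrite /expcoef !normrM normfV (ger0_norm (ler0n _ _)) normrX.
  rewrite /exp_coeff /= exprMn mulrA mulrA -exprD addnC.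
  rewrite -[leLHS]mulrA -[leRHS]mulrA [_^-1 * _]mulrC.
  by apply: ler_wpM2r; rewrite ?mulr_ge0 ?invr_ge0 ?exprn_ge0 ?pow_entry // addnC pow_entry.
- rewrite (_ : series _ = (fun k => N1 A ^+ m * series (exp_coeff (N1 A * `|x|)) k)).
    by apply: is_cvgMr; exact: is_cvg_series_exp_coeff.
  by apply/funext => k; rewrite /series /= mulr_sumr.
Qed.

Lemma pseries_diffs_expcoef n (A : 'M[R]_n) m i j :
  pseries_diffs (expcoef A m i j) = expcoef A m.+1 i j.
Proof.
apply/funext => k; rewrite /pseries_diffs /expcoef addSnnS factS natrM invfM.
by rewrite mulrCA; congr (_ * _); rewrite mulrA mulfV ?mul1r ?pnatr_eq0.
Qed.

Lemma expmx_partial n (A : 'M[R]_n) u N i j :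
  (\sum_(k < N) (k`!%:R)^-1 *: (u *: A) ^+ k) i j = pseries (expcoef A 0 i j) u N.
Proof.
rewrite /pseries /series /= big_mkord summxE; apply: eq_bigr => k _.
have -> : (u *: A) ^+ k = u ^+ k *: A ^+ k.
  elim: (nat_of_ord k) => [|q IH]; first by rewrite !expr0 scale1r.
  rewrite !exprS IH -[_ * _]/((u *: A) *m (u ^+ q *: A ^+ q)).
  by rewrite -scalemxAl -scalemxAr scalerA.
by rewrite !mxE /expcoef addn0 mulrCA mulrC [_^-1 * _]mulrC.
Qed.

Lemma expmx_ecvg n (A : 'M[R]_n) u :
  ecvg (fun N => \sum_(k < N) (k`!%:R)^-1 *: (u *: A) ^+ k) (expmx (u *: A)).
Proof.
pose L := \matrix_(i, j) limn (pseries (expcoef A 0 i j) u).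
have h : ecvg (fun N => \sum_(k < N) (k`!%:R)^-1 *: (u *: A) ^+ k) L.
  move=> i j; rewrite mxE (_ : (fun _ => _) = pseries (expcoef A 0 i j) u).
    exact: is_cvg_expcoef.
  by apply/funext => N; rewrite expmx_partial.
suff -> : expmx (u *: A) = L by [].
by apply: cvg_lim; [exact: norm_hausdorff|exact: ecvgP].
Qed.

Lemma expmxE n (A : 'M[R]_n) u i j :
  expmx (u *: A) i j = limn (pseries (expcoef A 0 i j) u).
Proof.
have := @expmx_ecvg n A u i j.
under eq_fun do rewrite expmx_partial.
by move/(cvg_lim (@norm_hausdorff _ _)).
Qed.

(** The relation passes to powers, then to partial sums and limits. A rectangular [P] is allowed, so
    this covers both changes of coordinates and restrictions to invariant blocks. *)
Lemma expmx_intertwine m n (P : 'M[R]_(m, n)) (A : 'M[R]_n) (B : 'M[R]_m) u :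
  P *m A = B *m P -> P *m expmx (u *: A) = expmx (u *: B) *m P.
Proof.
move=> PA; apply: (@ecvg_unique _ _ (fun N => P *m \sum_(k < N) (k`!%:R)^-1 *: (u *: A) ^+ k)).
  by apply: ecvgM; [exact: ecvg_cst|exact: expmx_ecvg].
rewrite (_ : (fun _ => _) = (fun N => (\sum_(k < N) (k`!%:R)^-1 *: (u *: B) ^+ k) *m P)).
  by apply: ecvgM; [exact: expmx_ecvg|exact: ecvg_cst].
apply/funext => N; rewrite mulmx_sumr mulmx_suml; apply: eq_bigr => k _.
rewrite -scalemxAr -scalemxAl; congr (_ *: _).
elim: (nat_of_ord k) => [|q IH]; first by rewrite !expr0 mulmx1 mul1mx.
rewrite !exprS -[X in P *m X]/((u *: A) *m ((u *: A) ^+ q)).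
rewrite -[X in X *m P]/((u *: B) *m ((u *: B) ^+ q)).
have -> : P *m (u *: A *m (u *: A) ^+ q) = u *: B *m (P *m (u *: A) ^+ q).
  by rewrite !mulmxA -scalemxAr PA scalemxAl.
by rewrite IH mulmxA.
Qed.

Definition mder m n (f f' : R -> 'M[R]_(m, n)) :=
  forall u i j, is_derive u (1 : R) (fun s => f s i j) (f' u i j).

Lemma mder_expmx n (A : 'M[R]_n) :
  mder (fun u => expmx (u *: A)) (fun u => A *m expmx (u *: A)).
Proof.
move=> u i j.
have -> : (fun s => expmx (s *: A) i j) = (fun s => limn (pseries (expcoef A 0 i j) s)).
  by apply/funext => s; rewrite expmxE.
have -> : (A *m expmx (u *: A)) i j = limn (pseries (pseries_diffs (expcoef A 0 i j)) u).
  apply/esym/cvg_lim; first exact: norm_hausdorff.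
  have hc : ecvg (fun N => A *m \sum_(k < N) (k`!%:R)^-1 *: (u *: A) ^+ k) (A *m expmx (u *: A)) := ecvgM (@ecvg_cst n n A) (@expmx_ecvg n A u).
  apply: cvg_trans (hc i j); apply: near_eq_cvg; near=> N.
  rewrite pseries_diffs_expcoef mxE.
  under eq_bigr do rewrite expmx_partial.
  rewrite /pseries /series /=.
  under eq_bigr do rewrite mulr_sumr.
  rewrite exchange_big /=; apply: eq_bigr => k _.
  rewrite /expcoef addn1 exprS [in RHS]mxE !mulr_suml.
  by apply: eq_bigr => l _; rewrite addn0 !mulrA.
apply: (@pseries_snd_diffs _ _ (`|u| + 1)); rewrite ?pseries_diffs_expcoef; try exact: is_cvg_expcoef.
by rewrite ltr_normr ltrDl ltr01.
Unshelve. all: by end_near. Qed.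

Lemma expmx0 n (A : 'M[R]_n) : expmx (0 *: A) = 1%:M.
Proof.
apply: ecvg_unique (@expmx_ecvg n A 0) _ => i j.
suff h : {near \oo, (fun=> (1%:M : 'M[R]_n) i j) =1
    (fun N => (\sum_(k < N) k`!%:R^-1 *: (0 *: A) ^+ k) i j)}.
  by apply: cvg_trans (near_eq_cvg h) _; exact: cvg_cst.
near=> N.
have N0 : (0 < N)%N by near: N; exact: nbhs_infty_gt.
move: N0; set N' := N; clearbody N'; case: N' => // N' _ /=.
congr (fun_of_matrix _ i j).
rewrite big_ord_recl expr0 fact0 invr1 scale1r big1 ?addr0 // => k _.
by rewrite scale0r expr0n /= scaler0.
Unshelve. all: by end_near. Qed.

Lemma expmxz n u : expmx (u *: (0 : 'M[R]_n)) = 1%:M.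
Proof. by rewrite scaler0 -(scale0r (0 : 'M[R]_n)) expmx0. Qed.

Lemma mder_cst m n (A : 'M[R]_(m, n)) : mder (fun=> A) (fun=> 0).
Proof. by move=> u i j; rewrite mxE; exact: is_derive_cst. Qed.

Lemma mderM m n p (f f' : R -> 'M[R]_(m, n)) (g g' : R -> 'M[R]_(n, p)) :
  mder f f' -> mder g g' ->
  mder (fun s => f s *m g s) (fun s => f' s *m g s + f s *m g' s).
Proof.
move=> hf hg u i j.
rewrite (_ : (fun _ => _) = \sum_l (fun s => f s i l * g s l j)); last first.
  by apply/funext => s; rewrite mxE fct_sumE.
rewrite [X in is_derive _ _ _ X](_ : _ = \sum_l (f' u i l * g u l j + f u i l * g' u l j)); last first.
  by rewrite !mxE -big_split.
apply: is_derive_sum => l.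
apply: is_derive_eq; first by apply: is_deriveM; [exact: hf|exact: hg].
by rewrite /= addrC; congr (_ + _); rewrite /GRing.scale /= mulrC.
Qed.

Lemma mder_eq m n (f f' g' : R -> 'M[R]_(m, n)) :
  mder f f' -> (forall s, f' s = g' s) -> mder f g'.
Proof. by move=> hf e u i j; rewrite -e; exact: hf. Qed.

Lemma mder_affine m n (f f' : R -> 'M[R]_(m, n)) (a b : R) :
  mder f f' -> mder (fun s => f (a * s + b)) (fun s => a *: f' (a * s + b)).
Proof.
move=> hf u i j; rewrite mxE.
have ha : is_derive u (1 : R) (fun s : R => a * s + b) a.
  have h1 : is_derive u (1 : R) ((a \*: @id R) + cst b) (a *: (1 : R) + 0).
    by apply: is_deriveD; exact: is_deriveZ.
  rewrite (_ : (fun _ => _) = (a \*: @id R) + cst b) //.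
  by rewrite addr0 /GRing.scale /= mulr1 in h1.
have := @is_derive1_comp R (fun s => f s i j) (fun s : R => a * s + b) u _ _ (hf _ i j) ha.
by rewrite mulrC.
Qed.

Lemma is_derive_continuous (f : R -> R) (u df : R) :
  is_derive u (1 : R) f df -> {for u, continuous f}.
Proof. by move=> [h _]; apply: differentiable_continuous; exact/derivable1_diffP. Qed.

Lemma le_of_derive (f f' : R -> R) (u : R) : 0 <= u ->
  (forall s, is_derive s (1 : R) f (f' s)) ->
  (forall s, 0 <= s <= u -> f' s <= 0) -> f u <= f 0.
Proof.
move=> u0 hf h.
have [|c + e] := @MVT_segment R f f' 0 u u0 (fun x _ => hf x).
  by apply: continuous_subspaceT => x; exact: is_derive_continuous (hf x).
rewrite in_itv /= => /h c0.
by rewrite -subr_le0 e subr0 mulr_le0_ge0.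
Qed.

(** Replaces integration in Duhamel's formula: instead of integrating a bound on the derivative, one
    exhibits a primitive [g] of it. Each entry of [f], with either sign, minus [g] is
    nonincreasing. *)
Lemma mder_mean m n (f f' : R -> 'M[R]_(m, n)) (g g' : R -> R) u : 0 <= u ->
  mder f f' -> (forall s, is_derive s (1 : R) g (g' s)) ->
  (forall s, 0 <= s <= u -> N1 (f' s) <= g' s) ->
  N1 (f u - f 0) <= (m * n)%:R * (g u - g 0).
Proof.
move=> u0 hf hg h; apply: N1_bound => i j; rewrite !mxE ler_norml; apply/andP; split.
  rewrite lerNl opprB.
  suff : - f u i j - g u <= - f 0 i j - g 0 by lra.
  apply: (@le_of_derive (- (fun s => f s i j) - g) (fun s => - f' s i j - g' s)) => //.
    by move=> s; apply: is_deriveB => //; apply: is_deriveN; exact: hf.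
  move=> s /h /(le_trans (N1_entry (f' s) i j)); rewrite ler_norml => /andP[+ _].
  by rewrite lerNl subr_le0.
suff : f u i j - g u <= f 0 i j - g 0 by lra.
apply: (@le_of_derive ((fun s => f s i j) - g) (fun s => f' s i j - g' s)) => //.
  by move=> s; apply: is_deriveB => //; exact: hf.
move=> s /h /(le_trans (N1_entry (f' s) i j)); rewrite ler_norml => /andP[_].
by rewrite subr_le0.
Qed.

Lemma mder_const m n (f : R -> 'M[R]_(m, n)) u v : mder f (fun=> 0) -> f u = f v.
Proof.
move=> hf; apply/matrixP => i j; apply: (is_derive_0_is_cst _ (f := fun s => f s i j)) => x.
by have := hf x i j; rewrite mxE.
Qed.

Lemma expmx_comm n (A : 'M[R]_n) u : A *m expmx (u *: A) = expmx (u *: A) *m A.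
Proof. exact: expmx_intertwine. Qed.

Lemma mder_expmx_affine n (A : 'M[R]_n) a b :
  mder (fun s => expmx ((a * s + b) *: A))
       (fun s => a *: (A *m expmx ((a * s + b) *: A))).
Proof. exact: (mder_affine a b (mder_expmx A)). Qed.

Lemma expmxN n (A : 'M[R]_n) u : expmx (- u *: A) *m expmx (u *: A) = 1%:M.
Proof.
pose f s := expmx ((-1 * s + 0) *: A) *m expmx (s *: A).
have hf : mder f (fun=> 0).
  apply: mder_eq; first exact: mderM (mder_expmx_affine A (-1) 0) (mder_expmx A).
  move=> s /=; rewrite -scalemxAl expmx_comm -mulmxA scaleN1r addNr //.
have := mder_const u 0 hf.
by rewrite /f mulN1r addr0 mulr0 addr0 expmx0 mul1mx.
Qed.

Lemma expmxD n (A : 'M[R]_n) u v :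
  expmx ((u + v) *: A) = expmx (u *: A) *m expmx (v *: A).
Proof.
pose f s := expmx ((-1 * s + 0) *: A) *m expmx ((1 * s + v) *: A).
have hf : mder f (fun=> 0).
  apply: mder_eq; first exact: mderM (mder_expmx_affine A (-1) 0) (mder_expmx_affine A 1 v).
  by move=> s /=; rewrite -scalemxAl expmx_comm scale1r -mulmxA scaleN1r addNr.
have := mder_const u 0 hf.
rewrite /f mulN1r addr0 mul1r !mulr0 !addr0 !add0r expmx0 mul1mx => <-.
by rewrite mulmxA; have := expmxN A (- u); rewrite opprK => ->; rewrite mul1mx.
Qed.

End Exp.

(** * Quadratic Lyapunov functions *)

Section Lyapunov.
Variable R : realType.

Definition bf n (Q : 'M[R]_n) (x y : 'cV[R]_n) : R := (x^T *m Q *m y) 0 0.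

Lemma bf_le n (Q : 'M[R]_n) x y : `|bf Q x y| <= N1 Q * N1 x * N1 y.
Proof.
apply: le_trans (N1_entry _ 0 0) _; apply: le_trans (N1M _ _) _.
apply: ler_wpM2r; first exact: N1_ge0.
by apply: le_trans (N1M _ _) _; rewrite N1_tr mulrC.
Qed.

Lemma bfDr n (Q : 'M[R]_n) x y z : bf Q x (y + z) = bf Q x y + bf Q x z.
Proof. by rewrite /bf mulmxDr mxE. Qed.

Lemma bf_sym n (Q : 'M[R]_n) x y : Q^T = Q -> bf Q x y = bf Q y x.
Proof.
move=> hQ; rewrite /bf -[in LHS](trmxK (_ *m y)) mxE !trmx_mul hQ trmxK mulmxA //.
Qed.

(* [bf Q x x] is a squared norm equivalent to the [N1] norm whose logarithmic
   derivative along the flow of [A] is at most [2 * kap]. *)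
Definition is_lyap n (Q A : 'M[R]_n) (kap C : R) :=
  [/\ Q^T = Q, N1 Q <= C, (forall x, N1 x ^+ 2 <= C * bf Q x x) &
      (forall x, bf Q x (A *m x) <= kap * bf Q x x)].

Lemma is_lyap_ge0 n (Q A : 'M[R]_n) kap C x : 0 < C -> is_lyap Q A kap C -> 0 <= bf Q x x.
Proof.
move=> C0 [_ _ h _]; have := le_trans (sqr_ge0 _) (h x).
by rewrite pmulr_rge0.
Qed.

Lemma is_lyap_up n (Q A : 'M[R]_n) kap C : 0 < C -> is_lyap Q A kap C ->
  forall x, bf Q x x <= C * N1 x ^+ 2.
Proof.
move=> C0 [_ h _ _] x; apply: le_trans (ler_norm _) _; apply: le_trans (bf_le _ _ _) _.
by rewrite -mulrA -expr2; apply: ler_wpM2r; rewrite ?sqr_ge0.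
Qed.

Lemma is_lyap_mono n (Q A : 'M[R]_n) kap kap' C C' : 0 < C -> kap <= kap' -> C <= C' ->
  is_lyap Q A kap C -> is_lyap Q A kap' C'.
Proof.
move=> C0 hk hC h; have h0 x := is_lyap_ge0 x C0 h; case: h => s n1 c d; split => //.
- exact: le_trans hC.
- by move=> x; apply: le_trans (c x) _; apply: ler_wpM2r.
- by move=> x; apply: le_trans (d x) _; apply: ler_wpM2r.
Qed.

(** One factor [C] comes from the size of [Q], the other from bounding the squared norm of x by the
    form, so the rate changes by at most C^2 times the distance of the matrices. *)
Lemma is_lyap_perturb n (Q A B : 'M[R]_n) kap C g : 0 < C ->
  is_lyap Q A kap C -> C ^+ 2 * N1 (B - A) <= g -> is_lyap Q B (kap + g) C.
Proof.
move=> C0 h hg; have h0 x := is_lyap_ge0 x C0 h; case: h => s n1 c d; split => // x.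
have -> : B *m x = A *m x + (B - A) *m x by rewrite -mulmxDl addrCA subrr addr0.
rewrite bfDr mulrDl; apply: lerD => //.
apply: le_trans (ler_norm _) _; apply: le_trans (bf_le _ _ _) _.
apply: (@le_trans _ _ (C * N1 (B - A) * N1 x ^+ 2)).
  rewrite -[leLHS]mulrA -[leRHS]mulrA; apply: ler_pM => //; rewrite ?mulr_ge0 ?N1_ge0 //.
  rewrite mulrC expr2 mulrA; apply: ler_wpM2r; rewrite ?N1_ge0 //; exact: N1M.
apply: (@le_trans _ _ (C * N1 (B - A) * (C * bf Q x x))).
  by apply: ler_wpM2l => //; rewrite mulr_ge0 ?N1_ge0 // ltW.
rewrite [leLHS](_ : _ = C ^+ 2 * N1 (B - A) * bf Q x x); last by ring.
by apply: ler_wpM2r.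
Qed.

Lemma mder_tr m n (f f' : R -> 'M[R]_(m, n)) :
  mder f f' -> mder (fun s => (f s)^T) (fun s => (f' s)^T).
Proof.
move=> hf u i j; rewrite mxE (_ : (fun _ => _) = (fun s => f s j i)); first exact: hf.
by apply/funext => s; rewrite mxE.
Qed.

Lemma is_derive_expR_lin (a u : R) :
  is_derive u (1 : R) (fun s => expR (a * s)) (a * expR (a * u)).
Proof.
have ha : is_derive u (1 : R) (fun s : R => a * s) a.
  have h1 : is_derive u (1 : R) (a \*: @id R) (a *: (1 : R)) by exact: is_deriveZ.
  by rewrite /GRing.scale /= mulr1 in h1.
have := @is_derive1_comp R expR (fun s : R => a * s) u _ _ (is_derive_expR _) ha.
by rewrite mulrC.
Qed.

(** The form along the trajectory, times exp(-2 kap s), is nonincreasing. Passing from the norm to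
    the form and back costs C^2 on squares, hence [C]. *)
Lemma lyap_vec n (Q A : 'M[R]_n) kap C u (x : 'cV[R]_n) : 0 < C -> is_lyap Q A kap C -> 0 <= u ->
  N1 (expmx (u *: A) *m x) <= C * expR (kap * u) * N1 x.
Proof.
move=> C0 h u0.
have [hQ _ hc hd] := h.
pose y s := expmx (s *: A) *m x.
have hy : mder y (fun s => A *m y s).
  apply: mder_eq; first exact: mderM (mder_expmx A) (@mder_cst R n 1 x).
  by move=> s; rewrite /= mulmx0 addr0 mulmxA.
have hq s : is_derive s (1 : R) (fun s => bf Q (y s) (y s)) (2 * bf Q (y s) (A *m y s)).
  have h1 := mderM (mderM (mder_tr hy) (@mder_cst R _ _ Q)) hy.
  have := h1 s 0 0; rewrite /= mulmx0 addr0 mxE -!/(bf _ _ _).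
  by rewrite (bf_sym (A *m y s)) // -mulr2n mulr_natl.
have hf s : is_derive s (1 : R) ((fun s => bf Q (y s) (y s)) * (fun s => expR ((-2 * kap) * s)))
     (2 * expR ((-2 * kap) * s) * (bf Q (y s) (A *m y s) - kap * bf Q (y s) (y s))).
  have hm := is_deriveM (hq s) (is_derive_expR_lin (-2 * kap) s).
  apply: is_derive_eq.
  rewrite /GRing.scale /=; ring.
have := le_of_derive u0 hf.
have -> : ((fun s => bf Q (y s) (y s)) * (fun s => expR ((-2 * kap) * s))) u =
   bf Q (y u) (y u) * expR (-2 * kap * u) by [].
have -> : ((fun s => bf Q (y s) (y s)) * (fun s => expR ((-2 * kap) * s))) 0 =
   bf Q x x.
  by rewrite -[LHS]/(bf Q (y 0) (y 0) * expR (-2 * kap * 0)) mulr0 expR0 mulr1 /y expmx0 mul1mx.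
move=> hle.
have {}hle : bf Q (y u) (y u) * expR (-2 * kap * u) <= bf Q x x.
  apply: hle => s _; apply: mulr_ge0_le0; first by rewrite mulr_ge0 ?expR_ge0.
  by rewrite subr_le0.
have e0 := expR_gt0 (kap * u).
have hle2 : bf Q (y u) (y u) <= expR (kap * u) ^+ 2 * bf Q x x.
  have -> : bf Q (y u) (y u) = expR (kap * u) ^+ 2 * (bf Q (y u) (y u) * expR (-2 * kap * u)).
    rewrite mulrCA -expRM_natl -expRD (_ : _ + _ = 0) ?expR0 ?mulr1 //; ring.
  by apply: ler_wpM2l => //; exact: sqr_ge0.
have up := is_lyap_up C0 h x.
have r0 : 0 <= C * expR (kap * u) * N1 x by rewrite !mulr_ge0 ?N1_ge0 // ltW.
rewrite -(ler_pXn2r (n := 2)) ?nnegrE ?N1_ge0 //.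
apply: le_trans (hc _) _.
apply: (@le_trans _ _ (C * (expR (kap * u) ^+ 2 * (C * N1 x ^+ 2)))).
  apply: ler_wpM2l; first exact: ltW.
  apply: le_trans hle2 _; apply: ler_wpM2l => //; exact: sqr_ge0.
by rewrite !exprMn le_eqVlt; apply/orP; left; apply/eqP; ring.
Qed.

Lemma lyap_exp n (Q A : 'M[R]_n) kap C u : 0 < C -> is_lyap Q A kap C -> 0 <= u ->
  N1 (expmx (u *: A)) <= n%:R * (C * expR (kap * u)).
Proof. by move=> C0 h u0; apply: N1_cols => x; exact: (lyap_vec x C0 h). Qed.

(** Read P = Pr + i Pi, U = Ur + i Ui, X = Xr + i Xi: the hypotheses are the real and imaginary
    parts of P A = U P, and the real part of X P = 1. The form is |P x|^2 on real vectors x; the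
    diagonal of U gives the rate [mu0], and each of the n^2 pairs of indices costs at most [del]
    times the form. *)
Lemma lyap_core n (A Pr Pi Ur Ui Xr Xi : 'M[R]_n) mu0 del :
  Pr *m A = Ur *m Pr - Ui *m Pi -> Pi *m A = Ur *m Pi + Ui *m Pr ->
  Xr *m Pr - Xi *m Pi = 1%:M ->
  (forall i, Ur i i <= mu0) ->
  0 <= del ->
  (forall i j, i != j -> `|Ur i j| + `|Ui i j| <= del) ->
  exists Q C, 0 < C /\ is_lyap Q A (mu0 + n%:R ^+ 2 * del) C.
Proof.
move=> h1 h2 h3 hd del0 ho.
pose Q := Pr^T *m Pr + Pi^T *m Pi.
have bfE x y : bf Q x y = \sum_i ((Pr *m x) i 0 * (Pr *m y) i 0 + (Pi *m x) i 0 * (Pi *m y) i 0).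
  rewrite /bf /Q mulmxDr mulmxDl mxE !mulmxA -!trmx_mul -!mulmxA big_split /=.
  by congr (_ + _); rewrite mxE; apply: eq_bigr => i _; rewrite mxE.
pose c := n%:R * (N1 Xr + N1 Xi).
exists Q, (c ^+ 2 + N1 Q + 1).
split; first by rewrite addrC ltr_pwDl // addr_ge0 ?N1_ge0 ?sqr_ge0.
have V0 x : 0 <= bf Q x x.
  by rewrite bfE; apply: sumr_ge0 => i _; rewrite -!expr2 addr_ge0 ?sqr_ge0.
have Vi x i : (Pr *m x) i 0 ^+ 2 + (Pi *m x) i 0 ^+ 2 <= bf Q x x.
  rewrite bfE (bigD1 i) //= -!expr2 lerDl; apply: sumr_ge0 => k _.
  by rewrite -!expr2 addr_ge0 ?sqr_ge0.
split.
- by rewrite /Q linearD /= !trmx_mul !trmxK.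
- by rewrite addrAC lerDr addr_ge0 ?sqr_ge0.
- move=> x.
  set s := Num.sqrt (bf Q x x).
  have s0 : 0 <= s by exact: sqrtr_ge0.
  have pi i : `|(Pr *m x) i 0| <= s.
    rewrite -sqrtr_sqr ler_wsqrtr //; apply: le_trans (Vi x i).
    by rewrite lerDl sqr_ge0.
  have qi i : `|(Pi *m x) i 0| <= s.
    rewrite -sqrtr_sqr ler_wsqrtr //; apply: le_trans (Vi x i).
    by rewrite lerDr sqr_ge0.
  have hx : N1 x <= c * s.
    have -> : x = Xr *m (Pr *m x) - Xi *m (Pi *m x).
      by rewrite !mulmxA -mulmxBl h3 mul1mx.
    apply: le_trans (N1D _ _) _; rewrite N1N.
    rewrite /c mulrDr mulrDl ![n%:R * _]mulrC -!mulrA.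
    have np : N1 (Pr *m x) <= n%:R * s.
      by rewrite -[n in n%:R]muln1; apply: N1_bound => i j; rewrite ord1.
    have nq : N1 (Pi *m x) <= n%:R * s.
      by rewrite -[n in n%:R]muln1; apply: N1_bound => i j; rewrite ord1.
    apply: lerD; (apply: le_trans (N1M _ _) _; apply: ler_wpM2l => //; exact: N1_ge0).
  have c0 : 0 <= c by rewrite mulr_ge0 ?addr_ge0 ?N1_ge0.
  apply: (@le_trans _ _ ((c * s) ^+ 2)).
    by rewrite ler_pXn2r ?nnegrE ?N1_ge0 // mulr_ge0.
  rewrite exprMn sqr_sqrtr //; apply: ler_wpM2r => //.
  by rewrite -addrA lerDl addr_ge0 ?N1_ge0.
- move=> x.
  set V := bf Q x x.
  rewrite bfE !mulmxA h1 h2.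
  rewrite mulmxBl mulmxDl -!mulmxA.
  have Vi' := Vi x.
  rewrite -/V in Vi'.
  have eV : V = \sum_i ((Pr *m x) i 0 ^+ 2 + (Pi *m x) i 0 ^+ 2) by rewrite /V bfE.
  have V0' : 0 <= V := V0 x.
  move: (Pr *m x) (Pi *m x) Vi' eV => p q Vi' eV.
  rewrite mulrDl eV mulr_sumr -eV.
  have -> : n%:R ^+ 2 * del * V = \sum_(i < n) (n%:R * (del * V)).
    by rewrite sumr_const card_ord -mulr_natl; ring.
  rewrite -big_split /=; apply: ler_sum => i _.
  rewrite !mxE -sumrB -big_split /= !mulr_sumr -big_split /=.
  rewrite (bigD1 i) //=.
  have -> : n%:R * (del * V) = \sum_(j < n) (del * V) by rewrite sumr_const card_ord mulr_natl.
  rewrite [X in _ <= _ + X](bigD1 i) //= [X in _ <= _ + X]addrC addrA.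
  have dV : 0 <= del * V by rewrite mulr_ge0.
  rewrite -[leLHS]addr0; apply: lerD => //; apply: lerD.
    have := hd i; have : 0 <= p i 0 ^+ 2 + q i 0 ^+ 2 by rewrite addr_ge0 ?sqr_ge0.
    move: (p i 0) (q i 0) (Ur i i) (Ui i i) => a b e f h0 he.
    have := ler_wpM2r h0 he; apply: le_trans; rewrite le_eqVlt; apply/orP; left; apply/eqP; ring.
  apply: ler_sum => j ji.
  have := ho i j; rewrite eq_sym => /(_ ji).
  move: (Vi' i) (Vi' j).
  move: (p i 0) (q i 0) (p j 0) (q j 0) (Ur i j) (Ui i j) => a b a' b' e f v1 v2 hef.
  (* These are the real part and, below, the imaginary part of a product of two coordinates of P x,
     one of them conjugated; each coordinate has squared modulus at most [V]. *)
  have k1 : `|a * a' + b * b'| <= V.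
    by rewrite ler_norml; have := sqr_ge0 (a - a'); have := sqr_ge0 (b - b');
       have := sqr_ge0 (a + a'); have := sqr_ge0 (b + b'); clear -v1 v2; move: V v1 v2 => v; nra.
  have k2 : `|b * a' - a * b'| <= V.
    by rewrite ler_norml; have := sqr_ge0 (b - a'); have := sqr_ge0 (a - b');
       have := sqr_ge0 (b + a'); have := sqr_ge0 (a + b'); clear -v1 v2; move: V v1 v2 => v; nra.
  have -> : a * (e * a' - f * b') + b * (e * b' + f * a') = e * (a * a' + b * b') + f * (b * a' - a * b') by ring.
  apply: le_trans (ler_norm _) _; apply: le_trans (ler_normD _ _) _.
  rewrite !normrM; apply: (@le_trans _ _ (`|e| * V + `|f| * V)).
    by apply: lerD; apply: ler_wpM2l.
  by rewrite -mulrDl; apply: ler_wpM2r.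
Qed.

End Lyapunov.

(** * Spectra *)

Section Spectral.
Variable R : realType.
Local Notation C := (R[i]).
Local Notation cplx := (map_mx (fun x : R => (x%:C)%C)).
Local Notation ReM := (map_mx (@complex.Re R)).
Local Notation ImM := (map_mx (@complex.Im R)).

Lemma ReD (x y : C) : complex.Re (x + y) = complex.Re x + complex.Re y.
Proof. by case: x; case: y. Qed.
Lemma ImD (x y : C) : complex.Im (x + y) = complex.Im x + complex.Im y.
Proof. by case: x; case: y. Qed.
Lemma ReMul (x y : C) :
  complex.Re (x * y) = complex.Re x * complex.Re y - complex.Im x * complex.Im y.
Proof. by case: x => ? ?; case: y. Qed.
Lemma ImMul (x y : C) :
  complex.Im (x * y) = complex.Re x * complex.Im y + complex.Im x * complex.Re y.
Proof. by case: x => ? ?; case: y => ? ? /=; rewrite addrC. Qed.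

Lemma ReM_mul m n p (X : 'M[C]_(m, n)) (Y : 'M[C]_(n, p)) :
  ReM (X *m Y) = ReM X *m ReM Y - ImM X *m ImM Y.
Proof.
apply/matrixP => i j; rewrite !mxE -sumrB (big_morph _ ReD (erefl _)).
by apply: eq_bigr => k _; rewrite ReMul !mxE.
Qed.

Lemma ImM_mul m n p (X : 'M[C]_(m, n)) (Y : 'M[C]_(n, p)) :
  ImM (X *m Y) = ReM X *m ImM Y + ImM X *m ReM Y.
Proof.
apply/matrixP => i j; rewrite !mxE -big_split /= (big_morph _ ImD (erefl _)).
by apply: eq_bigr => k _; rewrite ImMul !mxE.
Qed.

Lemma ReM_cplx m n (A : 'M[R]_(m, n)) : ReM (cplx A) = A.
Proof. by apply/matrixP => i j; rewrite !mxE. Qed.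
Lemma ImM_cplx m n (A : 'M[R]_(m, n)) : ImM (cplx A) = 0.
Proof. by apply/matrixP => i j; rewrite !mxE. Qed.

Lemma uniform_gap n (f : 'I_n -> R) mu : (forall i, f i < mu) ->
  exists2 g, 0 < g & forall i, f i <= mu - g.
Proof.
elim: n f => [|n IH] f h; first by exists 1 => // -[].
have [g g0 hg] := IH (fun i => f (lift ord0 i)) (fun i => h _).
exists (Num.min g (mu - f ord0)); first by rewrite lt_min g0 subr_gt0 h.
move=> i; rewrite lerBrDl -lerBrDr.
have [j ->|->] := unliftP ord0 i; rewrite ge_min.
  by have := hg j; rewrite lerBrDl -lerBrDr => ->.
by rewrite lexx orbT.
Qed.

(* Schur triangularisation, followed by a diagonal scaling by the powers of a
   small [r] which makes the off-diagonal part of the triangular matrix small. *)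
Lemma lyap_exists n (A : 'M[R]_n) mu :
  (forall z, eigenvalue (cplx A) z -> complex.Re z < mu) ->
  exists Q c g, [/\ 0 < c, 0 < g & is_lyap Q A (mu - g) c].
Proof.
case: n A => [|n] A hA.
  (* Size zero is separate because [Schur] asks for a positive size. *)
  exists 0, 1, 1; split => //; split.
  - exact: trmx0.
  - by rewrite N1_0.
  - by move=> x; rewrite /N1 big_ord0 expr0n /= mul1r /bf mulmx0 mul0mx mxE.
  - by move=> x; rewrite /bf mulmx0 !mul0mx mxE mulr0.
have [P Pu PA] := @Schur C n.+1 (cplx A) isT.
have Pun := unitarymx_unit Pu.
set U := conjmx P (cplx A) in PA.
have hU : P *m cplx A = U *m P by rewrite /U conjumx // mulmxKV.
have hdiag i : complex.Re (U i i) < mu.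
  apply: hA; apply/eigenvalueP.
  have : eigenvalue U (U i i).
    rewrite eigenvalue_root_char char_poly_trig // rootE horner_prod (bigD1 i) //=.
    by rewrite hornerXsubC subrr mul0r.
  case/eigenvalueP => v vU v0; exists (v *m P).
    by rewrite -mulmxA hU mulmxA vU scalemxAl.
  by apply: contra v0 => /eqP e; rewrite -(mulmxK Pun v) e mul0mx.
have [g g0 hg] := uniform_gap hdiag.
pose s := \sum_i \sum_j (`|complex.Re (U i j)| + `|complex.Im (U i j)|).
have s0 : 0 <= s by apply: sumr_ge0 => i _; apply: sumr_ge0 => j _; rewrite addr_ge0.
pose N : R := n.+1%:R ^+ 2.
have N0 : 0 < N by rewrite exprn_gt0.
(* [U] is lower triangular, so conjugation by the powers of [r] multiplies its (i, j) entry by r^(i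
   - j), at most [r] below the diagonal. This [r] makes the total off-diagonal cost at most g / 2,
   which leaves half of the gap. *)
pose r := Num.min 1 (g / (2 * N * (s + 1))).
have D0 : 0 < 2 * N * (s + 1) by rewrite !mulr_gt0 // addrC ltr_pwDl.
have r0 : 0 < r by rewrite lt_min ltr01 divr_gt0.
have r1 : r <= 1 by rewrite ge_min lexx.
have hr : N * (r * s) <= g / 2.
  have : r <= g / (2 * N * (s + 1)) by rewrite ge_min lexx orbT.
  rewrite ler_pdivlMr // => h.
  have h2 : 0 <= r * N by rewrite mulr_ge0 // ltW.
  rewrite ler_pdivlMr //; apply: le_trans h.
  rewrite -subr_ge0 (_ : _ - _ = 2 * (r * N)); last by ring.
  by rewrite mulr_ge0.
pose rc : C := (r%:C)%C.
have rc0 : rc != 0   by apply/eqP => /(congr1 (@complex.Re R)) /= e; rewrite e ltxx in r0.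
pose P' : 'M[C]_n.+1 := diag_mx (\row_i (rc ^+ i)) *m P.
pose U' : 'M[C]_n.+1 := diag_mx (\row_i (rc ^+ i)) *m U *m diag_mx (\row_i (rc ^- i)).
have hdd : diag_mx (\row_i (rc ^- i)) *m diag_mx (\row_i (rc ^+ i)) = 1%:M :> 'M[C]_n.+1.
  rewrite mulmx_diag -diag_const_mx; congr diag_mx; apply/rowP => i.
  by rewrite !mxE mulVf // expf_neq0.
have hU' : P' *m cplx A = U' *m P'.
  by rewrite /P' /U' -mulmxA hU -!mulmxA (mulmxA _ (diag_mx _) P) hdd mul1mx.
have P'u : P' \in unitmx.
  rewrite unitmx_mul Pun andbT; case: (mulmx1_unit hdd) => //.
have U'E i j : U' i j = rc ^+ i * U i j / rc ^+ j.
  by rewrite /U' mul_mx_diag mul_diag_mx !mxE.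
pose X := invmx P'.
have XP : X *m P' = 1%:M by rewrite mulVmx.
clearbody X U' P'.
have := @lyap_core R n.+1 A (ReM P') (ImM P') (ReM U') (ImM U') (ReM X) (ImM X) (mu - g) (r * s).
case.
- by rewrite -ReM_mul -hU' ReM_mul ImM_cplx mulmx0 subr0 ReM_cplx.
- by rewrite addrC -addrC -ImM_mul -hU' ImM_mul ImM_cplx mulmx0 add0r ReM_cplx.
- rewrite -ReM_mul XP; apply/matrixP => i j; rewrite !mxE; by case: eqP.
- move=> i; rewrite mxE U'E mulrAC mulfV ?mul1r ?expf_neq0 //.
- by rewrite mulr_ge0 // ltW.
- move=> i j ij; rewrite !mxE U'E.
  have [lt_ij|lt_ji|e] := ltngtP i j; last by rewrite (ord_inj e) eqxx in ij.
    move/is_trig_mxP: PA => /(_ i j lt_ij) ->; rewrite mulr0 mul0r /= normr0 addr0.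
    by rewrite mulr_ge0 // ltW.
  have -> : rc ^+ i * U i j / rc ^+ j = ((r ^+ (i - j))%:C)%C * U i j.
    have e : rc ^+ i = rc ^+ (i - j) * rc ^+ j by rewrite -exprD subnK // ltnW.
    by rewrite e mulrAC mulfK ?expf_neq0 // /rc -rmorphXn.
  rewrite ReMul ImMul /= !mul0r subr0 addr0 !normrM (ger0_norm (exprn_ge0 _ (ltW r0))) -mulrDr.
  apply: ler_pM; rewrite ?exprn_ge0 ?addr_ge0 ?(ltW r0) //.
    rewrite -[leRHS]expr1; apply: ler_wiXn2l; rewrite ?(ltW r0) //.
    by rewrite subn_gt0.
  rewrite /s (bigD1 i) //= (bigD1 j) //= -addrA lerDl addr_ge0 //.
    by apply: sumr_ge0 => k _; rewrite addr_ge0.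
  by apply: sumr_ge0 => k _; apply: sumr_ge0 => l _; rewrite addr_ge0.
- move=> Q [c [c0 hQ]]; exists Q, c, (g / 2); split => //; first by rewrite divr_gt0.
  apply: is_lyap_mono hQ => //.
  rewrite -/N; move: hr; lra.
Qed.

Lemma growth_compare (a b c T : R) :
  0 < c -> (forall t, T <= t -> expR (a * t) <= c * expR (b * t)) -> a <= b.
Proof.
move=> c0 h; rewrite leNgt; apply/negP => ba.
have ab : 0 < a - b by rewrite subr_gt0.
pose t := Num.max T (c / (a - b)).
have := h t; rewrite le_max lexx /= => /(_ isT).
have -> : a * t = (a - b) * t + b * t by ring.
rewrite expRD ler_pM2r ?expR_gt0 //.
apply/negP; rewrite -ltNge.
apply: lt_le_trans (expR_ge1Dx _).
rewrite ltr_pwDl // mulrC -ler_pdivrMr //.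
by rewrite le_max lexx orbT.
Qed.

(** For a left eigenvector a + i b, multiplication by exp(tA) scales the squared modulus of each
    entry by exactly exp(2 Re(z) t): the rotation due to Im(z) cancels in the sum of squares.
    Comparing growth rates on one nonzero entry gives the bound. *)
Lemma spectral_bound n (A : 'M[R]_n) m c T :
  0 < c -> (forall t, T <= t -> N1 (expmx (t *: A)) <= c * expR (m * t)) ->
  forall z, eigenvalue (cplx A) z -> complex.Re z <= m.
Proof.
move=> c0 h z /eigenvalueP [v vA v0].
pose a := ReM v; pose b := ImM v.
pose x := complex.Re z; pose y := complex.Im z.
have ha : a *m A = x *: a - y *: b.
  have := congr1 ReM vA; rewrite ReM_mul ImM_cplx mulmx0 subr0 ReM_cplx => ->.
  by apply/matrixP => i j; rewrite !mxE ReMul.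
have hb : b *m A = x *: b + y *: a.
  have := congr1 ImM vA; rewrite ImM_mul ImM_cplx mulmx0 add0r ReM_cplx => ->.
  by apply/matrixP => i j; rewrite !mxE ImMul.
pose al s := a *m expmx (s *: A); pose be s := b *m expmx (s *: A).
have hal : mder al (fun s => x *: al s - y *: be s).
  apply: mder_eq; first exact: mderM (@mder_cst R _ _ a) (mder_expmx A).
  by move=> s /=; rewrite mul0mx add0r mulmxA ha mulmxBl -!scalemxAl.
have hbe : mder be (fun s => x *: be s + y *: al s).
  apply: mder_eq; first exact: mderM (@mder_cst R _ _ b) (mder_expmx A).
  by move=> s /=; rewrite mul0mx add0r mulmxA hb mulmxDl -!scalemxAl.
have [i [j ij]] : exists i j, (a i j != 0) || (b i j != 0).
  have [i [j hij]] : exists i j, v i j != 0.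
    apply: contrapT => hn; move/negP: v0; apply; apply/eqP/matrixP => i j; rewrite mxE.
    by apply/eqP; apply: contrapT => e; apply: hn; exists i, j; apply/negP.
  exists i, j; apply: contraNT hij; rewrite !mxE negb_or !negbK.
  by case: (v i j) => p q /= /andP[/eqP -> /eqP ->].
have hN s : is_derive s (1 : R)
   (((fun s => al s i j) ^+ 2 + (fun s => be s i j) ^+ 2) * (fun s => expR ((-2 * x) * s))) 0.
  have d1 := hal s i j; have d2 := hbe s i j.
  have d3 := is_derive_expR_lin (-2 * x) s.
  apply: is_derive_eq; rewrite /GRing.scale /= !fctE !mxE /=; ring.
have hcst t : (al t i j ^+ 2 + be t i j ^+ 2) * expR ((-2 * x) * t) = a i j ^+ 2 + b i j ^+ 2.
  have := @is_derive_0_is_cst R _ t 0 hN.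
  rewrite !fctE mulr0 expR0 mulr1 /al /be expmx0 !mulmx1 //.
set q := a i j ^+ 2 + b i j ^+ 2 in hcst.
have q0 : 0 < q.
  by case/orP: ij => e; [apply: ltr_pwDl|apply: ltr_wpDl]; rewrite ?sqr_ge0 // lt_neqAle sqr_ge0 eq_sym sqrf_eq0 e.
pose c' := (N1 a ^+ 2 + N1 b ^+ 2) * c ^+ 2 / q.
suff : 2 * x <= 2 * m by rewrite ler_pM2l.
apply: (@growth_compare _ _ (c' + 1) T).
  rewrite ltr_wpDl // divr_ge0 ?mulr_ge0 ?addr_ge0 ?sqr_ge0 //; exact: ltW.
move=> t /h ht.
have ht' : al t i j ^+ 2 + be t i j ^+ 2 <= (N1 a ^+ 2 + N1 b ^+ 2) * (c ^+ 2 * expR (2 * m * t)).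
  have e2 : c ^+ 2 * expR (2 * m * t) = (c * expR (m * t)) ^+ 2.
    by rewrite exprMn -expRM_natl mulrA.
  rewrite e2 mulrDl -!exprMn; apply: lerD.
    rewrite -[leLHS]real_normK ?num_real //; apply: lerXn2r; rewrite ?nnegrE ?mulr_ge0 ?N1_ge0 ?expR_ge0 ?(ltW c0) //.
    apply: le_trans (N1_entry _ _ _) _; apply: le_trans (N1M _ _) _.
    by apply: ler_wpM2l => //; exact: N1_ge0.
  rewrite -[leLHS]real_normK ?num_real //; apply: lerXn2r; rewrite ?nnegrE ?mulr_ge0 ?N1_ge0 ?expR_ge0 ?(ltW c0) //.
  apply: le_trans (N1_entry _ _ _) _; apply: le_trans (N1M _ _) _.
  by apply: ler_wpM2l => //; exact: N1_ge0.
have e1 : al t i j ^+ 2 + be t i j ^+ 2 = q * expR (2 * x * t).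
  rewrite -(hcst t) -mulrA -expRD (_ : -2 * x * t + 2 * x * t = 0) ?expR0 ?mulr1 //.
  ring.
rewrite e1 in ht'.
apply: (@le_trans _ _ (c' * expR (2 * m * t))).
  rewrite [leRHS](_ : _ = (N1 a ^+ 2 + N1 b ^+ 2) * (c ^+ 2 * expR (2 * m * t)) / q).
    by rewrite ler_pdivlMr // mulrC.
  by rewrite /c'; ring.
by apply: ler_wpM2r; rewrite ?expR_ge0 // lerDl.
Qed.

End Spectral.

(** * The flow within one mode *)

Section OnePiece.
Variable R : realType.

(* A mode in the coordinates [w = T X]: [p1] and [p2] extract the slow and the
   fast components, and [w1' = M w1 + B w2], [w2' = G w1 + (D / e + F) w2]. *)
Record piece n := Piece {
  pa : nat; pb : nat; p1 : 'M[R]_(pa, n); p2 : 'M[R]_(pb, n);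
  pM : 'M[R]_pa; pB : 'M[R]_(pa, pb); pD : 'M[R]_pb;
  pF : 'M[R]_pb; pG : 'M[R]_(pb, pa) }.

Definition Lmx n (X : piece n) (e : R) : 'M[R]_n :=
  (p1 X)^T *m (pM X *m p1 X + pB X *m p2 X) +
  (p2 X)^T *m (pG X *m p1 X + (e^-1 *: pD X + pF X) *m p2 X).

Record proj_ok n (X : piece n) : Prop := ProjOk {
  p11 : p1 X *m (p1 X)^T = 1%:M;
  p22 : p2 X *m (p2 X)^T = 1%:M;
  p12 : p1 X *m (p2 X)^T = 0;
  p21 : p2 X *m (p1 X)^T = 0;
  psum : (p1 X)^T *m p1 X + (p2 X)^T *m p2 X = 1%:M;
  p1n : N1 (p1 X) <= n%:R;
  p2n : N1 (p2 X) <= n%:R;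
  pan : (pa X <= n)%N;
  pbn : (pb X <= n)%N }.

(** One constant serves for all bounds, and the decay rate of the fast block is written [- C^-1], so
    that the property weakens as [C] grows; the compactness argument relies on this monotonicity. *)
Record piece_ok n (X : piece n) (mu C : R) : Prop := PieceOk {
  pproj : proj_ok X;
  plyap1 : exists H, is_lyap H (pM X) mu C;
  plyap2 : exists H, is_lyap H (pD X) (- C^-1) C;
  pBC : N1 (pB X) <= C;
  pFC : N1 (pF X) <= C;
  pGC : N1 (pG X) <= C }.

Lemma p1L n (X : piece n) e : proj_ok X ->
  p1 X *m Lmx X e = pM X *m p1 X + pB X *m p2 X.
Proof. by move=> h; rewrite /Lmx mulmxDr !mulmxA p11 // p12 // !mul0mx mul1mx addr0. Qed.

Lemma p2L n (X : piece n) e : proj_ok X ->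
  p2 X *m Lmx X e = pG X *m p1 X + (e^-1 *: pD X + pF X) *m p2 X.
Proof. by move=> h; rewrite /Lmx mulmxDr !mulmxA p21 // p22 // !mul0mx mul1mx add0r. Qed.

Lemma ler_bound3 (a b c A B C : R) : 0 <= a -> 0 <= b -> 0 <= c ->
  a <= A -> b <= B -> c <= C -> a * b * c <= A * B * C.
Proof.
move=> a0 b0 c0 aA bB cC; apply: ler_pM => //; first by rewrite mulr_ge0.
exact: ler_pM.
Qed.

Lemma N1M3 m n p q (X : 'M[R]_(m, n)) (Y : 'M[R]_(n, p)) (Z : 'M[R]_(p, q)) :
  N1 (X *m Y *m Z) <= N1 X * N1 Y * N1 Z.
Proof.
apply: le_trans (N1M _ _) _; apply: ler_wpM2r; first exact: N1_ge0.
exact: N1M.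
Qed.

Lemma amgm_cross (C g a b : R) : 0 < C -> 0 < g ->
  2 * C ^+ 2 * (a * b) <= g / C * a ^+ 2 + C ^+ 5 / g * b ^+ 2.
Proof.
move=> C0 g0; rewrite -subr_ge0.
have -> : g / C * a ^+ 2 + C ^+ 5 / g * b ^+ 2 - 2 * C ^+ 2 * (a * b) =
  (g * a - C ^+ 3 * b) ^+ 2 / (C * g).
  by field; rewrite ?gt_eqF.
by rewrite divr_ge0 ?sqr_ge0 // mulr_ge0 // ltW.
Qed.

(** The sum of the slow and fast forms works for the coupled system. By [amgm_cross] the cross terms
    split into a slow part, paid by the gap mu' - mu, and a fast part, paid by the strong decay 1 /
    (e C); the condition on [e] is what this second payment requires. *)
Lemma lyap_coupled n (X : piece n) (mu mu' C e : R) :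
  1 <= C -> mu < mu' -> piece_ok X mu C -> 0 < e ->
  C ^+ 6 / (mu' - mu) + C ^+ 3 - mu' <= (e * C)^-1 ->
  exists H, is_lyap H (Lmx X e) mu' (2 * n%:R ^+ 2 * C + 1).
Proof.
move=> C1 hmu hX e0 he.
have C0 : 0 < C by apply: lt_le_trans C1.
have g0 : 0 < mu' - mu by rewrite subr_gt0.
have hp := pproj hX.
have [H1 h1] := plyap1 hX; have [H2 h2] := plyap2 hX.
have q10 x := is_lyap_ge0 x C0 h1; have q20 x := is_lyap_ge0 x C0 h2.
case: (h1) => s1 n1 c1 d1; case: (h2) => s2 n2 c2 d2.
pose Q := (p1 X)^T *m H1 *m p1 X + (p2 X)^T *m H2 *m p2 X.
have bfQ x y : bf Q x y = bf H1 (p1 X *m x) (p1 X *m y) + bf H2 (p2 X *m x) (p2 X *m y).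
  by rewrite /bf /Q mulmxDr mulmxDl mxE !trmx_mul !mulmxA.
have n0 : 0 <= n%:R :> R by [].
exists Q; split.
- by rewrite /Q linearD /= !trmx_mul !trmxK s1 s2 !mulmxA.
- apply: le_trans (N1D _ _) _.
  have k1 : N1 ((p1 X)^T *m H1 *m p1 X) <= n%:R * C * n%:R.
    apply: le_trans (N1M3 _ _ _) _; rewrite N1_tr.
    by apply: ler_bound3; rewrite ?N1_ge0 //; exact: p1n hp.
  have k2 : N1 ((p2 X)^T *m H2 *m p2 X) <= n%:R * C * n%:R.
    apply: le_trans (N1M3 _ _ _) _; rewrite N1_tr.
    by apply: ler_bound3; rewrite ?N1_ge0 //; exact: p2n hp.
  apply: le_trans (lerD k1 k2) _.
  rewrite (_ : n%:R * C * n%:R + n%:R * C * n%:R = 2 * n%:R ^+ 2 * C); last by ring.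
  by rewrite lerDl.
- move=> x.
  have hx : N1 x <= n%:R * (N1 (p1 X *m x) + N1 (p2 X *m x)).
    have {1}-> : x = (p1 X)^T *m (p1 X *m x) + (p2 X)^T *m (p2 X *m x).
      by rewrite !mulmxA -mulmxDl psum // mul1mx.
    apply: le_trans (N1D _ _) _; rewrite mulrDr.
    apply: lerD; (apply: le_trans (N1M _ _) _; rewrite N1_tr; apply: ler_wpM2r);
      rewrite ?N1_ge0 //; [exact: p1n hp|exact: p2n hp].
  rewrite bfQ; move: (c1 (p1 X *m x)) (c2 (p2 X *m x)) (q10 (p1 X *m x)) (q20 (p2 X *m x)).
  move: hx (N1_ge0 x) (N1_ge0 (p1 X *m x)) (N1_ge0 (p2 X *m x)).
  move: (N1 x) (N1 (p1 X *m x)) (N1 (p2 X *m x)) (bf H1 _ _) (bf H2 _ _) => a b c q1 q2.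
  move=> hx a0 b0 c0 hb hc q10' q20'.
  apply: (@le_trans _ _ ((n%:R * (b + c)) ^+ 2)).
    by rewrite ler_pXn2r ?nnegrE // mulr_ge0 // addr_ge0.
  apply: (@le_trans _ _ (2 * n%:R ^+ 2 * (b ^+ 2 + c ^+ 2))).
    rewrite -subr_ge0.
    rewrite (_ : 2 * n%:R ^+ 2 * (b ^+ 2 + c ^+ 2) - (n%:R * (b + c)) ^+ 2 = (n%:R * (b - c)) ^+ 2).
      exact: sqr_ge0.
    by ring.
  apply: (@le_trans _ _ (2 * n%:R ^+ 2 * (C * (q1 + q2)))).
    by apply: ler_wpM2l; [rewrite mulr_ge0 ?sqr_ge0|rewrite mulrDr lerD].
  by rewrite mulrA; apply: ler_wpM2r; rewrite ?addr_ge0 // lerDl.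
- move=> x.
  rewrite !bfQ !mulmxA p1L // p2L // !mulmxDl -!scalemxAl -!mulmxA !bfDr.
  move: (p1 X *m x) (p2 X *m x) => x1 x2.
  have bfZ z : bf H2 x2 (e^-1 *: z) = e^-1 * bf H2 x2 z by rewrite /bf -scalemxAr mxE.
  rewrite bfZ.
  have a0 := N1_ge0 x1; have b0 := N1_ge0 x2.
  have k1 : bf H1 x1 (pB X *m x2) <= C ^+ 2 * (N1 x1 * N1 x2).
    apply: le_trans (ler_norm _) _; apply: le_trans (bf_le _ _ _) _.
    apply: (@le_trans _ _ (C * N1 x1 * (C * N1 x2))).
      apply: ler_pM; rewrite ?mulr_ge0 ?N1_ge0 //; first exact: ler_wpM2r.
      apply: le_trans (N1M _ _) _; apply: ler_wpM2r => //; exact: pBC hX.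
    by rewrite le_eqVlt; apply/orP; left; apply/eqP; ring.
  have k2 : bf H2 x2 (pG X *m x1) <= C ^+ 2 * (N1 x1 * N1 x2).
    apply: le_trans (ler_norm _) _; apply: le_trans (bf_le _ _ _) _.
    apply: (@le_trans _ _ (C * N1 x2 * (C * N1 x1))).
      apply: ler_pM; rewrite ?mulr_ge0 ?N1_ge0 //; first exact: ler_wpM2r.
      apply: le_trans (N1M _ _) _; apply: ler_wpM2r => //; exact: pGC hX.
    by rewrite le_eqVlt; apply/orP; left; apply/eqP; ring.
  have k3 : bf H2 x2 (pF X *m x2) <= C ^+ 2 * (N1 x2 ^+ 2).
    apply: le_trans (ler_norm _) _; apply: le_trans (bf_le _ _ _) _.
    apply: (@le_trans _ _ (C * N1 x2 * (C * N1 x2))).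
      apply: ler_pM; rewrite ?mulr_ge0 ?N1_ge0 //; first exact: ler_wpM2r.
      apply: le_trans (N1M _ _) _; apply: ler_wpM2r => //; exact: pFC hX.
    by rewrite le_eqVlt; apply/orP; left; apply/eqP; ring.
  have k4 : e^-1 * bf H2 x2 (pD X *m x2) <= - (e * C)^-1 * bf H2 x2 x2.
    rewrite invfM -mulrN -mulrA; apply: ler_wpM2l; first by rewrite invr_ge0 ltW.
    exact: d2.
  have k5 := amgm_cross (N1 x1) (N1 x2) C0 g0.
  have k6 := d1 x1.
  have k7 : (mu' - mu) / C * N1 x1 ^+ 2 <= (mu' - mu) * bf H1 x1 x1.
    rewrite -mulrA; apply: ler_wpM2l; first exact: ltW.
    by rewrite mulrC ler_pdivrMr // mulrC c1.
  have k8 : (C ^+ 5 / (mu' - mu) + C ^+ 2) * N1 x2 ^+ 2 <=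
            (C ^+ 6 / (mu' - mu) + C ^+ 3) * bf H2 x2 x2.
    have -> : C ^+ 6 / (mu' - mu) + C ^+ 3 = (C ^+ 5 / (mu' - mu) + C ^+ 2) * C by ring.
    rewrite -mulrA; apply: ler_wpM2l => //.
    by rewrite addr_ge0 ?divr_ge0 ?exprn_ge0 // ltW.
  have k9 : (C ^+ 6 / (mu' - mu) + C ^+ 3) * bf H2 x2 x2 <=
            ((e * C)^-1 + mu') * bf H2 x2 x2.
    by apply: ler_wpM2r => //; rewrite -lerBlDr.
  move: k1 k2 k3 k4 k5 k6 k7 k8 k9; clear.
  move: (bf H1 x1 (pB X *m x2)) (bf H2 x2 (pG X *m x1)) (bf H2 x2 (pF X *m x2))
   (e^-1 * bf H2 x2 (pD X *m x2)) (bf H1 x1 (pM X *m x1)) (bf H1 x1 x1) (bf H2 x2 x2)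
   (N1 x1) (N1 x2) => t1 t2 t3 t4 t5 q1 q2 a b.
  rewrite (mulrDl (C ^+ 5 / _)) (mulrDl (C ^+ 6 / _)) (mulrDl (e * C)^-1) (mulrBl q1) mulNr.
  move: (C ^+ 5 / (mu' - mu) * b ^+ 2) (C ^+ 6 / (mu' - mu) * q2) ((mu' - mu) / C * a ^+ 2)
     (C ^+ 3 * q2) ((e * C)^-1 * q2) (C ^+ 2 * b ^+ 2) => z1 z2 z3 z4 z5 z6.
  rewrite -(mulrA 2) (mulrDr mu').
  move: (C ^+ 2 * (a * b)) (mu' * q1) (mu * q1) (mu' * q2) => z7 z8 z9 z10.
  lra.
Qed.

Lemma le_expR_scaled (u g : R) : 0 < g -> u <= expR (g * u) / g.
Proof.
move=> g0; rewrite ler_pdivlMr // mulrC.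
by apply: le_trans (expR_ge1Dx _); rewrite lerDr.
Qed.

Lemma is_derive_lin (k u : R) : is_derive u (1 : R) (fun s => k * s) k.
Proof.
have h1 : is_derive u (1 : R) (k \*: @id R) (k *: (1 : R)) by exact: is_deriveZ.
by rewrite /GRing.scale /= mulr1 in h1.
Qed.

Lemma is_derive_scale_expR (k a u : R) :
  is_derive u (1 : R) (fun s => k * expR (a * s)) (k * (a * expR (a * u))).
Proof.
have h := is_derive_expR_lin a u.
have h1 : is_derive u (1 : R) (k \*: (fun s => expR (a * s))) (k *: (a * expR (a * u))).
  exact: is_deriveZ.
by [].
Qed.

Lemma fast_decay n (X : piece n) mu C e u : 1 <= C -> piece_ok X mu C -> 0 < e -> 0 <= u ->
  N1 (expmx (u / e *: pD X)) <= n%:R * C * expR (- (u / (e * C))).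
Proof.
move=> C1 hX e0 u0; have C0 : 0 < C by apply: lt_le_trans C1.
have [H h] := plyap2 hX.
apply: le_trans (lyap_exp C0 h _) _; first by rewrite divr_ge0 // ltW.
rewrite mulrA; apply: ler_pM; rewrite ?mulr_ge0 ?expR_ge0 ?(ltW C0) //.
  by apply: ler_wpM2r; rewrite ?(ltW C0) // ler_nat; exact: pbn (pproj hX).
by rewrite (_ : - C^-1 * (u / e) = - (u / (e * C))) // invfM; ring.
Qed.

(** Duhamel: [f] below runs from the decoupled fast flow at s = 0 to the true one at s = u. The
    terms in D / e cancel in its derivative, so that only the bounded coupling [pG], [pF] remains,
    damped by exp(-(u - s) / (e C)). *)
Lemma fast_flow_diff n (X : piece n) mu mu' C c1 e : 1 <= C -> piece_ok X mu C -> 0 < e ->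
  0 <= c1 -> - (2 * mu') <= (e * C)^-1 ->
  (forall u, 0 <= u -> N1 (expmx (u *: Lmx X e)) <= c1 * expR (mu' * u)) ->
  forall u, 0 <= u ->
  let k := n%:R ^+ 2 * (2 * n%:R ^+ 2 * C ^+ 2 * c1) in
  N1 (p2 X *m expmx (u *: Lmx X e) - expmx (u / e *: pD X) *m p2 X) <= k * u * expR (mu' * u) /\
  N1 (p2 X *m expmx (u *: Lmx X e) - expmx (u / e *: pD X) *m p2 X) <=
     k * (2 * C) * e * expR (mu' * u).
Proof.
move=> C1 hX e0 c10 hmu hL u u0 k.
have C0 : 0 < C by apply: lt_le_trans C1.
have hp := pproj hX.
pose f s := expmx ((- e^-1 * s + u / e) *: pD X) *m (p2 X *m expmx (s *: Lmx X e)).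
pose f' s := expmx ((- e^-1 * s + u / e) *: pD X) *m
   ((pG X *m p1 X + pF X *m p2 X) *m expmx (s *: Lmx X e)).
have hf : mder f f'.
  apply: mder_eq.
    apply: mderM (mder_expmx_affine (pD X) (- e^-1) (u / e)) _.
    exact: mderM (@mder_cst R _ _ (p2 X)) (mder_expmx (Lmx X e)).
  move=> s /=; rewrite mul0mx add0r expmx_comm [p2 X *m (_ *m _)]mulmxA p2L //.
  rewrite /f'; move: (expmx (_ *: pD X)) (expmx (s *: _)) => E Phi.
  have -> : pG X *m p1 X + (e^-1 *: pD X + pF X) *m p2 X =
     (pG X *m p1 X + pF X *m p2 X) + e^-1 *: (pD X *m p2 X).
    by rewrite mulmxDl -scalemxAl -addrA; congr (_ + _); rewrite addrC.
  rewrite (mulmxDl (_ + _)) mulmxDr -!scalemxAl -scalemxAr !mulmxA scaleNr.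
  by rewrite addrCA addNr addr0.
have fu : f u = p2 X *m expmx (u *: Lmx X e).
  by rewrite /f mulNr (mulrC _ u) addNr expmx0 mul1mx.
have f0 : f 0 = expmx (u / e *: pD X) *m p2 X.
  by rewrite /f mulr0 add0r expmx0 mulmx1.
set gam := (e * C)^-1 in hmu *.
pose kk := 2 * n%:R ^+ 2 * C ^+ 2 * c1.
have kk0 : 0 <= kk by rewrite /kk !mulr_ge0 ?sqr_ge0 // ltW.
have gam0 : 0 < gam by rewrite invr_gt0 mulr_gt0.
(* The shifted rate keeps at least half of the fast decay, even for negative [mu']. *)
have hg : gam / 2 <= gam + mu' by move: hmu; lra.
have gg0 : 0 < gam + mu' by apply: lt_le_trans hg; rewrite divr_gt0.
have bnd s : 0 <= s <= u -> N1 (f' s) <= kk * expR (- gam * u) * expR ((gam + mu') * s).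
  case/andP=> s0 su.
  apply: le_trans (N1M _ _) _.
  have b1 : N1 (expmx ((- e^-1 * s + u / e) *: pD X)) <= n%:R * C * expR (- gam * (u - s)).
    have -> : - e^-1 * s + u / e = (u - s) / e by ring.
    have := fast_decay C1 hX e0 (u := u - s); rewrite subr_ge0 => /(_ su).
    by rewrite (_ : - ((u - s) / (e * C)) = - gam * (u - s)) // /gam; ring.
  have b2 : N1 ((pG X *m p1 X + pF X *m p2 X) *m expmx (s *: Lmx X e)) <=
     (2 * n%:R * C) * (c1 * expR (mu' * s)).
    apply: le_trans (N1M _ _) _; apply: ler_pM; rewrite ?N1_ge0 //; last exact: hL.
    apply: le_trans (N1D _ _) _.
    have -> : 2 * n%:R * C = C * n%:R + C * n%:R :> R by ring.
    apply: lerD; apply: le_trans (N1M _ _) _; apply: ler_pM; rewrite ?N1_ge0 //.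
    - exact: pGC hX. - exact: p1n hp. - exact: pFC hX. - exact: p2n hp.
  apply: le_trans (ler_pM (N1_ge0 _) (N1_ge0 _) b1 b2) _.
  have -> : kk * expR (- gam * u) * expR ((gam + mu') * s) =
    (n%:R * C * (2 * n%:R * C * c1)) * (expR (- gam * (u - s)) * expR (mu' * s)).
    rewrite -mulrA -!expRD /kk.
    rewrite (_ : - gam * u + (gam + mu') * s = - gam * (u - s) + mu' * s); first by ring.
    by ring.
  by rewrite le_eqVlt; apply/orP; left; apply/eqP; ring.
have nb : (pb X * n)%:R <= n%:R ^+ 2 :> R.
  by rewrite expr2 natrM ler_wpM2r // ler_nat; exact: pbn hp.
have eE : expR (- gam * u) * expR ((gam + mu') * u) = expR (mu' * u).
  by rewrite -expRD; congr expR; ring.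
(* Bounding the derivative by the value of its majorant at s = u gives the factor u. Using the
   primitive of the exponential gives 1 / (gam + mu'), at most 2 / gam = 2 C e. *)
rewrite -fu -f0; split.
  have hd s : is_derive s (1 : R) (fun s => (kk * expR (mu' * u)) * s) (kk * expR (mu' * u)).
    exact: is_derive_lin.
  apply: le_trans (mder_mean u0 hf hd _) _.
    move=> s hs; apply: le_trans (bnd s hs) _.
    rewrite -mulrA; apply: ler_wpM2l => //; rewrite -eE; apply: ler_wpM2l; first exact: expR_ge0.
    by rewrite ler_expR; apply: ler_wpM2l; [exact: ltW|case/andP: hs].
  rewrite mulr0 subr0.
  rewrite [leRHS](_ : _ = n%:R ^+ 2 * (kk * expR (mu' * u) * u)); last by rewrite /k /kk; ring.
  by apply: ler_wpM2r => //; rewrite mulr_ge0 // mulr_ge0 // expR_ge0.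
have hd s : is_derive s (1 : R)
   (fun s => kk * expR (- gam * u) / (gam + mu') * expR ((gam + mu') * s))
   (kk * expR (- gam * u) * expR ((gam + mu') * s)).
  have := is_derive_scale_expR (kk * expR (- gam * u) / (gam + mu')) (gam + mu') s.
  by rewrite mulrA divfK // gt_eqF.
apply: le_trans (mder_mean u0 hf hd bnd) _.

apply: (@le_trans _ _ ((pb X * n)%:R * (kk * expR (mu' * u) / (gam + mu')))).
  apply: ler_wpM2l => //.
  rewrite -eE [X in X - _](_ : _ = kk * (expR (- gam * u) * expR ((gam + mu') * u)) / (gam + mu')); last by ring.
  rewrite gerBl.
  by rewrite mulr_ge0 ?expR_ge0 // mulr_ge0 ?invr_ge0 ?(ltW gg0) // mulr_ge0 ?expR_ge0.
apply: (@le_trans _ _ (n%:R ^+ 2 * (kk * expR (mu' * u) * (2 * C * e)))).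
  have kE0 : 0 <= kk * expR (mu' * u) by rewrite mulr_ge0 ?expR_ge0.
  apply: ler_pM; rewrite // ?(mulr_ge0 kE0) ?invr_ge0 ?(ltW gg0) //.
  apply: ler_wpM2l; first by rewrite mulr_ge0 ?expR_ge0.
  rewrite -[leRHS]invrK lef_pV2 ?posrE // ?invr_gt0 ?mulr_gt0 //.
  by apply: le_trans hg; rewrite /gam !invfM; rewrite le_eqVlt; apply/orP; left; apply/eqP; ring.
by rewrite le_eqVlt; apply/orP; left; apply/eqP; rewrite /k /kk; ring.
Qed.

(** Duhamel again, the forcing being [pB] times the fast component. Its transient has total mass of
    order [e], and its remainder is already of order [e] but acts during the whole time, hence the
    extra factor [u]. *)
Lemma slow_flow_diff n (X : piece n) mu mu' C c1 c2 e : 1 <= C -> piece_ok X mu C -> 0 < e ->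
  mu <= mu' -> 0 <= c1 -> 0 <= c2 -> - (2 * mu') <= (e * C)^-1 ->
  (forall u, 0 <= u -> N1 (p2 X *m expmx (u *: Lmx X e)) <=
     c1 * expR (- (e * C)^-1 * u) + c2 * e * expR (mu' * u)) ->
  forall u, 0 <= u ->
  N1 (p1 X *m expmx (u *: Lmx X e) - expmx (u *: pM X) *m p1 X) <=
    n%:R ^+ 2 * (n%:R * C ^+ 2) * (2 * C * c1 + c2 * u) * e * expR (mu' * u).
Proof.
move=> C1 hX e0 hmm c10 c20 hmu h2 u u0.
have C0 : 0 < C by apply: lt_le_trans C1.
have hp := pproj hX.
pose f s := expmx ((-1 * s + u) *: pM X) *m (p1 X *m expmx (s *: Lmx X e)).
pose f' s := expmx ((-1 * s + u) *: pM X) *m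
   (pB X *m (p2 X *m expmx (s *: Lmx X e))).
have hf : mder f f'.
  apply: mder_eq.
    apply: mderM (mder_expmx_affine (pM X) (-1) u) _.
    exact: mderM (@mder_cst R _ _ (p1 X)) (mder_expmx (Lmx X e)).
  move=> s /=; rewrite mul0mx add0r expmx_comm [p1 X *m (_ *m _)]mulmxA p1L //.
  by rewrite scaleN1r mulNmx mulmxDl mulmxDr -!mulmxA addKr.
have fu : f u = p1 X *m expmx (u *: Lmx X e).
  by rewrite /f mulN1r addNr expmx0 mul1mx.
have f0 : f 0 = expmx (u *: pM X) *m p1 X.
  by rewrite /f mulr0 add0r expmx0 mulmx1.
set gam := (e * C)^-1 in hmu h2 *.
have gam0 : 0 < gam by rewrite invr_gt0 mulr_gt0.
have hg : gam / 2 <= gam + mu' by move: hmu; lra.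
have gg0 : 0 < gam + mu' by apply: lt_le_trans hg; rewrite divr_gt0.
pose k := n%:R * C ^+ 2 * expR (mu' * u).
have k0 : 0 <= k by rewrite mulr_ge0 ?expR_ge0 // mulr_ge0 // sqr_ge0.
have [H hH] := plyap1 hX.
have bnd s : 0 <= s <= u -> N1 (f' s) <= k * (c1 * expR (- (gam + mu') * s) + c2 * e).
  case/andP=> s0 su.
  apply: le_trans (N1M _ _) _.
  have us0 : 0 <= -1 * s + u by rewrite mulN1r addrC subr_ge0.
  have b1 : N1 (expmx ((-1 * s + u) *: pM X)) <= n%:R * C * expR (mu' * (u - s)).
    apply: le_trans (lyap_exp C0 hH us0) _; rewrite mulrA.
    apply: ler_pM; rewrite ?mulr_ge0 ?expR_ge0 ?(ltW C0) //.
      by apply: ler_wpM2r; rewrite ?(ltW C0) // ler_nat; exact: pan hp.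
    rewrite ler_expR mulN1r (addrC _ u); apply: ler_wpM2r => //; by rewrite subr_ge0.
  have b2 : N1 (pB X *m (p2 X *m expmx (s *: Lmx X e))) <=
     C * (c1 * expR (- gam * s) + c2 * e * expR (mu' * s)).
    apply: le_trans (N1M _ _) _; apply: ler_pM; rewrite ?N1_ge0 //; last exact: h2.
    exact: pBC hX.
  apply: le_trans (ler_pM (N1_ge0 _) (N1_ge0 _) b1 b2) _.
  rewrite le_eqVlt; apply/orP; left; apply/eqP; rewrite /k.
  have -> : expR (mu' * (u - s)) = expR (mu' * u) * expR (- (mu' * s)).
    by rewrite -expRD; congr expR; ring.
  have -> : expR (- (gam + mu') * s) = expR (- gam * s) * expR (- (mu' * s)).
    by rewrite -expRD; congr expR; ring.
  have h1 : expR (mu' * s) * expR (- (mu' * s)) = 1 by rewrite expRxMexpNx_1.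
  have -> : n%:R * C * (expR (mu' * u) * expR (- (mu' * s))) *
     (C * (c1 * expR (- gam * s) + c2 * e * expR (mu' * s))) =
    n%:R * C ^+ 2 * expR (mu' * u) * (c1 * (expR (- gam * s) * expR (- (mu' * s))) +
     c2 * e * (expR (mu' * s) * expR (- (mu' * s)))) by ring.
  by rewrite h1 mulr1.
have hd s : is_derive s (1 : R)
   ((fun s => - (k * c1) / (gam + mu') * expR (- (gam + mu') * s)) + (fun s => k * c2 * e * s))
   (k * (c1 * expR (- (gam + mu') * s) + c2 * e)).
  have h1 := is_derive_scale_expR (- (k * c1) / (gam + mu')) (- (gam + mu')) s.
  have h2' := is_derive_lin (k * c2 * e) s.
  apply: is_derive_eq.
  by field; rewrite gt_eqF.
rewrite -fu -f0; apply: le_trans (mder_mean u0 hf hd bnd) _.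
have na : (pa X * n)%:R <= n%:R ^+ 2 :> R.
  by rewrite expr2 natrM ler_wpM2r // ler_nat; exact: pan hp.
rewrite !fctE /= !mulr0 expR0 addr0 mulr1.
apply: (@le_trans _ _ ((pa X * n)%:R * (k * c1 / (gam + mu') + k * c2 * e * u))).
  apply: ler_wpM2l => //.
  have : 0 <= (k * c1) / (gam + mu') * expR (- (gam + mu') * u).
    by rewrite mulr_ge0 ?expR_ge0 // divr_ge0 // ?mulr_ge0 // ltW.
  rewrite !mulNr; lra.
apply: (@le_trans _ _ (n%:R ^+ 2 * (k * c1 * (2 * C * e) + k * c2 * e * u))).
  apply: ler_pM => //.
    by rewrite addr_ge0 // ?mulr_ge0 // ?invr_ge0 ltW.
  rewrite lerD2r; apply: ler_wpM2l; first by rewrite mulr_ge0.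
  rewrite -[leRHS]invrK lef_pV2 ?posrE // ?invr_gt0 ?mulr_gt0 //.
  by apply: le_trans hg; rewrite /gam !invfM; rewrite le_eqVlt; apply/orP; left; apply/eqP; ring.
by rewrite le_eqVlt; apply/orP; left; apply/eqP; rewrite /k; ring.
Qed.

End OnePiece.

Section OnePieceSummary.
Variable R : realType.

Lemma sum5_ge (a b c d f : R) : 0 <= a -> 0 <= b -> 0 <= c -> 0 <= d -> 0 <= f ->
  [/\ a <= a + b + c + d + f + 1, b <= a + b + c + d + f + 1, c <= a + b + c + d + f + 1,
      d <= a + b + c + d + f + 1 & f <= a + b + c + d + f + 1].
Proof. by move=> *; split; lra. Qed.

Lemma absorb_linear (w a k u d e E1 E2 : R) : 0 <= w -> 0 <= a -> 0 <= k -> 0 <= e -> 0 <= E1 ->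
  1 <= E2 -> u <= E2 / d ->
  w * (a + k * u) * e * E1 <= w * (a + k / d) * e * (E1 * E2).
Proof.
move=> w0 a0 k0 e0 E10 E21 hu.
rewrite [leRHS](_ : _ = w * (a * E2 + k * (E2 / d)) * e * E1); last by ring.
do 2 (apply: ler_wpM2r => //); apply: ler_wpM2l => //.
by apply: lerD; [rewrite ler_peMr|exact: ler_wpM2l].
Qed.

(** The gap is spent twice: mu' - mu pays for the coupling in [lyap_coupled], and nu - mu' absorbs
    the factor [u] left by [slow_flow_diff]. *)
Lemma one_piece n (mu nu C : R) : 1 <= C -> mu < nu ->
  exists e0 c : R, [/\ 0 < e0, 1 <= c & forall (X : piece R n) e u, piece_ok X mu C ->
    0 < e -> e < e0 -> 0 <= u ->
    [/\ N1 (expmx (u *: Lmx X e)) <= c * expR (nu * u),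
        N1 (p1 X *m expmx (u *: Lmx X e) - expmx (u *: pM X) *m p1 X) <= c * e * expR (nu * u),
        N1 (p2 X *m expmx (u *: Lmx X e) - expmx (u / e *: pD X) *m p2 X) <= c * u * expR (nu * u),
        N1 (p2 X *m expmx (u *: Lmx X e) - expmx (u / e *: pD X) *m p2 X) <= c * e * expR (nu * u) &
        N1 (expmx (u / e *: pD X) *m p2 X) <= c * expR (- (u / (e * C))) ] ].
Proof.
move=> C1 hmu; have C0 : 0 < C by apply: lt_le_trans C1.
pose mu' := (mu + nu) / 2.
have h1 : mu < mu' by rewrite /mu'; lra.
have h2 : mu' < nu by rewrite /mu'; lra.
(* [S] dominates the two lower bounds on 1 / (e C) required by the coupled form and by Duhamel; e <
   1 / (C S) then gives both. *)
pose S := `|C ^+ 6 / (mu' - mu) + C ^+ 3 - mu'| + `|2 * mu'| + 1.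
have S0 : 0 < S by rewrite /S addrC ltr_pwDl // addr_ge0.
pose c1 := n%:R * (2 * n%:R ^+ 2 * C + 1).
have C'0 : 0 < 2 * n%:R ^+ 2 * C + 1 by rewrite addrC ltr_pwDl // mulr_ge0 ?(ltW C0) // mulr_ge0 // sqr_ge0.
have c10 : 0 <= c1 by rewrite mulr_ge0 // ltW.
pose k := n%:R ^+ 2 * (2 * n%:R ^+ 2 * C ^+ 2 * c1).
have k0 : 0 <= k by rewrite mulr_ge0 ?sqr_ge0 // mulr_ge0 // mulr_ge0 ?sqr_ge0 // mulr_ge0 // sqr_ge0.
pose cs := n%:R * C * n%:R.
have cs0 : 0 <= cs by rewrite mulr_ge0 // mulr_ge0 // ltW.
pose ks := k * (2 * C).
have ks0 : 0 <= ks by rewrite mulr_ge0 // mulr_ge0 // ltW.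
pose c3 := n%:R ^+ 2 * (n%:R * C ^+ 2) * (2 * C * cs + ks / (nu - mu')).
have d0 : 0 < nu - mu' by rewrite subr_gt0.
have w0 : 0 <= n%:R ^+ 2 * (n%:R * C ^+ 2) by rewrite mulr_ge0 ?sqr_ge0 // mulr_ge0 // sqr_ge0.
have c30 : 0 <= c3.
  by rewrite mulr_ge0 // addr_ge0 ?divr_ge0 ?(ltW d0) // mulr_ge0 // mulr_ge0 // ltW.
pose c := c1 + c3 + k + ks + cs + 1.
exists (C * S)^-1, c; split.
- by rewrite invr_gt0 mulr_gt0.
- by rewrite lerDr !addr_ge0.
move=> X e u hX e0 he u0.
have hS : S <= (e * C)^-1.
  rewrite -[S]invrK lef_pV2 ?posrE ?invr_gt0 ?mulr_gt0 //.
  by move: he; rewrite invfM mulrC ltr_pdivlMr // => /ltW.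
have hS1 : C ^+ 6 / (mu' - mu) + C ^+ 3 - mu' <= (e * C)^-1.
  apply: le_trans hS; apply: le_trans (ler_norm _) _; do 2 (apply: ler_wpDr => //).
have hS2 : - (2 * mu') <= (e * C)^-1.
  apply: le_trans hS; apply: le_trans (ler_norm _) _; rewrite normrN; apply: ler_wpDr => //; exact: ler_wpDl.
have hL v : 0 <= v -> N1 (expmx (v *: Lmx X e)) <= c1 * expR (mu' * v).
  move=> v0; have [H hH] := lyap_coupled C1 h1 hX e0 hS1.
  by apply: le_trans (lyap_exp C'0 hH v0) _; rewrite mulrA.
have hE v : 0 <= v -> expR (mu' * v) <= expR (nu * v).
  by move=> v0; rewrite ler_expR; apply: ler_wpM2r => //; exact: ltW.
have hF v : 0 <= v -> _ := fun v0 => fast_flow_diff C1 hX e0 c10 hS2 hL v0.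
have hD v : 0 <= v -> N1 (expmx (v / e *: pD X) *m p2 X) <= cs * expR (- (v / (e * C))).
  move=> v0; apply: le_trans (N1M _ _) _.
  rewrite [leRHS](_ : _ = n%:R * C * expR (- (v / (e * C))) * n%:R); last by rewrite /cs; ring.
  apply: ler_pM; rewrite ?N1_ge0 //; first exact: fast_decay hX e0 v0.
  exact: p2n (pproj hX).
have hG v : 0 <= v -> N1 (p2 X *m expmx (v *: Lmx X e)) <=
     cs * expR (- (e * C)^-1 * v) + ks * e * expR (mu' * v).
  move=> v0; rewrite -[p2 X *m _](subrK (expmx (v / e *: pD X) *m p2 X)).
  apply: le_trans (N1D _ _) _; rewrite addrC; apply: lerD; last by have [] := hF v v0.
  by have := hD v v0; rewrite (_ : - (v / (e * C)) = - (e * C)^-1 * v) //; ring.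
have E0 := expR_ge0 (nu * u); have E1 := hE u u0.
have [f1 f2] := hF u u0.

have [l1 l2 l3 l4 l5] : [/\ c1 <= c, c3 <= c, k <= c, ks <= c & cs <= c].
  exact: sum5_ge.
split.
- by apply: le_trans (hL u u0) _; apply: ler_pM => //; exact: expR_ge0.
- apply: le_trans (slow_flow_diff C1 hX e0 (ltW h1) cs0 ks0 hS2 hG u0) _.
  have hu := le_expR_scaled u d0.
  have E2 : expR (mu' * u) * expR ((nu - mu') * u) = expR (nu * u).
    by rewrite -expRD; congr expR; ring.
  have E3 : 1 <= expR ((nu - mu') * u).
    by rewrite -expR0 ler_expR mulr_ge0 // ltW.
  apply: (@le_trans _ _ (c3 * e * expR (nu * u))).
    rewrite -E2 /c3; apply: absorb_linear => //; rewrite ?expR_ge0 ?(ltW e0) //.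
    by rewrite !mulr_ge0 // ltW.
  by apply: ler_wpM2r => //; apply: ler_wpM2r => //; exact: ltW.
- apply: le_trans f1 _; apply: ler_pM; rewrite ?expR_ge0 ?(mulr_ge0 k0) //.
  exact: ler_wpM2r.
- apply: le_trans f2 _; apply: ler_pM; rewrite ?expR_ge0 ?(mulr_ge0 ks0) ?(ltW e0) //.
  by apply: ler_wpM2r; first exact: ltW.
- by apply: le_trans (hD u u0) _; apply: ler_wpM2r; first exact: expR_ge0.
Qed.

End OnePieceSummary.

(** * Block decomposition of a mode *)

Section Blocks.
Variable R : realType.

(** Selection matrices turn block extraction and casts into products, after which no cast remains in
    the algebra. *)
Definition prU n1 n2 d (e : (n1 + n2 = d)%N) : 'M[R]_(n1, d) := castmx (erefl, e) (row_mx 1%:M 0).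
Definition prD n1 n2 d (e : (n1 + n2 = d)%N) : 'M[R]_(n2, d) := castmx (erefl, e) (row_mx 0 1%:M).

Lemma cast_block n1 n2 d (e : (n1 + n2 = d)%N) A B C D :
  castmx (e, e) (block_mx A B C D) =
  (prU e)^T *m (A *m prU e + B *m prD e) + (prD e)^T *m (C *m prU e + D *m prD e).
Proof.
case: d / e; rewrite /prU /prD !castmx_id !mul_mx_row !mulmx0 !mulmx1 !add_row_mx !addr0 !add0r.
rewrite !tr_row_mx !trmx1 !trmx0 !mul_col_mx !mul1mx !mul0mx add_col_mx addr0 add0r.
by rewrite /block_mx.
Qed.

Lemma castmx_mulr n m p q (e : n = m) (f : p = q) (Q : 'M[R]_(m, q)) :
  castmx (esym e, esym f) Q = castmx (esym e, erefl) 1%:M *m Q *m castmx (erefl, esym f) 1%:M.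
Proof. by case: m / e Q; case: q / f => Q; rewrite !castmx_id mul1mx mulmx1. Qed.

Lemma prU_cast n1 n2 d (e : (n1 + n2 = d)%N) :
  usubmx (castmx (esym e, erefl) (1%:M : 'M[R]_d)) = prU e.
Proof.
case: d / e; rewrite /prU !castmx_id.
by rewrite scalar_mx_block /block_mx col_mxKu.
Qed.

Lemma prD_cast n1 n2 d (e : (n1 + n2 = d)%N) :
  dsubmx (castmx (esym e, erefl) (1%:M : 'M[R]_d)) = prD e.
Proof.
case: d / e; rewrite /prD !castmx_id.
by rewrite scalar_mx_block /block_mx col_mxKd.
Qed.

Lemma prU_castr n1 n2 d (e : (n1 + n2 = d)%N) :
  lsubmx (castmx (erefl, esym e) (1%:M : 'M[R]_d)) = (prU e)^T.
Proof. by rewrite -prU_cast trmx_usub trmx_cast trmx1. Qed.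

Lemma prD_castr n1 n2 d (e : (n1 + n2 = d)%N) :
  rsubmx (castmx (erefl, esym e) (1%:M : 'M[R]_d)) = (prD e)^T.
Proof. by rewrite -prD_cast trmx_dsub trmx_cast trmx1. Qed.

Section Sub.
Variables (n1 n2 m1 m2 d : nat) (e : (n1 + n2 = d)%N) (f : (m1 + m2 = d)%N) (Q : 'M[R]_d).

Lemma ulsub_cast : ulsubmx (castmx (esym e, esym f) Q) = prU e *m Q *m (prU f)^T.
Proof. by rewrite castmx_mulr /ulsubmx -mulmxA -mul_usub_mx -mulmx_lsub prU_cast -mulmx_lsub prU_castr mulmxA. Qed.
Lemma ursub_cast : ursubmx (castmx (esym e, esym f) Q) = prU e *m Q *m (prD f)^T.
Proof. by rewrite castmx_mulr /ursubmx -mulmxA -mul_usub_mx -mulmx_rsub prU_cast -mulmx_rsub prD_castr mulmxA. Qed.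
Lemma dlsub_cast : dlsubmx (castmx (esym e, esym f) Q) = prD e *m Q *m (prU f)^T.
Proof. by rewrite castmx_mulr /dlsubmx -mulmxA -mul_dsub_mx -mulmx_lsub prD_cast -mulmx_lsub prU_castr mulmxA. Qed.
Lemma drsub_cast : drsubmx (castmx (esym e, esym f) Q) = prD e *m Q *m (prD f)^T.
Proof. by rewrite castmx_mulr /drsubmx -mulmxA -mul_dsub_mx -mulmx_rsub prD_cast -mulmx_rsub prD_castr mulmxA. Qed.
End Sub.

Section ProjEq.
Variables (n1 n2 d : nat) (e : (n1 + n2 = d)%N).

Lemma prUU : prU e *m (prU e)^T = 1%:M.
Proof. by case: d / e; rewrite /prU castmx_id tr_row_mx trmx1 trmx0 mul_row_col mulmx1 mulmx0 addr0. Qed.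
Lemma prDD : prD e *m (prD e)^T = 1%:M.
Proof. by case: d / e; rewrite /prD castmx_id tr_row_mx trmx1 trmx0 mul_row_col mulmx1 mulmx0 add0r. Qed.
Lemma prUD : prU e *m (prD e)^T = 0.
Proof. by case: d / e; rewrite /prU /prD !castmx_id tr_row_mx trmx1 trmx0 mul_row_col mulmx1 mulmx0 addr0. Qed.
Lemma prDU : prD e *m (prU e)^T = 0.
Proof. by case: d / e; rewrite /prU /prD !castmx_id tr_row_mx trmx1 trmx0 mul_row_col mulmx1 mulmx0 addr0. Qed.
Lemma prsum : (prU e)^T *m prU e + (prD e)^T *m prD e = 1%:M.
Proof.
case: d / e; rewrite /prU /prD !castmx_id !tr_row_mx !trmx1 !trmx0 !mul_col_row.
by rewrite ?mulmx1 ?mul1mx ?mulmx0 ?mul0mx ?mulmx1 ?mul1mx ?mulmx0 ?mul0mx add_block_mx !addr0 !add0r -scalar_mx_block.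
Qed.
Lemma N1_row_mx m p q (A : 'M[R]_(m, p)) (B : 'M[R]_(m, q)) : N1 (row_mx A B) = N1 A + N1 B.
Proof.
rewrite /N1 -big_split /=; apply: eq_bigr => i _; rewrite big_split_ord /=.
by congr (_ + _); apply: eq_bigr => j _; rewrite ?row_mxEl ?row_mxEr.
Qed.
Lemma N1_prU : N1 (prU e) <= d%:R.
Proof. by case: d / e; rewrite /prU castmx_id N1_row_mx N1_1 N1_0 addr0 ler_nat leq_addr. Qed.
Lemma N1_prD : N1 (prD e) <= d%:R.
Proof. by case: d / e; rewrite /prD castmx_id N1_row_mx N1_1 N1_0 add0r ler_nat leq_addl. Qed.
End ProjEq.

Section ModeAlg.
Variable d : nat.
Implicit Types s : mode R d.

Definition slow s := prU (split_eq (ml s)).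
Definition fast s := prD (split_eq (ml s)).
Definition Kmat s := invmx (Dblk s) *m Cblk s.

(** Put y = P X, so that w1 = y1 and w2 = y2 + K y1 with K = D^-1 C. Then e y2' = C y1 + D y2 = D w2
    and y1' = M w1 + B w2, whence w2' = (D / e) w2 + K (M w1 + B w2): the coupling blocks are K B
    and K M. *)
Definition piece_of s : piece R d :=
  Piece (slow s) (fast s) (Mmat s) (Bblk s) (Dblk s) (Kmat s *m Bblk s) (Kmat s *m Mmat s).

Lemma proj_ok_of s : proj_ok (piece_of s).
Proof.
split; rewrite /=; [exact: prUU|exact: prDD|exact: prUD|exact: prDU|exact: prsum|
  exact: N1_prU|exact: N1_prD|exact: ltnW (ltn_ord _)|exact: leq_subr].
Qed.

Lemma AblkE s : Ablk s = slow s *m LPinv s *m (slow s)^T.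
Proof. exact: ulsub_cast. Qed.
Lemma BblkE s : Bblk s = slow s *m LPinv s *m (fast s)^T.
Proof. exact: ursub_cast. Qed.
Lemma CblkE s : Cblk s = fast s *m LPinv s *m (slow s)^T.
Proof. exact: dlsub_cast. Qed.
Lemma DblkE s : Dblk s = fast s *m LPinv s *m (fast s)^T.
Proof. exact: drsub_cast. Qed.

Lemma ulblockE s s' Q : ulblock (ml s) (ml s') Q = slow s *m Q *m (slow s')^T.
Proof. exact: ulsub_cast. Qed.

Lemma TmatE s : Tmat s = (1%:M + (fast s)^T *m Kmat s *m slow s) *m mP s.
Proof.
rewrite /Tmat cast_block !mul1mx mul0mx addr0 -/(slow s) -/(fast s) -/(Kmat s) mulmxDr.
by rewrite addrCA prsum mulmxA [in LHS]addrC.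
Qed.

Lemma diag0DE s : diag0D s = (fast s)^T *m Dblk s *m fast s.
Proof. by rewrite /diag0D cast_block !mul0mx !add0r mulmx0 add0r mulmxA. Qed.

Lemma EepsE s e : Eeps d (ml s) e = (slow s)^T *m slow s + e *: ((fast s)^T *m fast s).
Proof.
have -> : (slow s)^T *m slow s + e *: ((fast s)^T *m fast s) =
  castmx (split_eq (ml s), split_eq (ml s)) (block_mx 1%:M 0 0 e%:M).
  by rewrite cast_block mul1mx !mul0mx addr0 add0r mul_scalar_mx -scalemxAr.
apply/matrixP => i j; rewrite mxE castmxE.
set i' := cast_ord _ i; set j' := cast_ord _ j.
have ei : (i' : nat) = i by []. have ej : (j' : nat) = j by [].
have -> : (i == j) = (i' == j') by rewrite -!val_eqE.
rewrite -ei; move: i' j' {ei ej} => i' j'.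
case: (split_ordP i') => k ->; case: (split_ordP j') => l ->;
  rewrite ?block_mxEul ?block_mxEur ?block_mxEdl ?block_mxEdr !mxE /= -val_eqE /=.
- by rewrite -(val_eqE k l) /=; case: (_ == _).
- by rewrite ltn_eqF // (leq_trans (ltn_ord k)) // leq_addr.
- by rewrite gtn_eqF // (leq_trans (ltn_ord l)) // leq_addr.
- by rewrite eqn_add2l -(val_eqE k l) /=; case: (_ == _).
Qed.

Lemma invEeps s e : e != 0 ->
  invmx (Eeps d (ml s) e) = (slow s)^T *m slow s + e^-1 *: ((fast s)^T *m fast s).
Proof.
move=> e0; set F := _ + _.
have h : F *m Eeps d (ml s) e = 1%:M.
  have k1 := prUU (split_eq (ml s)); have k2 := prDD (split_eq (ml s)).
  have k3 := prUD (split_eq (ml s)); have k4 := prDU (split_eq (ml s)).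
  rewrite /F EepsE mulmxDl !mulmxDr -!scalemxAl -!scalemxAr !mulmxA.
  rewrite -(mulmxA _ (slow s)) k1 -(mulmxA _ (slow s) (fast s)^T) k3 -(mulmxA _ (fast s)) k4.
  rewrite -(mulmxA _ (fast s) (fast s)^T) k2 !mulmx1 !mulmx0 !mul0mx !scaler0 addr0 add0r.
  by rewrite scalerA mulVf // scale1r prsum.
have [hu _] := mulmx1_unit h.
by rewrite -[LHS]mul1mx -h mulmxK //; case: (mulmx1_unit h).
Qed.

Section Unit.
Variable s : mode R d.
Hypothesis Pu : mP s \in unitmx.
Hypothesis Du : Dblk s \in unitmx.
Let p := slow s.
Let q := fast s.
Let K := Kmat s.
Let pp : p *m p^T = 1%:M := prUU _.
Let qq : q *m q^T = 1%:M := prDD _.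
Let pq : p *m q^T = 0 := prUD _.
Let qp : q *m p^T = 0 := prDU _.

Lemma unip_inv : (1%:M + q^T *m K *m p) *m (1%:M - q^T *m K *m p) = 1%:M.
Proof.
rewrite mulmxDl !mulmxBr !mulmx1 !mul1mx.
have -> : q^T *m K *m p *m (q^T *m K *m p) = 0.
  by rewrite !mulmxA -(mulmxA _ p) pq mulmx0 !mul0mx.
by rewrite subr0 subrK.
Qed.

Lemma Tunit : Tmat s \in unitmx.
Proof.
by rewrite TmatE unitmx_mul Pu andbT; have [] := mulmx1_unit unip_inv.
Qed.

Lemma LPsplit : LPinv s = p^T *m (Ablk s *m p + Bblk s *m q) + q^T *m (Cblk s *m p + Dblk s *m q).
Proof.
have ps : p^T *m p + q^T *m q = 1%:M := prsum _.
have -> : LPinv s = p^T *m (p *m LPinv s *m 1%:M) + q^T *m (q *m LPinv s *m 1%:M).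
  by move: (LPinv s) => Q; rewrite !mulmx1 !mulmxA -mulmxDl ps mul1mx.
rewrite -ps AblkE BblkE CblkE DblkE -/p -/q; move: (LPinv s) => Q.
by rewrite !mulmxDr !mulmxA.
Qed.

Lemma mode_intertwine e : e != 0 ->
  Tmat s *m (invmx (mP s) *m invmx (Eeps d (ml s) e) *m mL s) = Lmx (piece_of s) e *m Tmat s.
Proof.
move=> e0.
have eL : mL s = LPinv s *m mP s by rewrite /LPinv mulmxKV.
rewrite eL invEeps // TmatE -/p -/q -/K.
have hp : p *m LPinv s = Ablk s *m p + Bblk s *m q.
  by rewrite LPsplit mulmxDr !mulmxA pp pq mul1mx !mul0mx addr0.
have hq : q *m LPinv s = Cblk s *m p + Dblk s *m q.
  by rewrite LPsplit mulmxDr !mulmxA qq qp mul1mx !mul0mx add0r.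
move: (LPinv s) hp hq => Q hp hq.

have hDK : Dblk s *m K = Cblk s by rewrite /K /Kmat mulKVmx.
rewrite /Lmx /= -/p -/q -/K.
have hM : Mmat s = Ablk s - Bblk s *m K by rewrite /Mmat /K /Kmat mulmxA.
move: (Ablk s) (Bblk s) (Cblk s) (Dblk s) (Mmat s) hM hDK hp hq => A B C D M hM hDK hp hq.
clearbody K; clearbody pp qq pq qp; clearbody p q.
rewrite !mulmxA mulmxK //; congr (_ *m _).
have r1 : (M *m p + B *m q) *m (1%:M + q^T *m K *m p) = A *m p + B *m q.
  rewrite mulmxDr mulmx1 mulmxDl !mulmxA -(mulmxA _ p q^T) pq -(mulmxA _ q q^T) qq.
  by rewrite mulmx0 !mul0mx add0r mulmx1 hM mulmxBl addrAC subrK.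
have r2 : ((e^-1 *: D) *m q) *m (1%:M + q^T *m K *m p) = e^-1 *: (C *m p + D *m q).
  rewrite mulmxDr mulmx1 !mulmxA -(mulmxA _ q q^T) qq mulmx1.
  by rewrite -!scalemxAl hDK -scalerDr addrC.
have -> : K *m M *m p + (e^-1 *: D + K *m B) *m q =
  K *m (M *m p + B *m q) + (e^-1 *: D) *m q.
  by rewrite mulmxDl mulmxDr !mulmxA -addrA; congr (_ + _); rewrite addrC.
rewrite [RHS]mulmxDl -(mulmxA p^T) r1 -(mulmxA q^T (_ + _)) (mulmxDl (K *m _)) -(mulmxA K) r1 r2.
have -> : (1%:M + q^T *m K *m p) *m (p^T *m p + e^-1 *: (q^T *m q)) =
   p^T *m p + (q^T *m K *m p + e^-1 *: (q^T *m q)).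
  rewrite mulmxDl mul1mx mulmxDr -!scalemxAr !mulmxA -(mulmxA _ p p^T) pp -(mulmxA _ p q^T) pq.
  by rewrite mulmx1 mulmx0 mul0mx scaler0 addr0 -addrA; congr (_ + _); rewrite addrC.
rewrite !mulmxDl -scalemxAl -(mulmxA _ p Q) -(mulmxA _ p Q) -(mulmxA _ q Q) hp hq.
by rewrite (mulmxDr q^T (K *m _)) -scalemxAr (mulmxA q^T K).
Qed.

End Unit.
End ModeAlg.
End Blocks.

(** * Uniformity over the compact set of modes *)

Section Uniform.
Variable R : realType.

Section MCont.
Variables (T : topologicalType) (p0 : T).

Definition mcont m n (f : T -> 'M[R]_(m, n)) :=
  forall i j, f p i j @[p --> p0] --> f p0 i j.

Lemma mcont_cst m n (A : 'M[R]_(m, n)) : mcont (fun=> A).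
Proof. by move=> i j; exact: cvg_cst. Qed.

Lemma mcont_ext m n (f g : T -> 'M[R]_(m, n)) : (forall p, f p = g p) -> mcont g -> mcont f.
Proof. by move=> h hg; rewrite (funext h). Qed.

Lemma mcontD m n (f g : T -> 'M[R]_(m, n)) : mcont f -> mcont g -> mcont (fun p => f p + g p).
Proof.
move=> hf hg i j; rewrite mxE; under eq_fun do rewrite mxE.
by apply: cvgD; [exact: hf|exact: hg].
Qed.

Lemma mcontN m n (f : T -> 'M[R]_(m, n)) : mcont f -> mcont (fun p => - f p).
Proof.
move=> hf i j; rewrite mxE; under eq_fun do rewrite mxE.
by apply: cvgN; exact: hf.
Qed.

Lemma mcontM m n q (f : T -> 'M[R]_(m, n)) (g : T -> 'M[R]_(n, q)) :
  mcont f -> mcont g -> mcont (fun p => f p *m g p).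
Proof.
move=> hf hg i j; rewrite mxE; under eq_fun do rewrite mxE.
apply: cvg_big => [|l _]; first exact: add_continuous.
by apply: cvgM; [exact: hf|exact: hg].
Qed.

Lemma cvg_det n (f : T -> 'M[R]_n) : mcont f -> \det (f p) @[p --> p0] --> \det (f p0).
Proof.
move=> hf; rewrite /determinant.
apply: cvg_big => [|s _]; first exact: add_continuous.
apply: cvgM; first exact: cvg_cst.
apply: cvg_big => [|i _]; first exact: mul_continuous.
exact: hf.
Qed.

End MCont.

Section MInv.
Variables (T : topologicalType) (p0 : T).

(** The determinant stays nonzero near [p0]; there [invmx] is given by cofactors over the
    determinant. *)
Lemma mcont_inv n (f : T -> 'M[R]_n) : mcont p0 f -> f p0 \in unitmx ->
  mcont p0 (fun p => invmx (f p)).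
Proof.
move=> hf hu i j.
have hd := cvg_det hf.
have d0 : \det (f p0) != 0 by rewrite -unitfE -unitmxE.
have hdn : \forall p \near p0, \det (f p) != 0 by exact: cvgr_neq0 hd d0.
have hn : {near p0, (fun p => (\det (f p))^-1 * cofactor (f p) j i) =1 (fun p => invmx (f p) i j)}.
  near=> p.
  have hp : \det (f p) != 0 by near: p.
  by rewrite /invmx unitmxE unitfE hp !mxE.
apply: cvg_trans (near_eq_cvg hn) _.
rewrite /invmx hu !mxE.
apply: cvgM; first exact: cvgV.
rewrite /cofactor; apply: cvgM; first exact: cvg_cst.
apply: cvg_det => k l; rewrite !mxE; under eq_fun do rewrite !mxE.
exact: hf.
Unshelve. all: by end_near. Qed.

Lemma mcont_near m n (f : T -> 'M[R]_(m, n)) e : mcont p0 f -> 0 < e ->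
  \forall p \near p0, N1 (f p - f p0) <= e.
Proof.
move=> hf e0.
pose c : R := (m * n)%:R.
have c0 : 0 <= c by [].
have d0 : 0 < e / (c + 1) by rewrite divr_gt0 // ltr_wpDl.
have h : \forall p \near p0, forall i j, `|f p0 i j - f p i j| < e / (c + 1).
  apply: (@filter_forall _ _ (fun i p => forall j, `|f p0 i j - f p i j| < e / (c + 1)) (nbhs p0) _) => i.
  apply: (@filter_forall _ _ (fun j p => `|f p0 i j - f p i j| < e / (c + 1)) (nbhs p0) _) => j.
  by have /cvgrPdist_lt := hf i j; apply.
apply: filterS h => p hp.
apply: (@le_trans _ _ (c * (e / (c + 1)))).
  by apply: N1_bound => i j; rewrite !mxE distrC ltW.
rewrite mulrA ler_pdivrMr ?ltr_wpDl // mulrC; apply: ler_wpM2l; first exact: ltW.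
by rewrite lerDl.
Qed.

Lemma mcont_bound m n (f : T -> 'M[R]_(m, n)) : mcont p0 f ->
  \forall p \near p0, N1 (f p) <= N1 (f p0) + 1.
Proof.
move=> hf; have := mcont_near hf ltr01; apply: filterS => p hp.
rewrite -[f p](subrK (f p0)); apply: le_trans (N1D _ _) _.
by rewrite addrC lerD2l.
Qed.

End MInv.

(** Near-covering compactness against the filter of large constants: by monotonicity a local
    constant remains valid for all larger ones, so some constant serves everywhere. *)
Lemma compact_uniform (T : topologicalType) (A : set T) (Q : T -> R -> Prop) :
  compact A -> (forall p C C', C <= C' -> Q p C -> Q p C') ->
  (forall p0, A p0 -> exists C, \forall p \near p0, A p -> Q p C) ->
  exists C, forall p, A p -> Q p C.
Proof.
move=> /compact_near_coveringP cA mono loc.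
have : \forall C \near +oo, A `<=` (fun p => A p -> Q p C).
  apply: cA => p0 Ap0; have [C hC] := loc p0 Ap0.
  exists ((fun p => A p -> Q p C), [set C' | C <= C']).
    by split => //=; apply: nbhs_pinfty_ge; rewrite num_real.
  by move=> [p C'] /= [h1 h2] Ap; apply: mono (h1 Ap).
case/filter_ex => C hC; exists C => p Ap; exact: hC.
Qed.

Lemma le_sum_mem (ms : seq R) : (forall x, x \in ms -> 0 <= x) ->
  forall x, x \in ms -> x <= \sum_(y <- ms) y + 1.
Proof.
move=> ms0 x xm; rewrite (big_rem x) //= -addrA lerDl addr_ge0 //.
rewrite big_seq sumr_ge0 // => y yr; apply: ms0; exact: (mem_rem yr).
Qed.

Section Modes.
Variable d : nat.
Implicit Types s : mode R d.

Record mode_ok s (mu C : R) : Prop := ModeOk {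
  oP : mP s \in unitmx;
  oD : Dblk s \in unitmx;
  opiece : piece_ok (piece_of s) mu C;
  oT : N1 (Tmat s) <= C;
  oTi : N1 (invmx (Tmat s)) <= C;
  oR : N1 (mR s) <= C;
  oM : N1 (Mmat s) <= C;
  oDn : N1 (Dblk s) <= C }.

Lemma mode_ok_mono s mu C C' : 0 < C -> C <= C' -> mode_ok s mu C -> mode_ok s mu C'.
Proof.
move=> C0 CC' [h1 h2 [h3 [H4 h4] [H5 h5] h6 h7 h8] h9 h10 h11 h12 h13].
have C'0 : 0 < C' by apply: lt_le_trans CC'.
split => //; try exact: le_trans CC'.
split => //; try exact: le_trans CC'.
- by exists H4; apply: is_lyap_mono h4.
- by exists H5; apply: is_lyap_mono h5 => //; rewrite lerN2 lef_pV2.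
Qed.

Lemma Hurwitz_unit n (A : 'M[R]_n) : Hurwitz A -> A \in unitmx.
Proof.
move=> hA; rewrite unitmxE unitfE; apply/negP => /eqP d0.
have : eigenvalue (map_mx (fun x : R => (x%:C)%C) A) 0.
  rewrite eigenvalue_root_char rootE horner_coef0 char_poly_det.
  by rewrite det_map_mx d0 rmorph0 mulr0.
by move/hA; rewrite /= ltxx.
Qed.

(** With [l] fixed all blocks have constant sizes, so their continuity in [p] can be stated. *)
Definition mk_mode (l : 'I_d) (p : 'M[R]_d * ('M[R]_d * 'M[R]_d)) : mode R d :=
  Mode l p.1 p.2.1 p.2.2.

Lemma mode_ok_near l p0 mu :
  mP (mk_mode l p0) \in unitmx -> Hurwitz (Dblk (mk_mode l p0)) ->
  (forall z, eigenvalue (map_mx (fun x : R => (x%:C)%C) (Mmat (mk_mode l p0))) z -> complex.Re z < mu) ->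
  exists C, 0 < C /\ \forall p \near p0, mP (mk_mode l p) \in unitmx ->
    Dblk (mk_mode l p) \in unitmx -> mode_ok (mk_mode l p) mu C.
Proof.
move=> hP hD hM.
have hDu := Hurwitz_unit hD.
have cP : mcont p0 (fun p => mP (mk_mode l p)).
  move=> i j; apply: (@cvg_comp _ _ _ (fun p : 'M[R]_d * ('M[R]_d * 'M[R]_d) => p.1) (fun M : 'M[R]_d => M i j) _ _ _ _).
    exact: cvg_fst. exact: coord_continuous.
have cL : mcont p0 (fun p => mL (mk_mode l p)).
  move=> i j; apply: (@cvg_comp _ _ _ (fun p : 'M[R]_d * ('M[R]_d * 'M[R]_d) => p.2.1) (fun M : 'M[R]_d => M i j) _ _ _ _).
    by apply: (@cvg_comp _ _ _ snd fst); [exact: cvg_snd|exact: cvg_fst].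
  exact: coord_continuous.
have cR : mcont p0 (fun p => mR (mk_mode l p)).
  move=> i j; apply: (@cvg_comp _ _ _ (fun p : 'M[R]_d * ('M[R]_d * 'M[R]_d) => p.2.2) (fun M : 'M[R]_d => M i j) _ _ _ _).
    by apply: (@cvg_comp _ _ _ snd snd); [exact: cvg_snd|exact: cvg_snd].
  exact: coord_continuous.
have cQ : mcont p0 (fun p => LPinv (mk_mode l p)).
  exact: (mcontM cL (mcont_inv cP hP)).
have cA : @mcont _ p0 l l (fun p => Ablk (mk_mode l p)).
  apply: (@mcont_ext _ p0 l l (fun p => Ablk (mk_mode l p)) _ (fun p => AblkE (mk_mode l p))).
  exact: (mcontM (mcontM (@mcont_cst _ p0 _ _ _) cQ) (@mcont_cst _ p0 _ _ _)).
have cB : @mcont _ p0 l (d - l) (fun p => Bblk (mk_mode l p)).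
  apply: (@mcont_ext _ p0 l (d - l) (fun p => Bblk (mk_mode l p)) _ (fun p => BblkE (mk_mode l p))).
  exact: (mcontM (mcontM (@mcont_cst _ p0 _ _ _) cQ) (@mcont_cst _ p0 _ _ _)).
have cC : @mcont _ p0 (d - l) l (fun p => Cblk (mk_mode l p)).
  apply: (@mcont_ext _ p0 (d - l) l (fun p => Cblk (mk_mode l p)) _ (fun p => CblkE (mk_mode l p))).
  exact: (mcontM (mcontM (@mcont_cst _ p0 _ _ _) cQ) (@mcont_cst _ p0 _ _ _)).
have cD : @mcont _ p0 (d - l) (d - l) (fun p => Dblk (mk_mode l p)).
  apply: (@mcont_ext _ p0 (d - l) (d - l) (fun p => Dblk (mk_mode l p)) _ (fun p => DblkE (mk_mode l p))).
  exact: (mcontM (mcontM (@mcont_cst _ p0 _ _ _) cQ) (@mcont_cst _ p0 _ _ _)).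
have cDi : @mcont _ p0 (d - l) (d - l) (fun p => invmx (Dblk (mk_mode l p))) := mcont_inv cD hDu.
have cK : @mcont _ p0 (d - l) l (fun p => Kmat (mk_mode l p)) := mcontM cDi cC.
have cM : @mcont _ p0 l l (fun p => Mmat (mk_mode l p)).
  exact: (mcontD cA (mcontN (mcontM (mcontM cB cDi) cC))).
have cT : mcont p0 (fun p => Tmat (mk_mode l p)).
  apply: (mcont_ext (fun p => TmatE (mk_mode l p))).
  apply: mcontM cP; apply: mcontD; first exact: mcont_cst.
  exact: (mcontM (mcontM (@mcont_cst _ p0 _ _ _) cK) (@mcont_cst _ p0 _ _ _)).
have cTi : mcont p0 (fun p => invmx (Tmat (mk_mode l p))).
  by apply: (@mcont_inv _ p0 d (fun p => Tmat (mk_mode l p)) cT); exact: Tunit.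
have cF : @mcont _ p0 (d - l) (d - l) (fun p => Kmat (mk_mode l p) *m Bblk (mk_mode l p)) := mcontM cK cB.
have cG : @mcont _ p0 (d - l) l (fun p => Kmat (mk_mode l p) *m Mmat (mk_mode l p)) := mcontM cK cM.
have [Q1 [c1 [g1 [c10 g10 l1]]]] := lyap_exists hM.
have [Q2 [c2 [g2 [c20 g20 l2]]]] := lyap_exists hD.
(* The Lyapunov functions at [p0] are kept for all nearby modes. The radii are the budgets of
   [is_lyap_perturb]: the whole gap for [Mmat], only half of it for [Dblk], whose rate must remain
   below - g2 / 2; the entry 2 / g2 of [ms] turns this into - C^-1. *)
have n1 := mcont_near cM (divr_gt0 g10 (exprn_gt0 2 c10)).
have n2 := mcont_near cD (divr_gt0 (divr_gt0 g20 (ltr0Sn R 1)) (exprn_gt0 2 c20)).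
have b1 := mcont_bound cB. have b2 := mcont_bound cF. have b3 := mcont_bound cG.
have b4 := mcont_bound cT. have b5 := mcont_bound cTi. have b6 := mcont_bound cR.
have b7 := mcont_bound cM. have b8 := mcont_bound cD.
set m1 := N1 _ + 1 in b1; set m2 := N1 _ + 1 in b2; set m3 := N1 _ + 1 in b3.
set m4 := N1 _ + 1 in b4; set m5 := N1 _ + 1 in b5; set m6 := N1 _ + 1 in b6.
set m7 := N1 _ + 1 in b7; set m8 := N1 _ + 1 in b8.
pose ms := [:: c1; c2; 2 / g2; m1; m2; m3; m4; m5; m6; m7; m8].
have ms0 : forall x, x \in ms -> 0 <= x.
  have mm (x y : nat) (X : 'M[R]_(x, y)) : 0 <= N1 X + 1 by rewrite addr_ge0 ?N1_ge0.
  apply/(@allP _ (fun x => 0 <= x)); rewrite /= (ltW c10) (ltW c20).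
  by rewrite divr_ge0 ?(ltW g20) // /m1 /m2 /m3 /m4 /m5 /m6 /m7 /m8 !mm.
pose C := \sum_(x <- ms) x + 1.
have hC x : x \in ms -> x <= C.
  exact: le_sum_mem.
have C0 : 0 < C by rewrite ltr_wpDl // big_seq sumr_ge0.
exists C; split => //.
near=> p => hPp hDp.
have k1 : N1 (Mmat (mk_mode l p) - Mmat (mk_mode l p0)) <= g1 / c1 ^+ 2 by near: p.
have k2 : N1 (Dblk (mk_mode l p) - Dblk (mk_mode l p0)) <= g2 / 2 / c2 ^+ 2 by near: p.
have hb x y : y \in ms -> x <= y -> x <= C by move=> /hC yC xy; exact: le_trans yC.
have d1 : N1 (Bblk (mk_mode l p)) <= C by apply: (hb _ m1); rewrite ?inE ?eqxx ?orbT //; near: p.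
have d2 : N1 (Kmat (mk_mode l p) *m Bblk (mk_mode l p)) <= C by apply: (hb _ m2); rewrite ?inE ?eqxx ?orbT //; near: p.
have d3 : N1 (Kmat (mk_mode l p) *m Mmat (mk_mode l p)) <= C by apply: (hb _ m3); rewrite ?inE ?eqxx ?orbT //; near: p.
have d4 : N1 (Tmat (mk_mode l p)) <= C by apply: (hb _ m4); rewrite ?inE ?eqxx ?orbT //; near: p.
have d5 : N1 (invmx (Tmat (mk_mode l p))) <= C by apply: (hb _ m5); rewrite ?inE ?eqxx ?orbT //; near: p.
have d6 : N1 (mR (mk_mode l p)) <= C by apply: (hb _ m6); rewrite ?inE ?eqxx ?orbT //; near: p.
have d7 : N1 (Mmat (mk_mode l p)) <= C by apply: (hb _ m7); rewrite ?inE ?eqxx ?orbT //; near: p.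
have d8 : N1 (Dblk (mk_mode l p)) <= C by apply: (hb _ m8); rewrite ?inE ?eqxx ?orbT //; near: p.
split => //; split => //; first exact: proj_ok_of.
- exists Q1; apply: (is_lyap_mono c10 (lexx _)); first by apply: hC; rewrite !inE eqxx.
  rewrite -(subrK g1 mu); apply: is_lyap_perturb l1 _ => //.
  by rewrite mulrC -ler_pdivlMr // exprn_gt0.
- exists Q2.
  have hp : is_lyap Q2 (Dblk (mk_mode l p)) ((0 - g2) + g2 / 2) c2.
    apply: is_lyap_perturb l2 _ => //.
    by rewrite mulrC -ler_pdivlMr // exprn_gt0.
  apply: is_lyap_mono hp => //; last by apply: hC; rewrite !inE eqxx orbT.
  have : C^-1 <= g2 / 2.
    rewrite -[g2 / 2]invrK lef_pV2 ?posrE ?invr_gt0 ?divr_gt0 // invf_div.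
    by apply: hC; rewrite !inE eqxx !orbT.
  by lra.
Unshelve. all: by end_near. Qed.

Lemma mode_ok_uniform (K : set (mode R d)) mu :
  (forall s, K s -> mP s \in unitmx) ->
  (forall l : 'I_d, compact [set p : 'M[R]_d * ('M[R]_d * 'M[R]_d) | K (Mode l p.1 p.2.1 p.2.2)]) ->
  (forall s, K s -> Hurwitz (Dblk s)) ->
  (forall s, K s -> forall z, eigenvalue (map_mx (fun x : R => (x%:C)%C) (Mmat s)) z -> complex.Re z < mu) ->
  exists2 C, 1 <= C & forall s, K s -> mode_ok s mu C.
Proof.
move=> hP hK hD hM.
have h (l : 'I_d) : exists C, forall p, K (mk_mode l p) -> 0 < C /\ mode_ok (mk_mode l p) mu C.
  apply: (@compact_uniform _ [set p | K (mk_mode l p)] (fun p C => 0 < C /\ mode_ok (mk_mode l p) mu C) (hK l)).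
    move=> p C C' CC' [C0 hC]; split; first exact: lt_le_trans CC'.
    exact: mode_ok_mono hC.
  move=> p0 Kp0.
  have [C [C0 hC]] := mode_ok_near (hP _ Kp0) (hD _ Kp0) (hM _ Kp0).
  exists C; apply: filterS hC => p hp Kp; split => //.
  by apply: hp; [exact: hP|exact/Hurwitz_unit/hD].
have [Cf hCf] := choice h.
exists (\sum_l `|Cf l| + 1); first by rewrite lerDr sumr_ge0.
move=> [l P L Rm] Ks; have [C0 hC] := hCf l (P, (L, Rm)) Ks.
apply: mode_ok_mono hC => //.
rewrite (bigD1 l) //= -addrA; apply: le_trans (ler_norm _) _.
by rewrite lerDl addr_ge0 // sumr_ge0.
Qed.

End Modes.
End Uniform.

(** * Operator norms, products of matrices and growth rates *)

Section OpNorm.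
Variable R : realType.

Lemma enorm_le_N1 n (x : 'cV[R]_n) : enorm x <= N1 x.
Proof.
have x0 : 0 <= N1 x := N1_ge0 x.
rewrite /enorm -[N1 x]ger0_norm // -sqrtr_sqr ler_wsqrtr //.
have -> : N1 x ^+ 2 = \sum_i `|x i 0| * N1 x.
  by rewrite -mulr_suml expr2; congr (_ * _); apply: eq_bigr => i _; rewrite big_ord1.
apply: ler_sum => i _; rewrite -real_normK ?num_real // expr2.
by apply: ler_wpM2l => //; exact: N1_entry.
Qed.

Lemma entry_le_enorm n (x : 'cV[R]_n) i : `|x i 0| <= enorm x.
Proof.
rewrite -sqrtr_sqr ler_wsqrtr // (bigD1 i) //= lerDl.
by apply: sumr_ge0 => j _; exact: sqr_ge0.
Qed.

Lemma N1_le_enorm n (x : 'cV[R]_n) : N1 x <= n%:R * enorm x.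
Proof.
rewrite -[n in n%:R]muln1; apply: N1_bound => i j; rewrite ord1; exact: entry_le_enorm.
Qed.

Lemma opnorm_ub m n (A : 'M[R]_(m, n)) :
  ubound [set enorm (A *m x) | x in [set x : 'cV[R]_n | enorm x <= 1]] (n%:R * N1 A).
Proof.
move=> _ [x /= x1 <-]; apply: le_trans (enorm_le_N1 _) _; apply: le_trans (N1M _ _) _.
rewrite mulrC; apply: ler_wpM2r; first exact: N1_ge0.
by apply: le_trans (N1_le_enorm _) _; rewrite -[leRHS]mulr1; apply: ler_wpM2l.
Qed.

Lemma enorm0 n : enorm (0 : 'cV[R]_n) = 0.
Proof. by rewrite /enorm big1 ?sqrtr0 // => i _; rewrite mxE expr0n. Qed.

Lemma opnorm_le m n (A : 'M[R]_(m, n)) : opnorm A <= n%:R * N1 A.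
Proof.
apply: ge_sup; last exact: opnorm_ub.
by exists (enorm (A *m 0)); exists 0 => //=; rewrite enorm0.
Qed.

Lemma le_opnorm m n (A : 'M[R]_(m, n)) x : enorm x <= 1 -> enorm (A *m x) <= opnorm A.
Proof.
move=> x1; apply: ub_le_sup; first by exists (n%:R * N1 A); exact: opnorm_ub.
by exists x.
Qed.

Lemma opnorm_ge0 m n (A : 'M[R]_(m, n)) : 0 <= opnorm A.
Proof. by have := @le_opnorm m n A 0; rewrite mulmx0 !enorm0; apply. Qed.

Lemma N1_le_opnorm m n (A : 'M[R]_(m, n)) : N1 A <= (m * n)%:R * opnorm A.
Proof.
apply: N1_bound => i j.
have e1 : enorm (delta_mx j (0 : 'I_1) : 'cV[R]_n) <= 1.
  rewrite /enorm (bigD1 j) //= mxE !eqxx expr1n big1 ?addr0 ?sqrtr1 // => k /negbTE kj.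
  by rewrite mxE kj expr0n.
apply: le_trans (le_opnorm A e1); apply: le_trans (entry_le_enorm _ i).
by rewrite -colE mxE.
Qed.

End OpNorm.

(** * Products of perturbed matrices *)

Section Perturb.
Variables (R : realType) (n : nat).
Implicit Types (H G : nat -> 'M[R]_n) (r : nat -> R).

Fixpoint prodn G m : 'M[R]_n := if m is m'.+1 then G m' *m prodn G m' else 1%:M.

Lemma prodnSr G m : prodn G m.+1 = prodn (fun i => G i.+1) m *m G 0%N.
Proof.
elim: m => [|m IH]; first by rewrite /= mulmx1 mul1mx.
by rewrite [LHS]/= -/(prodn G m.+1) IH mulmxA.
Qed.

Lemma eq_prodn G H m : (forall i, (i < m)%N -> G i = H i) -> prodn G m = prodn H m.
Proof.
elim: m => // m IH h /=; rewrite h // IH // => i im; apply: h; exact: ltnW.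
Qed.

(* [adapted H r m x] is the maximum over [k <= m] of the norm of
   [H (k-1) ... H 0 x] divided by [r 0 ... r (k-1)]: a norm in which every step
   [H i] has norm at most [r i], so that errors on the steps only add up. *)
Fixpoint adapted H r m (x : 'cV[R]_n) : R :=
  if m is m'.+1 then
    Num.max (N1 x) (adapted (fun i => H i.+1) (fun i => r i.+1) m' (H 0%N *m x) / r 0%N)
  else N1 x.

Lemma adapted_ge H r m x : N1 x <= adapted H r m x.
Proof. by case: m => //= m; rewrite le_max lexx. Qed.

Lemma adaptedD H r m x y : (forall i, 0 < r i) ->
  adapted H r m (x + y) <= adapted H r m x + adapted H r m y.
Proof.
elim: m H r x y => [|m IH] H r x y r0 /=; first exact: N1D.
rewrite ge_max; apply/andP; split.
  by apply: le_trans (N1D _ _) _; apply: lerD; rewrite le_max lexx.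
rewrite mulmxDr; apply: (@le_trans _ _ ((adapted (fun i => H i.+1) (fun i => r i.+1) m (H 0%N *m x) +
   adapted (fun i => H i.+1) (fun i => r i.+1) m (H 0%N *m y)) / r 0%N)).
  by apply: ler_wpM2r; [rewrite invr_ge0 ltW|exact: IH].
by rewrite mulrDl; apply: lerD; rewrite le_max lexx orbT.
Qed.

Lemma adapted_le H r m x c : (forall i, 0 < r i) ->
  (forall k, (k <= m)%N -> N1 (prodn H k *m x) <= c * \prod_(i < k) r i) ->
  adapted H r m x <= c.
Proof.
elim: m H r x c => [|m IH] H r x c r0 h /=.
  by have := h 0%N isT; rewrite big_ord0 mulr1 mul1mx.
rewrite ge_max; apply/andP; split.
  by have := h 0%N isT; rewrite big_ord0 mulr1 mul1mx.
rewrite ler_pdivrMr //; apply: IH => // k km.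
have := h k.+1 km; rewrite prodnSr big_ord_recl mulrA -mulmxA.
by under eq_bigr do rewrite lift0.
Qed.

(** In the norm adapted to the remaining steps, [H i] costs at most [r i] and the error [C * q i],
    so [G i] costs at most [s i]. The constant [C] enters once more only when the initial vector is
    measured. As the norm changes with i, the hypothesis concerns all subproducts; the factor [n%:R]
    comes from passing from vectors to columns. *)
Lemma prodn_perturb H G r s q C m : (forall i, 0 < r i) -> (forall i, 0 <= s i) -> 0 <= C ->
  (forall j k, (j + k <= m)%N -> N1 (prodn (fun i => H (i + j)%N) k) <= C * \prod_(i < k) r (i + j)%N) ->
  (forall i, (i < m)%N -> N1 (G i - H i) <= q i) ->
  (forall i, (i < m)%N -> r i + C * q i <= s i) ->
  N1 (prodn G m) <= n%:R * (C * \prod_(i < m) s i).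
Proof.
move=> r0 s0 C0 hH hq hs; apply: N1_cols => x.
have ub H' r' m' y : (forall i, 0 < r' i) ->
    (forall k, (k <= m')%N -> N1 (prodn H' k) <= C * \prod_(i < k) r' i) ->
    adapted H' r' m' y <= C * N1 y.
  move=> r0' h; apply: adapted_le => // k km; apply: le_trans (N1M _ _) _.
  by rewrite mulrAC; apply: ler_wpM2r; [exact: N1_ge0|exact: h].
suff h : N1 (prodn G m *m x) <= (\prod_(i < m) s i) * adapted H r m x.
  apply: le_trans h _; rewrite (mulrC C) -mulrA; apply: ler_wpM2l; first exact: prodr_ge0.
  apply: ub => // k km; have := hH 0%N k km.
  under eq_bigr do rewrite addn0.
  by rewrite (eq_prodn (H := H)) // => i _; rewrite addn0.
elim: m H G r s q x r0 s0 hH hq hs => [|m IH] H G r s q x r0 s0 hH hq hs.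
  by rewrite big_ord0 mul1r /= mul1mx.
rewrite prodnSr -mulmxA.
have hH' j k : (j + k <= m)%N ->
    N1 (prodn (fun i => H (i + j).+1) k) <= C * \prod_(i < k) r (i + j).+1.
  move=> jk; have := hH j.+1 k jk.
  under eq_bigr do rewrite addnS.
  by rewrite (eq_prodn (H := fun i => H (i + j).+1)) // => i _; rewrite addnS.
apply: le_trans (IH (fun i => H i.+1) (fun i => G i.+1) (fun i => r i.+1) (fun i => s i.+1)
  (fun i => q i.+1) (G 0%N *m x) _ _ hH' _ _) _ => //.
- by move=> i im; apply: hq.
- by move=> i im; apply: hs.
rewrite [in leRHS]big_ord_recl.
under [X in _ <= _ * X * _]eq_bigr do rewrite lift0.
rewrite mulrAC [leRHS]mulrC; apply: ler_wpM2l; first by apply: prodr_ge0.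
have -> : G 0%N *m x = H 0%N *m x + (G 0%N - H 0%N) *m x.
  by rewrite -mulmxDl addrCA subrr addr0.
have r00 : forall i, 0 < r i.+1 by [].
apply: le_trans (adaptedD _ _ _ _ r00) _.
set V := adapted H r m.+1 x.
have V0 : N1 x <= V := adapted_ge H r m.+1 x.
have V1 : adapted (fun i => H i.+1) (fun i => r i.+1) m (H 0%N *m x) <= r 0%N * V.
  by rewrite mulrC -ler_pdivrMr // /V /= le_max lexx orbT.
have V2 : adapted (fun i => H i.+1) (fun i => r i.+1) m ((G 0%N - H 0%N) *m x) <= C * q 0%N * V.
  have hb : adapted (fun i => H i.+1) (fun i => r i.+1) m ((G 0%N - H 0%N) *m x) <= C * N1 ((G 0%N - H 0%N) *m x).
    apply: ub => // k km; have := hH' 0%N k km.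
    under eq_bigr do rewrite addn0.
    by rewrite (eq_prodn (H := fun i => H i.+1)) // => i _; rewrite addn0.
  apply: le_trans hb _; rewrite -mulrA; apply: ler_wpM2l => //.
  apply: le_trans (N1M _ _) _; apply: ler_pM; rewrite ?N1_ge0 //; exact: hq.
apply: le_trans (lerD V1 V2) _; rewrite -mulrDl; apply: ler_wpM2r; last exact: hs.
by apply: le_trans V0; exact: N1_ge0.
Qed.

End Perturb.

(** * Lyapunov exponents and exponential bounds *)

Section Rates.
Variable R : realType.
Implicit Types NS : R -> set R.

Lemma lyap_lt_bound NS (mu : R) : (forall t x, NS t x -> 0 <= x) -> (lyap NS < mu%:E)%E ->
  exists2 T, 0 < T & forall t x, T <= t -> NS t x -> x <= expR (mu * t).
Proof.
move=> h0 /ereal_inf_lt [_ [T _ <-] hT].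
(* The threshold must be positive to clear the division by t in [logdiv]. *)
exists (Num.max T 1); first by rewrite lt_max ltr01 orbT.
move=> t x; rewrite ge_max => /andP[Tt t1] xt.
have t0 : 0 < t by apply: lt_le_trans t1.
have [->|x0] := eqVneq x 0; first exact: expR_ge0.
have xp : 0 < x by rewrite lt_neqAle eq_sym x0 (h0 _ _ xt).
have : (logdiv x t < mu%:E)%E.
  apply: le_lt_trans hT; apply: (@le_trans _ _ (ereal_sup [set logdiv y t | y in NS t])).
    by apply: ereal_sup_ubound; exists x.
  by apply: ereal_sup_ubound; exists t.
rewrite /logdiv (negbTE x0) lte_fin ltr_pdivrMr // => hl.
by rewrite -[x](lnK (x := x)) ?posrE // ler_expR ltW.
Qed.

Lemma lyap_le_of_bound NS (mu mu' C : R) : mu < mu' -> 0 < C ->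
  (forall t x, 0 <= t -> NS t x -> 0 <= x /\ x <= C * expR (mu * t)) ->
  (lyap NS <= mu'%:E)%E.
Proof.
move=> hmu C0 h.
have g0 : 0 < mu' - mu by rewrite subr_gt0.
pose T := Num.max 1 (`|ln C| / (mu' - mu)).
have T1 : 0 < T by rewrite lt_max ltr01.
apply: ge_ereal_inf.
exists (ereal_sup [set ereal_sup [set logdiv x t | x in NS t] | t in [set t | T <= t]]); first by exists T.
apply/ereal_supP => _ [t /= Tt <-]; apply/ereal_supP => _ [x xt <-].
have t0 : 0 < t by apply: lt_le_trans Tt.
have [x0 xC] := h t x (ltW t0) xt.
rewrite /logdiv; case: eqVneq => [_|xn]; first exact: leNye.
have xp : 0 < x by rewrite lt_neqAle eq_sym xn x0.
rewrite lee_fin ler_pdivrMr // -ler_expR lnK ?posrE //.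
apply: le_trans xC _.
rewrite -[C in leLHS](lnK (x := C)) ?posrE // -expRD ler_expR.
have : `|ln C| <= (mu' - mu) * t.
  rewrite mulrC -ler_pdivrMr //; apply: le_trans Tt; by rewrite le_max lexx orbT.
have := ler_norm (ln C); lra.
Qed.

Lemma lyap_lt0_of_ES NS : (forall t x, NS t x -> 0 <= x) -> ES NS ->
  exists2 mu : R, mu < 0 & (lyap NS < mu%:E)%E.
Proof.
move=> h0 [c [del [c0 [d0 h]]]].
exists (- del / 4); first by rewrite mulNr oppr_lt0 divr_gt0.
apply: (@le_lt_trans _ _ (- del / 2)%:E).
  apply: (@lyap_le_of_bound _ (- del) _ c) => //; first lra.
  by move=> t x t0 xt; split; [exact: h0 xt|exact: h].
by rewrite lte_fin; lra.
Qed.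

Lemma limsup0_le (g : R -> \bar R) (r : R) (y : \bar R) : 0 < r ->
  (forall e, 0 < e < r -> (g e <= y)%E) -> (limsup_0plus g <= y)%E.
Proof.
move=> r0 h; apply: ge_ereal_inf.
exists (ereal_sup [set g e | e in [set e | 0 < e < r]]); first by exists r.
by apply/ereal_supP => _ [e /= he <-]; exact: h.
Qed.

(** Lyapunov exponents may be infinite, so they are compared through real rates strictly above. *)
Lemma lee_real_above (x y : \bar R) : (forall z : R, (y < z%:E)%E -> (x <= z%:E)%E) -> (x <= y)%E.
Proof.
case: y => [r| |] h; last 1 first.
- have h' (z : R) : (x <= z%:E)%E by apply: h; rewrite ltNyr.
  case: x h' {h} => [r| |] h'; rewrite ?leNye //; last by have := h' 0; rewrite leye_eq.
  by have := h' (r - 1 : R); rewrite lee_fin => hr; exfalso; lra.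
- apply/lee_addgt0Pr => e e0; rewrite -EFinD; apply: h.
  by rewrite lte_fin ltrDl.
- exact: leey.
Qed.

Lemma lte_real_between (x : \bar R) (y : R) : (x < y%:E)%E -> exists2 z, (x < z%:E)%E & z < y.
Proof.
case: x => [r| |] //.
- by rewrite lte_fin => h; exists ((r + y) / 2); rewrite ?lte_fin; lra.
- by move=> _; exists (y - 1); rewrite ?ltNyr //; lra.
Qed.

(** Both conclusions follow from one estimate, uniform in small [e] and valid for all t >= 0. For ES
    one takes [mu0] negative and mu = mu0 / 2, which is still negative. *)
Lemma singular_limit (NSb : R -> set R) (NSe : R -> R -> set R) :
  (forall t x, NSb t x -> 0 <= x) -> (forall e t x, NSe e t x -> 0 <= x) ->
  (forall mu0 mu, (lyap NSb < mu0%:E)%E -> mu0 < mu ->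
     exists e0 C, [/\ 0 < e0, 0 < C & forall e t x, 0 < e -> e < e0 -> 0 <= t ->
        NSe e t x -> x <= C * expR (mu * t)]) ->
  (limsup_0plus (fun e => lyap (NSe e)) <= lyap NSb)%E /\
  (ES NSb -> exists e0 : R, 0 < e0 /\ forall e : R, 0 < e < e0 -> ES (NSe e)).
Proof.
move=> hb he core; split.
  apply: lee_real_above => z /lte_real_between [mu0 h1 h2].
  have [] := core mu0 ((mu0 + z) / 2) h1 _; first lra.
  move=> e0 [C [e00 C0 h]]; apply: (limsup0_le e00) => e /andP[ep ee0].
  apply: (@lyap_le_of_bound _ ((mu0 + z) / 2) _ C) => //; first lra.
  by move=> t x t0 xt; split; [exact: he xt|exact: h xt].
move=> /(lyap_lt0_of_ES hb) [mu0 mu00 h1].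
have [] := core mu0 (mu0 / 2) h1 _; first lra.
move=> e0 [C [e00 C0 h]]; exists e0; split=> // e /andP[ep ee0].
exists C, (- (mu0 / 2)); split=> //; split; first lra.
by move=> t t0 x xt; rewrite opprK; exact: h xt.
Qed.

End Rates.

(** * Words *)

Section Words.
Variables (R : realType) (d : nat).
Implicit Types (v : nat -> mode R d) (u : nat -> R).

Definition wtime u (i : nat) : R := \sum_(k < i) u k.
Definition wsig v u N : signal R (mode R d) := Signal v (wtime u) (Some N).

Lemma wtimeS u i : wtime u i.+1 = wtime u i + u i.
Proof. by rewrite /wtime big_ord_recr. Qed.

Lemma wtime_dur u i : wtime u i.+1 - wtime u i = u i.
Proof. by rewrite wtimeS addrC addKr. Qed.

Lemma wtime_ge0 u m : (forall i, (i < m)%N -> 0 < u i) -> 0 <= wtime u m.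
Proof. by move=> h; apply: sumr_ge0 => i _; apply: ltW; exact: h. Qed.

Lemma wsig_admissible (K : set (mode R d)) tau v u N : (0 < N)%N ->
  (forall i, (i < N)%N -> K (v i)) ->
  (forall i, (i.+1 < N)%N -> [/\ 0 < u i, tau <= u i & v i.+1 <> v i]) ->
  admissible K tau (wsig v u N).
Proof.
move=> N0 hK hu; split.
- by rewrite /= /wtime big_ord0.
- by move=> n [<-].
- exact: hK.
- move=> k /hu [h1 h2 h3]; split; [|by rewrite [X in _ <= X]wtime_dur|exact: h3].
  by rewrite -subr_gt0 [X in _ < X]wtime_dur.
- by [].
Qed.

Definition delay (T : R) u : nat -> R := fun i => if i is 0%N then u 0%N + T else u i.

Lemma wtime_delay T u m : wtime (delay T u) m.+1 = wtime u m.+1 + T.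
Proof. by rewrite /wtime !big_ord_recl /= addrAC. Qed.

Definition jmp v i : 'M[R]_d := Tmat (v i.+1) *m mR (v i) *m invmx (Tmat (v i)).
Definition slowflow (s : mode R d) (t : R) : 'M[R]_d :=
  (slow s)^T *m expmx (t *: Mmat s) *m slow s.
(** Lift of a reduced step to dimension [d]: the reduced state changes dimension with the mode,
    while comparison with [Geps] needs square matrices of a fixed size. *)
Definition Hbar v u i := jmp v i *m slowflow (v i) (u i).
Definition Hhat v u i := jmp v i *m expmx (u i *: diag0D (v i)).
Definition Geps e v u i := jmp v i *m expmx (u i *: Lmx (piece_of (v i)) e).

Definition prebar v (tt : nat -> R) k :=
  preflow (dm := fun k => nat_of_ord (ml (v k)))
    (fun k t => expmx (t *: Mmat (v k)))
    (fun k => ulblock (ml (v k.+1)) (ml (v k)) (Tmat (v k.+1) *m mR (v k) *m invmx (Tmat (v k))))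
    tt k.

Lemma bar_lift v u tt m : (forall k, tt k.+1 - tt k = u k) ->
  prodn (Hbar v u) m.+1 =
  jmp v m *m (slow (v m))^T *m (expmx (u m *: Mmat (v m)) *m prebar v tt m) *m slow (v 0%N).
Proof.
move=> htt; elim: m => [|m IH].
  by rewrite [LHS]/= /prebar /= !mulmx1 /Hbar /slowflow !mulmxA.
rewrite [LHS]/= -/(prodn (Hbar v u) m.+1) IH /Hbar /slowflow.
rewrite [prebar v tt m.+1]/= -/(prebar v tt m) htt.
by rewrite [ulblock _ _ _](ulblockE (v m.+1) (v m)) -/(jmp v m) !mulmxA.
Qed.

Lemma slow_split (s : mode R d) t t' : slowflow s (t + t') = slowflow s t *m slowflow s t'.
Proof.
rewrite /slowflow expmxD !mulmxA; congr (_ *m _ *m _).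
by rewrite -(mulmxA _ (slow s)) [slow s *m _]prUU mulmx1.
Qed.

Lemma slow_delayed (s : mode R d) t T : slowflow s t = slowflow s (t + T) *m slowflow s (- T).
Proof. by rewrite -slow_split addrK. Qed.

Lemma prod_delay (H H' : nat -> 'M[R]_d) (X : 'M[R]_d) m :
  H 0%N = H' 0%N *m X -> (forall i, H i.+1 = H' i.+1) -> prodn H m.+1 = prodn H' m.+1 *m X.
Proof. by move=> h0 hS; rewrite !prodnSr h0 mulmxA; congr (_ *m _ *m _); apply: eq_prodn. Qed.

(** The identity is a Lyapunov form for every matrix, with a crude rate. This bounds the backward
    flows that undo a wait in the first mode. *)
Lemma expmx_growth n (A : 'M[R]_n) C t : N1 A <= C -> 0 <= t ->
  N1 (expmx (t *: A)) <= n%:R * ((n%:R ^+ 2 + n%:R + 1) * expR (n%:R * C * n%:R ^+ 2 * t)).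
Proof.
move=> hA t0.
have n0 : 0 <= n%:R :> R by [].
have C0 : 0 <= C by apply: le_trans hA; exact: N1_ge0.
have c0 : 0 < n%:R ^+ 2 + n%:R + 1 :> R by rewrite ltr_wpDl // addr_ge0 // sqr_ge0.
have bfE (x : 'cV[R]_n) : bf 1%:M x x = \sum_i x i 0 ^+ 2.
  by rewrite /bf mulmx1 mxE; apply: eq_bigr => i _; rewrite mxE expr2.
have b0 (x : 'cV[R]_n) : 0 <= bf 1%:M x x by rewrite bfE; apply: sumr_ge0 => i _; exact: sqr_ge0.
have hx (x : 'cV[R]_n) : N1 x ^+ 2 <= n%:R ^+ 2 * bf 1%:M x x.
  have -> : n%:R ^+ 2 * bf 1%:M x x = (n%:R * enorm x) ^+ 2.
    by rewrite exprMn /enorm -bfE sqr_sqrtr // b0.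
  by apply: lerXn2r; rewrite ?nnegrE ?N1_ge0 ?mulr_ge0 ?sqrtr_ge0 //; exact: N1_le_enorm.
have hl : is_lyap 1%:M A (n%:R * C * n%:R ^+ 2) (n%:R ^+ 2 + n%:R + 1).
  split.
  - exact: trmx1.
  - by rewrite N1_1 addrAC lerDr addr_ge0 // sqr_ge0.
  - move=> x; apply: le_trans (hx x) _; apply: ler_wpM2r => //.
    by rewrite -addrA lerDl addr_ge0.
  - move=> x; apply: le_trans (ler_norm _) _; apply: le_trans (bf_le _ _ _) _.
    rewrite N1_1 -!mulrA; apply: ler_wpM2l => //.
    apply: (@le_trans _ _ (C * N1 x ^+ 2)); last by rewrite (mulrA n%:R n%:R) -expr2; apply: ler_wpM2l => //; exact: hx.
    apply: (@le_trans _ _ (N1 x * (C * N1 x))); last by rewrite mulrCA -expr2.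
    apply: ler_wpM2l; first exact: N1_ge0.
    by apply: le_trans (N1M _ _) _; apply: ler_wpM2r; first exact: N1_ge0.
exact: lyap_exp hl t0.
Qed.

Definition growth (C t : R) : R :=
  d%:R * ((d%:R ^+ 2 + d%:R + 1) * expR (d%:R * C * d%:R ^+ 2 * t)).

End Words.

(** * Bounds on finite words from bounds at large times *)

Section WordBounds.
Variables (R : realType) (d : nat) (K : set (mode R d)).
Implicit Types (v : nat -> mode R d) (u : nat -> R).
Variables (mu' C : R).
Hypothesis C1 : 1 <= C.
Hypothesis hK : forall s, K s -> mode_ok s mu' C.

Let D : R := d%:R.
Let D0 : 0 <= D. Proof. exact: ler0n. Qed.
Let C0 : 0 < C. Proof. exact: lt_le_trans C1. Qed.
Let Cge0 : 0 <= C. Proof. exact: ltW. Qed.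

Lemma N1_jmp v i : K (v i) -> K (v i.+1) -> N1 (jmp v i) <= C ^+ 3.
Proof.
move=> /hK h1 /hK h2; apply: le_trans (N1M3 _ _ _) _.
have -> : C ^+ 3 = C * C * C by rewrite !exprS mulr1 mulrA.
by apply: ler_bound3; rewrite ?N1_ge0 //; [exact: oT h2|exact: oR h1|exact: oTi h1].
Qed.

Lemma N1_slow (s : mode R d) : N1 (slow s) <= D.
Proof. exact: N1_prU. Qed.
Lemma N1_fast (s : mode R d) : N1 (fast s) <= D.
Proof. exact: N1_prD. Qed.
Lemma N1_slowT (s : mode R d) : N1 (slow s)^T <= D.
Proof. by rewrite N1_tr N1_slow. Qed.
Lemma N1_fastT (s : mode R d) : N1 (fast s)^T <= D.
Proof. by rewrite N1_tr N1_fast. Qed.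

Lemma growth_mono a b T : 0 <= b -> 0 <= T -> (a <= d)%N ->
  a%:R * ((a%:R ^+ 2 + a%:R + 1) * expR (a%:R * b * a%:R ^+ 2 * T)) <= growth d b T :> R.
Proof.
move=> b0 T0 ad.
have ad' : a%:R <= d%:R :> R by rewrite ler_nat.
have ad2 : a%:R ^+ 2 <= d%:R ^+ 2 :> R by apply: lerXn2r; rewrite ?nnegrE.
have a2 : 0 <= a%:R ^+ 2 :> R by exact: sqr_ge0.
apply: ler_pM => //.
apply: ler_pM; rewrite ?expR_ge0 //.
- by rewrite lerD2r lerD.
- rewrite ler_expR; apply: ler_wpM2r => //; apply: ler_pM => //; first by rewrite mulr_ge0.
  exact: ler_wpM2r.
Qed.

Lemma growth_ge0 b T : 0 <= growth d b T :> R.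
Proof. by rewrite /growth mulr_ge0 // mulr_ge0 ?expR_ge0 // addr_ge0 // addr_ge0 // sqr_ge0. Qed.

Lemma N1_slowflow_neg (s : mode R d) T : K s -> 0 <= T ->
  N1 (slowflow s (- T)) <= D * growth d C T * D.
Proof.
move=> /hK h T0; apply: le_trans (N1M3 _ _ _) _.
apply: ler_bound3; rewrite ?N1_ge0 ?N1_slow ?N1_slowT //.
rewrite scaleNr -scalerN.
apply: le_trans (expmx_growth (C := C) _ T0) _; first by rewrite N1N; exact: oM h.
apply: growth_mono => //; exact: ltnW (ltn_ord _).
Qed.

Lemma NS_bar_ge0 tau t x : NS_bar K tau t x -> 0 <= x.
Proof. by move=> [s [k [_ _ _ ->]]]; exact: opnorm_ge0. Qed.
Lemma NS_eps_ge0 e tau t x : NS_eps K e tau t x -> 0 <= x.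
Proof. by move=> [s [k [_ _ _ ->]]]; exact: opnorm_ge0. Qed.
Lemma NS_tilde_ge0 t x : NS_tilde K t x -> 0 <= x.
Proof. by move=> [s [F [k [_ _ _ _ ->]]]]; exact: opnorm_ge0. Qed.
Lemma NS_hat_ge0 t x : NS_hat_sw K t x -> 0 <= x.
Proof. by move=> [s [k [_ _ _ _ ->]]]; exact: opnorm_ge0. Qed.

Lemma wtimeS_ge u m T : (forall i, (i < m.+1)%N -> 0 < u i) -> 0 <= T -> T <= wtime (delay T u) m.+1.
Proof. by move=> h T0; rewrite wtime_delay lerDr wtime_ge0. Qed.

Lemma delay_ge T u i : 0 <= T -> u i <= delay T u i.
Proof. by move=> T0; case: i => //=; rewrite lerDl. Qed.

(* Waiting during [T] in the first mode multiplies the flow on the right by an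
   invertible matrix, so a bound for large times gives one for all times. *)
Lemma bar_words tau mu T : 0 <= T ->
  (forall t x, T <= t -> NS_bar K tau t x -> x <= expR (mu * t)) ->
  exists2 C2, 1 <= C2 & forall v u m, (forall i, (i <= m)%N -> K (v i)) ->
    (forall i, (i < m)%N -> [/\ 0 < u i, tau <= u i & v i.+1 <> v i]) ->
    N1 (prodn (Hbar v u) m) <= C2 * expR (mu * wtime u m).
Proof.
move=> T0 hb.
(* From left to right: the last jump and the lift from the last mode, the reduced flow along the
   delayed word, the restriction to the slow part of the first mode, and the flow undoing the
   wait. *)
pose c := C ^+ 3 * D * (D ^+ 2 * expR (mu * T)) * D * (D * growth d C T * D).
have c0 : 0 <= c.
  have g0 := growth_ge0 C T.
  rewrite /c; apply: mulr_ge0; last by rewrite mulr_ge0 // mulr_ge0.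
  apply: mulr_ge0 => //; apply: mulr_ge0; first by rewrite mulr_ge0 // exprn_ge0.
  by rewrite mulr_ge0 ?expR_ge0 // sqr_ge0.
exists (c + D + 1); first by rewrite lerDr addr_ge0.
move=> v u [|m] hv hu.
  rewrite /= N1_1 /wtime big_ord0 mulr0 expR0 mulr1 -/D.
  by rewrite addrAC lerDr addr_ge0.
apply: (@le_trans _ _ (c * expR (mu * wtime u m.+1))); last first.
  by apply: ler_wpM2r; rewrite ?expR_ge0 // -addrA lerDl addr_ge0.
pose u' := delay T u.
have hu0 i : (i < m.+1)%N -> 0 < u i by move=> /hu [].
rewrite (@prod_delay _ _ _ (Hbar v u') (slowflow (v 0%N) (- T))); last 2 first.
- by rewrite /Hbar -mulmxA -slow_delayed.
- by [].
(* The signal stops at [v m], whose piece lasts forever; the flow is measured just before the last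
   jump, which is bounded separately. *)
have adm : admissible K tau (wsig v u' m.+1).
  apply: wsig_admissible => // [i im|i im]; first exact/hv/ltnW.
  have [h1 h2 h3] := hu i (ltnW im).
  by split => //; [apply: lt_le_trans h1 _|apply: le_trans h2 _]; exact: delay_ge.
have pc : in_piece (wsig v u' m.+1) m (wtime u' m.+1).
  split => /=; rewrite ?ltnn ?leqnn //.
  rewrite wtimeS lerDl; apply: ltW; have h1 := hu0 m (ltnSn m).
  by apply: lt_le_trans h1 _; exact: delay_ge.
have tT := wtimeS_ge hu0 T0.
have hop := hb (wtime u' m.+1) _ tT (ex_intro _ (wsig v u' m.+1) (ex_intro _ m
   (And4 adm (le_trans T0 tT) pc erefl))).
have hbar : opnorm (expmx (u' m *: Mmat (v m)) *m prebar v (wtime u') m) <= expR (mu * wtime u' m.+1).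
  by move: hop; rewrite /flowat [sg_time _]/= wtime_dur.
rewrite (bar_lift v m (wtime_dur u')).
apply: le_trans (N1M _ _) _.
have -> : c * expR (mu * wtime u m.+1) =
  (C ^+ 3 * D * (D ^+ 2 * expR (mu * wtime u' m.+1)) * D) * (D * growth d C T * D).
  by rewrite wtime_delay mulrDr expRD /c; ring.
apply: ler_pM; rewrite ?N1_ge0 //; last exact: N1_slowflow_neg (hv _ _) T0.
apply: le_trans (N1M3 _ _ _) _.
apply: ler_bound3; rewrite ?N1_ge0 ?N1_slow //.
  apply: le_trans (N1M _ _) _; apply: ler_pM; rewrite ?N1_ge0 ?N1_slowT //.
  by apply: N1_jmp; apply: hv.
apply: le_trans (N1_le_opnorm _) _; apply: ler_pM; rewrite ?opnorm_ge0 //.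
by rewrite natrM expr2; apply: ler_pM => //; rewrite ler_nat; exact: ltnW (ltn_ord _).
Qed.

Lemma N1_diag0D (s : mode R d) : K s -> N1 (diag0D s) <= D * C * D.
Proof.
move=> /hK h; rewrite diag0DE; apply: le_trans (N1M3 _ _ _) _.
by apply: ler_bound3; rewrite ?N1_ge0 ?N1_fast ?N1_fastT //; exact: oDn h.
Qed.

Lemma hat_preflow v u tt m : (forall k, tt k.+1 - tt k = u k) ->
  preflow (dm := fun _ => d) (fun k t => expmx (t *: diag0D (v k)))
    (fun k => Tmat (v k.+1) *m mR (v k) *m invmx (Tmat (v k))) tt m = prodn (Hhat v u) m.
Proof. by move=> htt; elim: m => //= m ->; rewrite htt mulmxA. Qed.

Lemma hat_word_bound mu T v u m : 0 <= T ->
  (forall t x, T <= t -> NS_hat_sw K t x -> x <= expR (mu * t)) ->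
  (forall i, (i <= m.+1)%N -> K (v i)) ->
  (forall i, (i < m.+1)%N -> 0 < u i /\ v i.+1 <> v i) -> T <= wtime u m.+1 ->
  N1 (prodn (Hhat v u) m.+1) <= D ^+ 2 * expR (mu * wtime u m.+1).
Proof.
move=> T0 hb hv hu tT.
(* One piece more than there are durations, so that the final time is a switching time and its jump
   is included. *)
have adm : admissible K 0 (wsig v u m.+2).
  apply: wsig_admissible => // i im; have [h1 h2] := hu i im.
  by split => //; exact: ltW.
have hop : opnorm (prodn (Hhat v u) m.+1) <= expR (mu * wtime u m.+1).
  rewrite -(hat_preflow v m.+1 (wtime_dur u)); apply: hb tT _.
  by exists (wsig v u m.+2), m.+1; split => //=; rewrite ltnSn.
apply: le_trans (N1_le_opnorm _) _; apply: ler_pM; rewrite ?opnorm_ge0 //.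
by rewrite natrM expr2.
Qed.

Lemma hat_words mu T : 0 <= T ->
  (forall t x, T <= t -> NS_hat_sw K t x -> x <= expR (mu * t)) ->
  exists2 C2, 1 <= C2 & forall v u m, (forall i, (i <= m)%N -> K (v i)) ->
    (forall i, (i < m)%N -> 0 < u i /\ v i.+1 <> v i) ->
    N1 (prodn (Hhat v u) m) <= C2 * expR (mu * wtime u m).
Proof.
move=> T0 hb.
pose g := growth d (D * C * D) T.
have g0 : 0 <= g := growth_ge0 _ _.
pose c := D ^+ 2 * expR (mu * T) * g.
have c0 : 0 <= c by rewrite /c mulr_ge0 // mulr_ge0 ?expR_ge0 // sqr_ge0.
exists (c + D + 1); first by rewrite lerDr addr_ge0.
move=> v u [|m] hv hu.
  rewrite /= N1_1 /wtime big_ord0 mulr0 expR0 mulr1 -/D.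
  by rewrite addrAC lerDr addr_ge0.
apply: (@le_trans _ _ (c * expR (mu * wtime u m.+1))); last first.
  by apply: ler_wpM2r; rewrite ?expR_ge0 // -addrA lerDl addr_ge0.
pose u' := delay T u.
have hu0 i : (i < m.+1)%N -> 0 < u i by move=> /hu [].
rewrite (@prod_delay _ _ _ (Hhat v u') (expmx (- T *: diag0D (v 0%N)))); last 2 first.
- by rewrite /Hhat -mulmxA -expmxD /= addrK.
- by [].
have h1 : N1 (prodn (Hhat v u') m.+1) <= D ^+ 2 * expR (mu * wtime u' m.+1).
  apply: (hat_word_bound T0 hb hv); last exact: wtimeS_ge.
  move=> i im; have [h1 h2] := hu i im; split => //.
  by apply: lt_le_trans h1 _; exact: delay_ge.
have h2 : N1 (expmx (- T *: diag0D (v 0%N))) <= g.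
  rewrite scaleNr -scalerN; apply: expmx_growth => //.
  by rewrite N1N; apply: N1_diag0D; exact: hv.
apply: le_trans (N1M _ _) _; apply: le_trans (ler_pM (N1_ge0 _) (N1_ge0 _) h1 h2) _.
by rewrite wtime_delay mulrDr expRD /c le_eqVlt; apply/orP; left; apply/eqP; ring.
Qed.

Lemma le0_of_decay (a c mu T : R) : mu < 0 -> 0 <= c ->
  (forall t, T <= t -> a <= c * expR (mu * t)) -> a <= 0.
Proof.
move=> m0 c0 h; rewrite leNgt; apply/negP => a0.
pose t := Num.max T ((c / a) / - mu).
have nm : 0 < - mu by rewrite oppr_gt0.
have := h t; rewrite le_max lexx => /(_ isT).
have ht : c / a < expR (- (mu * t)).
  apply: lt_le_trans (expR_ge1Dx _); rewrite ltr_pwDl // -mulNr [leRHS]mulrC -ler_pdivrMr //.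
  by rewrite le_max lexx orbT.
rewrite expRN ltr_pdivrMr // [ltRHS]mulrC ltr_pdivlMr ?expR_gt0 // in ht.
by rewrite leNgt ht.
Qed.

(* Since the slow components are constant along the hat system, its decay at
   switching times forces every jump out of a mode to annihilate them. *)
Lemma jump_kills_slow mu T s s' : 0 <= T -> mu < 0 ->
  (forall t x, T <= t -> NS_hat_sw K t x -> x <= expR (mu * t)) ->
  K s -> K s' -> s' <> s -> mR s *m invmx (Tmat s) *m (slow s)^T = 0.
Proof.
move=> T0 m0 hb Ks Ks' ss'.
(* A single switch from [s] to [s'] after an arbitrarily long time t: the slow block of the product
   does not depend on t, yet tends to 0. *)
pose v (i : nat) := if i is 0%N then s else s'.
have hJ : N1 (jmp v 0%N *m (slow s)^T) <= 0.
  apply: (@le0_of_decay _ (D ^+ 2 * D) mu (Num.max T 1)) => //.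
    by rewrite mulr_ge0 // sqr_ge0.
  move=> t; rewrite ge_max => /andP[Tt t1].
  have w1 : wtime (fun=> t) 1 = t by rewrite /wtime big_ord1.
  have := @hat_word_bound mu T v (fun=> t) 0%N T0 hb; rewrite w1 => hw.
  have {}hw : N1 (prodn (Hhat v (fun=> t)) 1) <= D ^+ 2 * expR (mu * t).
    apply: hw => //; first by case=> [|[|]].
    by case=> // _; split => //; apply: lt_le_trans t1.
  (* [diag0D s] vanishes on the slow space, so its exponential is intertwined there with that of the
     zero matrix. *)
  have e1 : expmx (t *: diag0D s) *m (slow s)^T = (slow s)^T.
    rewrite -(@expmx_intertwine R _ _ (slow s)^T 0 (diag0D s)) ?expmxz ?mulmx1 //.
    by rewrite mulmx0 diag0DE -mulmxA [fast s *m _]prDU mulmx0.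
  have -> : jmp v 0%N *m (slow s)^T = prodn (Hhat v (fun=> t)) 1 *m (slow s)^T.
    by rewrite /= mulmx1 /Hhat -mulmxA e1.
  apply: le_trans (N1M _ _) _; rewrite mulrAC.
  by apply: ler_pM; rewrite ?N1_ge0 ?N1_slowT.
have Tu' := Tunit (oP (hK Ks')).
have hz : jmp v 0%N *m (slow s)^T = 0.
  apply/matrixP => i j; rewrite [RHS]mxE; apply/eqP; rewrite -normr_le0.
  exact: le_trans (N1_entry _ _ _) hJ.
have hz' : Tmat s' *m (mR s *m invmx (Tmat s) *m (slow s)^T) = 0.
  by rewrite -hz -[jmp v 0%N]/(Tmat s' *m mR s *m invmx (Tmat s)) 2!(mulmxA (Tmat s')).
by rewrite -(mulKmx Tu' (mR s *m _ *m _)) hz' mulmx0.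
Qed.

Lemma step_intertwine (T' Rm T E E' P : 'M[R]_d) : T \in unitmx -> T *m E = E' *m T ->
  T' *m (Rm *m (E *m P)) = T' *m Rm *m invmx T *m E' *m (T *m P).
Proof. by move=> Tu hi; rewrite -!mulmxA (mulmxA E') -hi -!mulmxA mulKmx. Qed.

Lemma flow_intertwine (T E E' P : 'M[R]_d) : T \in unitmx -> T *m E = E' *m T ->
  E *m P = invmx T *m E' *m (T *m P).
Proof. by move=> Tu hi; rewrite -mulmxA (mulmxA E') -hi -mulmxA mulKmx. Qed.

(** In the coordinates of each mode the factors [Tmat] telescope; only those at the two ends
    remain. *)
Lemma eps_preflow v u tt e m : e != 0 -> (forall k, tt k.+1 - tt k = u k) ->
  (forall i, (i <= m)%N -> K (v i)) ->
  Tmat (v m) *m preflow (dm := fun _ => d)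
    (fun k t => expmx (t *: (invmx (mP (v k)) *m invmx (Eeps d (ml (v k)) e) *m mL (v k))))
    (fun k => mR (v k)) tt m = prodn (Geps e v u) m *m Tmat (v 0%N).
Proof.
move=> e0 htt; elim: m => [|m IH] hv; first by rewrite /= mulmx1 mul1mx.
have h := hK (hv m (leqnSn m)).
have Tu := Tunit (oP h).
rewrite [preflow _ _ _ _]/= htt [prodn _ _]/= -[RHS]mulmxA -IH; last by move=> i im; exact/hv/ltnW.
rewrite /Geps /jmp.
have hi := expmx_intertwine (u m) (mode_intertwine (oP h) (oD h) e0).
exact: step_intertwine.
Qed.

Lemma eps_flow v u tt e m t : e != 0 -> (forall k, tt k.+1 - tt k = u k) ->
  (forall i, (i <= m)%N -> K (v i)) ->
  flowat (dm := fun _ => d)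
    (fun k t => expmx (t *: (invmx (mP (v k)) *m invmx (Eeps d (ml (v k)) e) *m mL (v k))))
    (fun k => mR (v k)) tt m t =
  invmx (Tmat (v m)) *m expmx ((t - tt m) *: Lmx (piece_of (v m)) e) *m
    (prodn (Geps e v u) m *m Tmat (v 0%N)).
Proof.
move=> e0 htt hv; rewrite -(eps_preflow e0 htt hv) /flowat.
have h := hK (hv m (leqnn m)).
have Tu := Tunit (oP h).
have hi := expmx_intertwine (t - tt m) (mode_intertwine (oP h) (oD h) e0).
exact: flow_intertwine.
Qed.

End WordBounds.

(** * Proof of the theorem *)

Section Cores.
Variables (R : realType) (d : nat) (K : set (mode R d)).
Implicit Types (v : nat -> mode R d) (u : nat -> R).

Let D : R := d%:R.
Let D0 : 0 <= D. Proof. exact: ler0n. Qed.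

Definition word (tau : R) v u m :=
  (forall i, (i <= m)%N -> K (v i)) /\
  (forall i, (i < m)%N -> [/\ 0 < u i, tau <= u i & v i.+1 <> v i]).

Lemma word_sub tau v u m j k : word tau v u m -> (j + k <= m)%N ->
  word tau (fun i => v (i + j)%N) (fun i => u (i + j)%N) k.
Proof.
move=> [h1 h2] jk; split=> i ik.
  by apply: h1; apply: leq_trans jk; rewrite addnC leq_add2l.
by apply: h2; apply: leq_trans jk; rewrite addnC ltn_add2l.
Qed.

Definition durations (s : signal R (mode R d)) i := sg_time s i.+1 - sg_time s i.

Lemma inpieces_le (N : option nat) i k : (i <= k)%N -> inpieces N k -> inpieces N i.
Proof. by case: N => //= n ik; apply: leq_ltn_trans. Qed.

Lemma word_of_signal tau s k t : admissible K tau s -> in_piece s k t ->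
  word tau (sg_val s) (durations s) k.
Proof.
move=> [_ _ h3 h4 _] [pk _ _]; split=> i ik.
  by apply: h3; exact: inpieces_le pk.
have [h5 h6 h7] := h4 i (inpieces_le ik pk).
by split => //; rewrite subr_gt0.
Qed.

Lemma wtime_durations s k : sg_time s 0%N = 0 -> wtime (durations s) k = sg_time s k.
Proof.
move=> h0; elim: k => [|k IH]; first by rewrite /wtime big_ord0 h0.
by rewrite wtimeS IH /durations addrC subrK.
Qed.

Lemma prod_expR (a : R) u k : \prod_(i < k) expR (a * u i) = expR (a * wtime u k).
Proof. by rewrite /wtime mulr_sumr expR_sum. Qed.

(** The piece containing [t] is unfinished and may be shorter than [tau], so it is not a step of the
    word: it is bounded by the growth of one mode, the completed pieces by the product. *)
Lemma eps_bound mu' C tau e nu c B t x : 1 <= C -> (forall s, K s -> mode_ok s mu' C) ->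
  0 < e -> 0 <= c -> 0 <= B ->
  (forall s w, K s -> 0 <= w -> N1 (expmx (w *: Lmx (piece_of s) e)) <= c * expR (nu * w)) ->
  (forall v u m, word tau v u m -> N1 (prodn (Geps e v u) m) <= B * expR (nu * wtime u m)) ->
  NS_eps K e tau t x -> x <= (D * (C * c * (B * C)) + 1) * expR (nu * t).
Proof.
move=> C1 hK e0 c0 B0 hL hG [s [k [adm t0 pk ->]]].
have Cge0 : 0 <= C by apply: le_trans C1.
have hw := word_of_signal adm pk.
have [hv hu] := hw.
have htt i : sg_time s i.+1 - sg_time s i = durations s i by [].
rewrite (eps_flow hK t (lt0r_neq0 e0) htt hv).
apply: le_trans (opnorm_le _) _.
apply: (@le_trans _ _ (D * (C * c * (B * C)) * expR (nu * t))); last first.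
  by apply: ler_wpM2r; rewrite ?expR_ge0 // lerDl.
rewrite -mulrA; apply: ler_wpM2l => //.
have [s0 _ _ _ _] := adm.
have [_ tk _] := pk.
have Kk := hv k (leqnn k).
have K0 := hv 0%N isT.
have -> : C * c * (B * C) * expR (nu * t) =
  C * (c * expR (nu * (t - sg_time s k))) * (B * expR (nu * wtime (durations s) k) * C).
  have -> : expR (nu * t) = expR (nu * (t - sg_time s k)) * expR (nu * wtime (durations s) k).
    by rewrite -expRD wtime_durations //; congr expR; ring.
  by ring.
apply: le_trans (N1M3 _ _ _) _.
apply: ler_bound3; rewrite ?N1_ge0 //.
- exact: oTi (hK _ Kk).
- by apply: hL => //; rewrite subr_ge0.
- apply: le_trans (N1M _ _) _; apply: ler_pM; rewrite ?N1_ge0 //; first exact: hG.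
  exact: oT (hK _ K0).
Qed.

Lemma spectral_of_constant (NS : R -> set R) mu T (s : mode R d) : 0 < T ->
  (forall t, 0 <= t -> NS t (opnorm (expmx (t *: Mmat s)))) ->
  (forall t x, T <= t -> NS t x -> x <= expR (mu * t)) ->
  forall z, eigenvalue (map_mx (fun x : R => (x%:C)%C) (Mmat s)) z -> complex.Re z <= mu.
Proof.
move=> T0 hc hb; apply: (@spectral_bound _ _ _ mu ((ml s * ml s)%:R + 1) T).
  by rewrite ltr_wpDl.
move=> t Tt; apply: le_trans (N1_le_opnorm _) _.
have h := hb t _ Tt (hc t (le_trans (ltW T0) Tt)).
apply: ler_pM; rewrite ?opnorm_ge0 //; by rewrite lerDl.
Qed.

Lemma constant_admissible tau s : K s -> admissible K tau (wsig (fun=> s) (fun=> 0) 1).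
Proof. by move=> Ks; apply: wsig_admissible. Qed.

Lemma constant_piece s t : 0 <= t -> in_piece (wsig (fun=> s : mode R d) (fun=> 0) 1) 0 t.
Proof. by move=> t0; split => //=; rewrite /wtime big_ord0. Qed.

Lemma NS_bar_constant tau (s : mode R d) t : K s -> 0 <= t -> NS_bar K tau t (opnorm (expmx (t *: Mmat s))).
Proof.
move=> Ks t0; exists (wsig (fun=> s) (fun=> 0) 1), 0%N.
split => //; [exact: constant_admissible|exact: constant_piece|].
by rewrite /flowat /= mulmx1 /wtime big_ord0 subr0.
Qed.

Lemma NS_tilde_constant (s : mode R d) t : K s -> 0 <= t -> NS_tilde K t (opnorm (expmx (t *: Mmat s))).
Proof.
move=> Ks t0; exists (wsig (fun=> s) (fun=> 0) 1), (fun=> 1%:M), 0%N.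
split => //; [exact: constant_admissible|by left|exact: constant_piece|].
by rewrite /flowat /= mulmx1 /wtime big_ord0 subr0.
Qed.

Section WithK.
Hypothesis hP : forall s, K s -> mP s \in unitmx.
Hypothesis hcpt : forall l : 'I_d,
  compact [set p : 'M[R]_d * ('M[R]_d * 'M[R]_d) | K (Mode l p.1 p.2.1 p.2.2)].
Hypothesis hH : forall s, K s -> Hurwitz (Dblk s).

(** This is where the dwell time acts: exp(-y) <= 1 / y with y at least tau / (2 e C) makes the fast
    transient of order [e]. *)
Lemma fast_negligible (C m e tau u : R) : 0 < C -> 0 < e -> 0 < tau -> tau <= u ->
  2 * `|m| <= (e * C)^-1 ->
  expR (- (u / (e * C))) <= 2 * C / tau * e * expR (m * u).
Proof.
move=> C0 e0 tau0 tu hm.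
have eC : 0 < e * C by rewrite mulr_gt0.
have u0 : 0 < u by apply: lt_le_trans tu.
have -> : expR (- (u / (e * C))) = expR (- (((e * C)^-1 + m) * u)) * expR (m * u).
  by rewrite -expRD; congr expR; ring.
apply: ler_wpM2r; first exact: expR_ge0.
have hy : tau / (2 * (e * C)) <= ((e * C)^-1 + m) * u.
  have -> : tau / (2 * (e * C)) = (e * C)^-1 / 2 * tau by rewrite invfM; ring.
  apply: ler_pM => //; rewrite ?divr_ge0 ?invr_ge0 ?(ltW eC) ?(ltW tau0) //.
  have := ler_norm (- m); rewrite normrN; move: hm; lra.
have t0 : 0 < tau / (2 * (e * C)) by rewrite divr_gt0 // mulr_gt0.
rewrite expRN.
have -> : 2 * C / tau * e = (tau / (2 * (e * C)))^-1 by rewrite invf_div; ring.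
rewrite lef_pV2 ?posrE ?expR_gt0 //.
apply: le_trans hy _; apply: le_trans (expR_ge1Dx _); by rewrite lerDr.
Qed.

(** The reference has no fast part, so the whole fast flow counts as error. The constant collects
    the slow and fast Duhamel errors ([2 * c]) and the negligible transient
    ([c * (2 * C / tau)]). *)
Lemma bar_step_diff mu' C nu c e tau v u i : 1 <= C -> (forall s, K s -> mode_ok s mu' C) ->
  0 < e -> 0 < tau -> tau <= u i -> 0 <= c -> K (v i) -> K (v i.+1) ->
  2 * `|nu| <= (e * C)^-1 ->
  N1 (slow (v i) *m expmx (u i *: Lmx (piece_of (v i)) e) - expmx (u i *: Mmat (v i)) *m slow (v i))
    <= c * e * expR (nu * u i) ->
  N1 (fast (v i) *m expmx (u i *: Lmx (piece_of (v i)) e) - expmx (u i / e *: Dblk (v i)) *m fast (v i))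
    <= c * e * expR (nu * u i) ->
  N1 (expmx (u i / e *: Dblk (v i)) *m fast (v i)) <= c * expR (- (u i / (e * C))) ->
  N1 (Geps e v u i - Hbar v u i) <=
    C ^+ 3 * (D * (2 * c + c * (2 * C / tau))) * e * expR (nu * u i).
Proof.
move=> C1 hK e0 tau0 tu c0 Ki Ki1 hnu f1 f2 f3.
have C0 : 0 < C by apply: lt_le_trans C1.
have hneg := fast_negligible C0 e0 tau0 tu hnu.
set E := expmx (u i *: Lmx _ _) in f1 f2 *.
rewrite /Geps /Hbar -mulmxBr -/E.
apply: le_trans (N1M _ _) _; rewrite -2!mulrA; apply: ler_pM; rewrite ?N1_ge0 //.
  exact: N1_jmp hK _ _ Ki Ki1.
have -> : E - slowflow (v i) (u i) =
  (slow (v i))^T *m (slow (v i) *m E - expmx (u i *: Mmat (v i)) *m slow (v i)) +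
  (fast (v i))^T *m ((fast (v i) *m E - expmx (u i / e *: Dblk (v i)) *m fast (v i))
    + expmx (u i / e *: Dblk (v i)) *m fast (v i)).
  rewrite subrK mulmxBr /slowflow !mulmxA addrAC -mulmxDl.
  by rewrite [_ + _ *m _](prsum _ (split_eq (ml (v i)))) mul1mx.
apply: le_trans (N1D _ _) _.
have -> : D * (2 * c + c * (2 * C / tau)) * (e * expR (nu * u i)) =
  D * (c * e * expR (nu * u i)) + D * (c * e * expR (nu * u i) + c * (2 * C / tau * e * expR (nu * u i))).
  by ring.
apply: lerD.
  apply: le_trans (N1M _ _) _; apply: ler_pM; rewrite ?N1_ge0 //; exact: N1_slowT.
apply: le_trans (N1M _ _) _; apply: ler_pM; rewrite ?N1_ge0 //; first exact: N1_fastT.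
apply: le_trans (N1D _ _) _; apply: lerD => //.
by apply: le_trans f3 _; apply: ler_wpM2l.
Qed.

Lemma core_bar tau mu0 mu : 0 < tau -> (lyap (NS_bar K tau) < mu0%:E)%E -> mu0 < mu ->
  exists e0 C, [/\ 0 < e0, 0 < C & forall e t x, 0 < e -> e < e0 -> 0 <= t ->
     NS_eps K e tau t x -> x <= C * expR (mu * t)].
Proof.
move=> tau0 hl hmu.
have [T T0 hT] := lyap_lt_bound (@NS_bar_ge0 _ _ K tau) hl.
(* [m1] lies strictly above all spectral abscissae, [m2] is the rate of the one-step estimates, and
   mu - m2 absorbs the accumulated errors. *)
pose m1 := mu0 + (mu - mu0) / 3; pose m2 := mu0 + 2 * (mu - mu0) / 3.
have m01 : mu0 < m1 by rewrite /m1; lra.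
have m12 : m1 < m2 by rewrite /m1 /m2; lra.
have m2m : m2 < mu by rewrite /m2; lra.
have hM s : K s -> forall z, eigenvalue (map_mx (fun x : R => (x%:C)%C) (Mmat s)) z -> complex.Re z < m1.
  move=> Ks z hz; apply: le_lt_trans m01.
  exact: (spectral_of_constant T0 (fun t t0 => NS_bar_constant tau Ks t0) hT hz).
have [C C1 hK] := mode_ok_uniform hP hcpt hH hM.
have C0 : 0 < C by apply: lt_le_trans C1.
have [e0 [c [e00 c1 hone]]] := one_piece d C1 m12.
have c0 : 0 <= c by apply: le_trans c1.
have [C2 C21 hbar] := bar_words C1 hK (ltW T0) hT.
have C20 : 0 <= C2 by apply: le_trans C21.
pose q0 := C ^+ 3 * (D * (2 * c + c * (2 * C / tau))).
have q00 : 0 <= q0.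
  have h1 : 0 <= 2 * C / tau by rewrite divr_ge0 ?mulr_ge0 ?(ltW C0) ?(ltW tau0).
  by rewrite /q0 mulr_ge0 ?exprn_ge0 ?(ltW C0) // mulr_ge0 // addr_ge0 // mulr_ge0.
have g0 : 0 < mu - m2 by rewrite subr_gt0.
have k0 : 0 < C2 * q0 + 1 by rewrite ltr_wpDl // mulr_ge0.
have n0 : 0 < C * (2 * `|m2| + 1) by rewrite mulr_gt0 // ltr_wpDl // mulr_ge0.
(* In order: validity of [one_piece], the hypothesis of [fast_negligible], and C2 q0 e <= (mu - m2)
   tau, so that 1 + C2 q0 e <= exp((mu - m2) u) on every step of length u >= tau. *)
pose e1 := Num.min e0 (Num.min (C * (2 * `|m2| + 1))^-1 ((mu - m2) * tau / (C2 * q0 + 1))).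
exists e1, (D * (C * c * (D * C2 * C)) + 1); split.
- by rewrite !lt_min e00 invr_gt0 n0 divr_gt0 // mulr_gt0.
- by rewrite ltr_wpDl // !mulr_ge0 // ltW.
move=> e t x ep; rewrite !lt_min => /and3P[ee0 ee1 ee2] t0.
have hnu : 2 * `|m2| <= (e * C)^-1.
  apply: (@le_trans _ _ (2 * `|m2| + 1)); first by rewrite lerDl.
  rewrite -[leLHS]invrK lef_pV2 ?posrE ?invr_gt0 ?mulr_gt0 // ?ltr_wpDl ?mulr_ge0 //.
  by move: ee1; rewrite invfM mulrC ltr_pdivlMr // => /ltW.
have hke : C2 * (q0 * e) <= (mu - m2) * tau.
  move: ee2; rewrite ltr_pdivlMr // => /ltW; apply: le_trans.
  by rewrite mulrDr mulr1 mulrA [leRHS]addrC (mulrC e) ler_wpDl // ltW.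
have hexp w : 0 <= w -> expR (m2 * w) <= expR (mu * w).
  by move=> w0; rewrite ler_expR; apply: ler_wpM2r => //; exact: ltW.
have hX s : K s -> piece_ok (piece_of s) m1 C by move=> /hK /opiece.
apply: (eps_bound C1 hK ep c0) => //; first by rewrite mulr_ge0.
  move=> s w Ks w0; have [f1 _ _ _ _] := hone _ e w (hX _ Ks) ep ee0 w0.
  by apply: le_trans f1 _; apply: ler_wpM2l => //; exact: hexp.
move=> v u m hw; have [hv hu] := hw.
rewrite -prod_expR -mulrA.
apply: (@prodn_perturb _ _ (Hbar v u) (Geps e v u) (fun i => expR (m2 * u i))
   (fun i => expR (mu * u i)) (fun i => q0 * e * expR (m2 * u i)) C2 m).
- by move=> i; exact: expR_gt0.
- by move=> i; exact: expR_ge0.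
- by [].
- move=> j k jk; have [hv' hu'] := word_sub hw jk.
  rewrite (prod_expR m2 (fun i => u (i + j)%N)); apply: le_trans (hbar _ _ k hv' hu') _.
  apply: ler_wpM2l => //; rewrite ler_expR; apply: ler_wpM2r; last by apply: ltW; apply: lt_trans m12.
  by apply: wtime_ge0 => i /hu' [].
- move=> i im; have [u0 tu _] := hu i im.
  have [_ f2 _ f4 f5] := hone _ e (u i) (hX _ (hv i (ltnW im))) ep ee0 (ltW u0).
  by apply: (bar_step_diff C1 hK) => //; apply: hv => //; exact: ltnW.
- move=> i im; have [u0 tu _] := hu i im.
  rewrite mulrA -{1}[expR (m2 * u i)]mul1r -mulrDl.
  have -> : expR (mu * u i) = expR ((mu - m2) * u i) * expR (m2 * u i).
    by rewrite -expRD; congr expR; ring.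
  apply: ler_wpM2r; first exact: expR_ge0.
  apply: le_trans (expR_ge1Dx _); rewrite lerD2l; apply: le_trans hke _.
  by apply: ler_wpM2l => //; exact: ltW.
Qed.

(** With z = min(u / e, 1) the error is proportional to [e * z], and the decay leaves a factor at
    most 1 / (1 + del z / 2). This convex function of z lies below its chord on [0, 1], whose slope
    is -del / (2 + del): hence the threshold on [e]. The other condition keeps del + e mu at least
    del / 2. *)
Lemma rate_absorb (del k e mu u : R) : 0 < del -> 0 <= k -> 0 < e -> 0 < u ->
  e * (k + 1) <= del / (2 + del) -> e * (2 * (`|mu| + 1)) <= del ->
  expR (- del * (u / e)) + k * (Num.min u e * expR (mu * u)) <= expR (mu * u).
Proof.
move=> d0 k0 e0 u0 h1 h2.
have -> : expR (- del * (u / e)) = expR (- ((del / e + mu) * u)) * expR (mu * u).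
  by rewrite -expRD; congr expR; ring.
rewrite mulrA -mulrDl -[leRHS]mul1r; apply: ler_wpM2r; first exact: expR_ge0.
pose z := Num.min (u / e) 1.
have z0 : 0 < z by rewrite lt_min ltr01 divr_gt0.
have z1 : z <= 1 by rewrite ge_min lexx orbT.
have zu : z <= u / e by rewrite ge_min lexx.
have -> : Num.min u e = e * z.
  by rewrite /z minr_pMr ?(ltW e0) // mulr1 mulrCA mulfV ?mulr1 // gt_eqF.
have hy : del * z / 2 <= (del / e + mu) * u.
  have h3 : del / 2 <= del + e * mu.
    have : - (e * mu) <= e * `|mu|.
      by rewrite -mulrN; apply: ler_wpM2l; [exact: ltW|rewrite -normrN ler_norm].
    have : 0 <= e by exact: ltW.
    move: h2; rewrite mulrCA mulrDr mulr1; lra.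
  have -> : (del / e + mu) * u = (del + e * mu) * (u / e) by field; rewrite gt_eqF.
  rewrite mulrAC; apply: ler_pM => //; try exact: ltW.
  by rewrite divr_ge0 // ltW.
have p0 : 0 < 1 + del * z / 2 by rewrite ltr_pwDl // divr_ge0 // mulr_ge0 // ltW.
have hE : expR (- ((del / e + mu) * u)) <= (1 + del * z / 2)^-1.
  rewrite expRN lef_pV2 ?posrE ?expR_gt0 //; apply: le_trans (expR_ge1Dx _).
  by rewrite lerD2l.
have hk : k * (e * z) <= del / (2 + del) * z.
  rewrite mulrA; apply: ler_wpM2r; first exact: ltW.
  apply: le_trans h1; rewrite mulrC mulrDr mulr1 lerDl; exact: ltW.
apply: le_trans (lerD hE hk) _.
have p2 : 0 < 2 + del by rewrite ltr_pwDl // ltW.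
rewrite -subr_ge0.
have -> : 1 - ((1 + del * z / 2)^-1 + del / (2 + del) * z) =
  del ^+ 2 * z * (1 - z) / ((2 + del * z) * (2 + del)).
  by field; rewrite !gt_eqF //; move: p0; lra.
rewrite divr_ge0 // !mulr_ge0 ?subr_ge0 ?sqr_ge0 ?addr_ge0 ?mulr_ge0 // ltW //.
Qed.

(** The jump annihilates the slow component, whose error is not controlled by min(u, e); only the
    fast difference survives, and the smaller of its two bounds is taken. *)
Lemma hat_step_diff mu' C nu c e mu T v u i : 1 <= C -> (forall s, K s -> mode_ok s mu' C) ->
  0 < e -> 0 < u i -> 0 <= T -> mu < 0 -> (forall t x, T <= t -> NS_hat_sw K t x -> x <= expR (mu * t)) ->
  K (v i) -> K (v i.+1) -> v i.+1 <> v i ->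
  N1 (fast (v i) *m expmx (u i *: Lmx (piece_of (v i)) e) - expmx (u i / e *: Dblk (v i)) *m fast (v i))
    <= c * u i * expR (nu * u i) ->
  N1 (fast (v i) *m expmx (u i *: Lmx (piece_of (v i)) e) - expmx (u i / e *: Dblk (v i)) *m fast (v i))
    <= c * e * expR (nu * u i) ->
  N1 (Geps e v u i - Hhat v (fun i => u i / e) i) <=
    C ^+ 3 * D * c * (Num.min (u i) e * expR (nu * u i)).
Proof.
move=> C1 hK e0 u0 T0 m0 hb Ki Ki1 hne f1 f2.
have C0 : 0 < C by apply: lt_le_trans C1.
set E := expmx (u i *: Lmx _ _) in f1 f2 *.
rewrite /Geps /Hhat -mulmxBr -/E.
have hk := jump_kills_slow hK T0 m0 hb Ki Ki1 hne.
have hj : jmp v i *m (slow (v i))^T = 0.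
  by rewrite -[jmp v i]/(Tmat (v i.+1) *m mR (v i) *m invmx (Tmat (v i))) -2!(mulmxA (Tmat (v i.+1))) hk mulmx0.
have hF : fast (v i) *m expmx (u i / e *: diag0D (v i)) = expmx (u i / e *: Dblk (v i)) *m fast (v i).
  by apply: expmx_intertwine; rewrite diag0DE !mulmxA [fast (v i) *m _]prDD mul1mx.
have -> : jmp v i *m (E - expmx (u i / e *: diag0D (v i))) =
  jmp v i *m (fast (v i))^T *m (fast (v i) *m E - expmx (u i / e *: Dblk (v i)) *m fast (v i)).
  rewrite -hF -mulmxBr.
  set Y := E - _.
  rewrite -{1}[Y]mul1mx -(prsum _ (split_eq (ml (v i)))) -/(slow (v i)) -/(fast (v i)) mulmxDl mulmxDr.
  by rewrite !(mulmxA (jmp v i)) hj !mul0mx add0r !mulmxA.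
apply: le_trans (N1M3 _ _ _) _.
rewrite -(mulrA (_ * D)); apply: ler_pM; rewrite ?mulr_ge0 ?N1_ge0 //.
  apply: ler_pM; rewrite ?N1_ge0 ?N1_fastT //; exact: N1_jmp hK _ _ Ki Ki1.
by rewrite mulrA; case: (leP (u i) e).
Qed.

Lemma core_tilde mu0 mu : (lyap_tilde_hat K < 0%:E)%E -> (lyap (NS_tilde K) < mu0%:E)%E -> mu0 < mu ->
  exists e0 C, [/\ 0 < e0, 0 < C & forall e t x, 0 < e -> e < e0 -> 0 <= t ->
     NS_eps K e 0 t x -> x <= C * expR (mu * t)].
Proof.
move=> /lte_real_between [mh hmh mh0] hl hmu.
have [Th Th0 hTh] := @lyap_lt_bound _ (NS_hat_sw K) mh (@NS_hat_ge0 _ _ K) hmh.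
have [T T0 hT] := lyap_lt_bound (@NS_tilde_ge0 _ _ K) hl.
pose m1 := (mu0 + mu) / 2.
have m01 : mu0 < m1 by rewrite /m1; lra.
have m1m : m1 < mu by rewrite /m1; lra.
have hM s : K s -> forall z, eigenvalue (map_mx (fun x : R => (x%:C)%C) (Mmat s)) z -> complex.Re z < m1.
  move=> Ks z hz; apply: le_lt_trans m01.
  exact: (spectral_of_constant T0 (fun t t0 => NS_tilde_constant Ks t0) hT hz).
have [C C1 hK] := mode_ok_uniform hP hcpt hH hM.
have C0 : 0 < C by apply: lt_le_trans C1.
have [e0 [c [e00 c1 hone]]] := one_piece d C1 m1m.
have c0 : 0 <= c by apply: le_trans c1.
have [C2 C21 hhat] := hat_words hK (ltW Th0) hTh.
have C20 : 0 <= C2 by apply: le_trans C21.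
pose q0 := C ^+ 3 * D * c.
have q00 : 0 <= q0 by rewrite /q0 mulr_ge0 // mulr_ge0 // exprn_ge0 // ltW.
pose del := - mh.
have del0 : 0 < del by rewrite oppr_gt0.
have k0 : 0 < C2 * q0 + 1 by rewrite ltr_wpDl // mulr_ge0.
have n0 : 0 < 2 * (`|mu| + 1) by rewrite mulr_gt0 // ltr_wpDl.
have a0 : 0 < del / (2 + del) by rewrite divr_gt0 // ltr_pwDl // ltW.
(* Besides the validity of [one_piece], the two conditions are those of [rate_absorb] with k = C2
   q0. *)
pose e1 := Num.min e0 (Num.min (del / (2 + del) / (C2 * q0 + 1)) (del / (2 * (`|mu| + 1)))).
exists e1, (D * (C * c * (D * C2 * C)) + 1); split.
- by rewrite !lt_min e00 !divr_gt0 // ltr_pwDl // ltW.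
- by rewrite ltr_wpDl // !mulr_ge0 // ltW.
move=> e t x ep; rewrite !lt_min => /and3P[ee0 ee1 ee2] t0.
have h1 : e * (C2 * q0 + 1) <= del / (2 + del) by rewrite -ler_pdivlMr // ltW.
have h2 : e * (2 * (`|mu| + 1)) <= del by rewrite -ler_pdivlMr // ltW.
have hX s : K s -> piece_ok (piece_of s) m1 C by move=> /hK /opiece.
apply: (eps_bound C1 hK ep c0) => //; first by rewrite mulr_ge0.
  by move=> s w Ks w0; have [] := hone _ e w (hX _ Ks) ep ee0 w0.
move=> v u m hw; have [hv hu] := hw.
rewrite -prod_expR -mulrA.
(* The reference runs in the time u / e with a negative rate [mh], while the target rate [mu] is in
   the original time; the surplus of decay is what pays for the errors. *)
apply: (@prodn_perturb _ _ (Hhat v (fun i => u i / e)) (Geps e v u) (fun i => expR (mh * (u i / e)))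
   (fun i => expR (mu * u i)) (fun i => q0 * (Num.min (u i) e * expR (mu * u i))) C2 m).
- by move=> i; exact: expR_gt0.
- by move=> i; exact: expR_ge0.
- by [].
- move=> j k jk; have [hv' hu'] := word_sub hw jk.
  rewrite (prod_expR mh (fun i => u (i + j)%N / e)).
  apply: (hhat (fun i => v (i + j)%N) (fun i => u (i + j)%N / e) k hv') => i /hu' [u0 _ hne].
  by split => //; rewrite divr_gt0.
- move=> i im; have [u0 _ hne] := hu i im.
  have [_ _ f3 f4 _] := hone _ e (u i) (hX _ (hv i (ltnW im))) ep ee0 (ltW u0).
  by apply: (hat_step_diff C1 hK ep u0 (ltW Th0) mh0 hTh) => //; apply: hv => //; exact: ltnW.
- move=> i im; have [u0 _ _] := hu i im.
  rewrite mulrA; have := rate_absorb del0 (mulr_ge0 C20 q00) ep u0 h1 h2.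
  by rewrite /del opprK.
Qed.

End WithK.
End Cores.

Theorem theorem2 (R : realType) (d : nat) (K : set (mode R d)) :
  (2 <= d)%N ->
  (* K is a subset of {1,...,d-1} x GL(d,R) x M_d(R) x M_d(R) ... *)
  (forall s, K s -> (0 < ml s)%N /\ mP s \in unitmx) ->
  (* ... and is compact (each slice l = const is compact) *)
  (forall l : 'I_d,
     compact [set p : 'M[R]_d * ('M[R]_d * 'M[R]_d) | K (Mode l p.1 p.2.1 p.2.2)]) ->
  (* D-Hurwitz assumption *)
  (forall s, K s -> Hurwitz (Dblk s)) ->
  (forall tau : R, 0 < tau ->
     (limsup_0plus (fun e => lyap (NS_eps K e tau)) <= lyap (NS_bar K tau))%E /\
     (ES (NS_bar K tau) ->
        exists e0 : R, 0 < e0 /\ forall e : R, 0 < e < e0 -> ES (NS_eps K e tau)))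
  /\
  ((lyap_tilde_hat K < 0%:E)%E ->
     (limsup_0plus (fun e => lyap (NS_eps K e 0)) <= lyap (NS_tilde K))%E /\
     (ES (NS_tilde K) ->
        exists e0 : R, 0 < e0 /\ forall e : R, 0 < e < e0 -> ES (NS_eps K e 0))).
Proof.
move=> _ hK hcpt hH; have hP s : K s -> mP s \in unitmx by move=> /hK [].
split=> [tau tau0|hhat].
  apply: singular_limit; [exact: NS_bar_ge0|by move=> e; exact: NS_eps_ge0|].
  by move=> mu0 mu; exact: core_bar.
apply: singular_limit; [exact: NS_tilde_ge0|by move=> e; exact: NS_eps_ge0|].
by move=> mu0 mu; exact: core_tilde.
Qed.
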